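(* Let $G$ be a (discrete) group, and let $\omega$ be a weight on $G$. Then $\ell^1(G,\omega)$ is an injective Banach algebra if and only if it is isomorphic to an operator algebra.
   Context: A weight on $G$ is a function $\omega:G\to(0,\infty)$ with $\omega(xy)\le\omega(x)\omega(y)$ for all $x,y\in G$. The weighted group algebra $\ell^1(G,\omega)$ is the convolution algebra of functions $g:G\to\mathbb{C}$ with $\|g\|=\sum_{x\in G}|g(x)|\omega(x)<\infty$. A Banach algebra $\mathcal{A}$ is an injective algebra if its multiplication extends to a bounded linear map $\mathcal{A}\otimes_\varepsilon\mathcal{A}\to\mathcal{A}$ on the injective Banach space tensor product. An operator algebra is a norm-closed subalgebra of $B(H)$ for a Hilbert space $H$. A Banach algebra is isomorphic to an operator algebra if there is a bounded algebra isomorphism with bounded inverse from it onto an operator algebra. *)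

(* Defs.v *)
From HB Require Import structures.
From mathcomp Require Import all_boot all_order all_algebra.
From mathcomp Require Import all_classical all_reals all_analysis.
From mathcomp Require Import complex ring lra.

Set Implicit Arguments.
Unset Strict Implicit.
Unset Printing Implicit Defensive.

Import Order.TTheory GRing.Theory Num.Theory.
Import numFieldNormedType.Exports.
Import ComplexField.Normc.

Local Open Scope classical_set_scope.
Local Open Scope ring_scope.
Local Open Scope complex_scope.

Section ComplexNorm.
Variable R : realType.
Implicit Types (z : R[i]) (V : normedModType R[i]).

(* Norms on a [normedModType R[i]] take their (real) values in R[i]; [rnorm] is
   the same number in R. *)
Definition rnorm V (v : V) : R := complex.Re `|v|.

Lemma normE V (v : V) : `|v| = (rnorm v)%:C.
Proof. by rewrite RRe_real// realE normr_ge0. Qed.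

Lemma rnorm_ge0 V (v : V) : 0 <= rnorm v.
Proof. by rewrite -ler0c -normE. Qed.

Lemma normc_ge0 z : 0 <= normc z.
Proof. by case: z => a b; exact: Num.Theory.sqrtr_ge0. Qed.

Lemma normcD z1 z2 : normc (z1 + z2) <= normc z1 + normc z2.
Proof. exact: le_normcD. Qed.

Lemma normcB z1 z2 : normc (z1 - z2) = normc (z2 - z1).
Proof. by rewrite -opprB normcN. Qed.

Lemma normc_real (a : R) : normc a%:C = `|a|.
Proof. by rewrite /= expr0n/= addr0 sqrtr_sqr. Qed.

Lemma Re_le_normc z : `|complex.Re z| <= normc z.
Proof. by rewrite -lecR; exact: normc_ge_Re. Qed.

Lemma Im_le_normc z : `|complex.Im z| <= normc z.
Proof.
by case: z => a b /=; rewrite -sqrtr_sqr ler_wsqrtr// lerDr sqr_ge0.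
Qed.

Lemma normc_le z : normc z <= `|complex.Re z| + `|complex.Im z|.
Proof.
rewrite [z in normc z]complexE (le_trans (normcD _ _))// normc_real.
by rewrite normcM normc_real /= expr0n/= add0r expr1n sqrtr1 mul1r.
Qed.

Lemma ReB z1 z2 : complex.Re (z1 - z2) = complex.Re z1 - complex.Re z2.
Proof. by case: z1 z2 => [? ?] [? ?]. Qed.

Lemma ImB z1 z2 : complex.Im (z1 - z2) = complex.Im z1 - complex.Im z2.
Proof. by case: z1 z2 => [? ?] [? ?]. Qed.

End ComplexNorm.

Section Completeness.
Variables (R : realType) (I : Type) (V : normedModType R[i]).
Variables (ev : V -> I -> R[i]) (S : set (seq (I * R))).
Local Notation semi s a := (\sum_(p <- s) p.2 * normc (a p.1)).
Hypothesis evB : forall f g i, ev (f - g) i = ev f i - ev g i.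
Hypothesis S0 : forall s, S s -> all (fun p => 0 <= p.2) s.
Hypothesis nE : forall f (e : R), 0 <= e ->
  rnorm f <= e <-> forall s, S s -> semi s (ev f) <= e.
Hypothesis cover : forall i, exists2 c : R, 0 < c &
  forall f, normc (ev f i) <= c * rnorm f.
Hypothesis evcl : forall h : I -> R[i],
  (forall e : R, 0 < e -> exists f, forall s, S s ->
     semi s (fun i => ev f i - h i) <= e) -> exists g, ev g = h.

(* Common completeness argument for norms of the form
   sup over s in S of sum_((i, c) in s) c * |f i|, on function spaces. *)
Lemma complete_criterion (F : set_system V) :
  ProperFilter F -> cauchy F -> cvg F.
Proof.
move=> FF Fc.
have Fball (e : R) : 0 < e -> exists x, \forall f \near F, rnorm (x - f) < e.
  move=> e0; have /cauchyP/(_ e%:C) := Fc.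
  rewrite ltcR => /(_ e0)[x Fx]; exists x; near=> f.
  have : ball x e%:C f by near: f.
  by rewrite -ball_normE/= normE ltcR.
have coord (p : R[i] -> R) i : (forall z1 z2, p (z1 - z2) = p z1 - p z2) ->
    (forall z, `|p z| <= normc z) ->
    exists l : R, forall e, 0 < e -> \forall f \near F, `|l - p (ev f i)| <= e.
  move=> pB pn.
  have /cvg_ex[l Fl] : cvg ((fun f => p (ev f i)) @ F).
    apply: cauchy_cvg; apply/cauchyP => e e0.
    have [c c0 hc] := cover i.
    have [|x Fx] := Fball (e / c); first by rewrite divr_gt0.
    exists (p (ev x i)).
    change (\forall f \near F, ball (p (ev x i)) e (p (ev f i))); near=> f.
    rewrite /ball/= -pB -evB (le_lt_trans (pn _))// (le_lt_trans (hc _))//.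
    by rewrite mulrC -ltr_pdivlMr//; near: f.
  exists l => e e0; move/cvgrPdist_le : Fl => /(_ e e0); exact.
have {coord} /choice[h hh] i : exists z : R[i], forall e, 0 < e ->
    \forall f \near F, normc (ev f i - z) <= e.
  have [lr hr] := coord (@complex.Re R) i (@ReB R) (@Re_le_normc R).
  have [li hi] := coord (@complex.Im R) i (@ImB R) (@Im_le_normc R).
  exists (Complex lr li) => e e0; near=> f.
  rewrite normcB (le_trans (normc_le _))// [e]splitr lerD//.
    rewrite ReB; near: f; apply: hr; by rewrite divr_gt0.
  rewrite ImB; near: f; apply: hi; by rewrite divr_gt0.
have hsemi s : S s -> forall e, 0 < e ->
    \forall f \near F, semi s (fun i => ev f i - h i) <= e.
  move=> /S0; elim: s => [|[i w] s IH] s0 e e0.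
    by near=> f; rewrite big_nil ltW.
  have /andP[/= w0 {}s0] := s0.
  have w1 : 0 < w + 1 by rewrite ltr_wpDl.
  near=> f; rewrite big_cons/= [e]splitr lerD//.
    rewrite (@le_trans _ _ ((w + 1) * normc (ev f i - h i)))//.
      by rewrite ler_wpM2r ?normc_ge0// lerDl.
    rewrite mulrC -ler_pdivlMr//; near: f; apply: hh.
    by rewrite !divr_gt0.
  by near: f; apply: IH => //; rewrite divr_gt0.
have Fh (e : R) : 0 < e -> \forall f \near F, forall s, S s ->
    semi s (fun i => ev f i - h i) <= e.
  move=> e0; have [|x Fx] := Fball (e / 2); first by rewrite divr_gt0.
  near=> f => s Ss; apply/ler_addgt0Pr => d d0.
  near F => g.
  have fg : rnorm (f - g) <= e.
    rewrite -lecR -normE (le_trans (ler_distD x _ _))// !normE -rmorphD lecR.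
    rewrite [e]splitr lerD//; last by rewrite ltW//; near: g.
    by rewrite -lecR -normE distrC normE lecR ltW//; near: f.
  have /(nE _ (ltW e0))/(_ _ Ss) sfg := fg.
  rewrite (@le_trans _ _ (semi s (ev (f - g)) + semi s (fun i => ev g i - h i)))//.
    rewrite -big_split/=; elim: (s) (S0 Ss) => [|p s' IH] s0.
      by rewrite !big_nil.
    move: s0 => /andP[p0 s0].
    rewrite !big_cons lerD//; last exact: IH.
    rewrite -mulrDr ler_wpM2l//.
    rewrite evB (le_trans _ (normcD _ _))//.
    by rewrite addrA subrK.
  by rewrite lerD//; near: g; exact: hsemi.
have [|g gh] := @evcl h.
  move=> e /Fh Fe; near F => f; exists f.
  by near: f.
apply/cvg_ex; exists g; apply/cvgrPdist_le => e e0.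
have [r er] : exists r, e = r%:C by apply/complex_realP; rewrite realE ltW.
move: e0; rewrite er ltcR => r0; near=> f.
rewrite distrC normE lecR; apply/nE => [|s Ss]; first exact: ltW.
have : semi s (fun i => ev f i - h i) <= r.
  have : forall s, S s -> semi s (fun i => ev f i - h i) <= r.
    by near: f; exact: Fh.
  exact.
apply: le_trans; rewrite le_eqVlt; apply/orP; left; apply/eqP.
by apply: eq_bigr => p _; rewrite evB gh.
Unshelve. all: by end_near. Qed.

End Completeness.

Definition bounded_map (K : numFieldType) (V W : normedModType K) (f : V -> W) :=
  exists c : K, forall v, `|f v| <= c * `|v|.

Definition dual_ball (R : realType) (X : normedModType R[i]) : set (X -> R[i]^o) :=
  [set phi | linear phi /\ forall x, `|phi x| <= `|x|].
Arguments dual_ball {R} X _.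

(* The map sending an element sum_k x_k (x) y_k of the algebraic tensor product to
   the function (phi, psi) |-> sum_k phi x_k * psi y_k on pairs from the closed
   unit balls of the duals is injective, and the injective norm is by definition
   the sup norm of that function.  The completion is therefore the closure of the
   image in the Banach space of bounded functions with the sup norm, which is the
   type [injective_tensor X Y] below. *)
Section InjectiveTensor.
Variables (R : realType) (X Y : normedModType R[i]).

Definition dual_pair : Type := (dual_ball X * dual_ball Y)%type.

Definition elt_form (x : X) (y : Y) : dual_pair -> R[i]^o :=
  fun p => val p.1 x * val p.2 y.

Definition tensor_form (s : seq (X * Y)) : dual_pair -> R[i]^o :=
  \sum_(t <- s) elt_form t.1 t.2.

Definition injective_tensor_pred : {pred dual_pair -> R[i]^o} :=
  fun T => `[< forall e : R, 0 < e ->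
    exists s, forall p, normc (T p - tensor_form s p) <= e >].

Lemma dual_ballP (Z : normedModType R[i]) (phi : dual_ball Z) :
  linear (val phi) /\ forall x, `|val phi x| <= `|x|.
Proof. by case: phi => phi /= /set_mem. Qed.

Lemma zero_dual_ball (Z : normedModType R[i]) : dual_ball Z (0 : Z -> R[i]^o).
Proof.
split=> [a u v|x].
  by change (0 = a *: 0 + 0 :> R[i]^o); rewrite scaler0 addr0.
by change (`|0 : R[i]| <= `|x|); rewrite normr0.
Qed.

Lemma dual_pair0 : dual_pair.
Proof.
by split; exists 0; apply/mem_set; exact: zero_dual_ball.
Defined.

Lemma tensor_formE s p :
  tensor_form s p = \sum_(t <- s) val p.1 t.1 * val p.2 t.2.
Proof. by rewrite /tensor_form fct_sumE. Qed.

Lemma tensor_formZ a s p :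
  tensor_form [seq (a *: t.1, t.2) | t <- s] p = a * tensor_form s p.
Proof.
rewrite !tensor_formE big_map mulr_sumr; apply: eq_bigr => t _ /=.
have phi0 : val p.1 0 = 0.
  apply: (addrI (val p.1 0)); have := (dual_ballP p.1).1 1 0 0.
  by rewrite scale1r addr0 addr0 scale1r => <-.
have := (dual_ballP p.1).1 a t.1 0; rewrite phi0 !addr0 => ->.
by rewrite /GRing.scale/= mulrA.
Qed.

Lemma injective_tensor_submod : submod_closed injective_tensor_pred.
Proof.
split.
  apply/asboolP => e e0; exists [::] => p.
  by rewrite tensor_formE big_nil subrr normc0 ltW.
move=> a T1 T2 /asboolP h1 /asboolP h2; apply/asboolP => e e0.
have a1 : 0 < normc a + 1 by rewrite ltr_wpDl// normc_ge0.
have [|s1 hs1] := h1 (e / 2 / (normc a + 1)); first by rewrite !divr_gt0.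
have [|s2 hs2] := h2 (e / 2); first by rewrite divr_gt0.
exists ([seq (a *: t.1, t.2) | t <- s1] ++ s2) => p.
have -> : tensor_form ([seq (a *: t.1, t.2) | t <- s1] ++ s2) p =
    a * tensor_form s1 p + tensor_form s2 p.
  by rewrite -tensor_formZ !tensor_formE big_cat.
rewrite fctE/= opprD addrACA -mulrBr (le_trans (normcD _ _))// [e]splitr.
rewrite lerD// normcM (@le_trans _ _ ((normc a + 1) * normc (T1 p - tensor_form s1 p)))//.
  by rewrite ler_wpM2r ?normc_ge0// lerDl.
by rewrite mulrC -ler_pdivlMr.
Qed.

HB.instance Definition _ := GRing.isSubmodClosed.Build _ _
  injective_tensor_pred injective_tensor_submod.

Record injective_tensor := InjectiveTensor {
  it_fun :> dual_pair -> R[i]^o ;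
  it_funP : it_fun \in injective_tensor_pred }.

HB.instance Definition _ := [isSub for it_fun].
HB.instance Definition _ := [Choice of injective_tensor by <:].
HB.instance Definition _ := [SubChoice_isSubLmodule of injective_tensor by <:].

Definition it_norm (T : injective_tensor) : R :=
  sup [set normc (T p) | p in [set: dual_pair]].

Lemma it_normP (T : injective_tensor) (e : R) :
  it_norm T <= e <-> forall p, normc (T p) <= e.
Proof.
have hub : has_ubound [set normc (T p) | p in [set: dual_pair]].
  have /asboolP/(_ 1 ltr01)[s hs] := it_funP T.
  exists (1 + \sum_(t <- s) rnorm t.1 * rnorm t.2) => _ [p _ <-].
  rewrite -[it_fun T p](subrK (tensor_form s p)) (le_trans (normcD _ _))//.
  rewrite lerD// tensor_formE; elim: s {hs} => [|t s IH].
    by rewrite !big_nil normc0.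
  rewrite !big_cons (le_trans (normcD _ _))// lerD// normcM.
  have [_ h1] := dual_ballP p.1; have [_ h2] := dual_ballP p.2.
  rewrite ler_pM ?normc_ge0//; first by rewrite -lecR -normE; exact: h1.
  by rewrite -lecR -normE; exact: h2.
split=> [Te p|h].
  by rewrite (le_trans _ Te)//; apply: ub_le_sup => //; exists p.
by apply: ge_sup => [|_ [p _ <-]//]; exists (normc (T dual_pair0)), dual_pair0.
Qed.

Lemma it_norm_ub (T : injective_tensor) p : normc (T p) <= it_norm T.
Proof. by have /(_ (it_norm T))[/(_ (lexx _))] := it_normP T. Qed.

Lemma it_norm_ge0 T : 0 <= it_norm T.
Proof. exact: le_trans (normc_ge0 _) (it_norm_ub T dual_pair0). Qed.

Lemma it_normD (T1 T2 : injective_tensor) :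
  (it_norm (T1 + T2))%:C <= (it_norm T1)%:C + (it_norm T2)%:C.
Proof.
rewrite -rmorphD lecR; apply/it_normP => p.
by rewrite (le_trans (normcD _ _))// lerD// it_norm_ub.
Qed.

Lemma it_normZ (a : R[i]) (T : injective_tensor) :
  (it_norm (a *: T))%:C = `|a| * (it_norm T)%:C.
Proof.
have le b S : it_norm (b *: S) <= normc b * it_norm S.
  apply/it_normP => p; rewrite [it_fun _ _]/(b * S p) normcM.
  by rewrite ler_wpM2l ?normc_ge0// it_norm_ub.
rewrite -[`|a|]/((normc a)%:C) -rmorphM; congr (_%:C).
apply/eqP; rewrite eq_le le/=.
have [->|a0] := eqVneq a 0.
  by rewrite normc0 mul0r it_norm_ge0.
have na : 0 < normc a.
  by rewrite lt_def normc_ge0 andbT; apply: contra a0 => /eqP/eq0_normc ->.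
rewrite mulrC -ler_pdivlMr// -{1}(scale1r T) -(mulVf a0) -scalerA.
by rewrite (le_trans (le _ _))// normcV mulrC.
Qed.

Lemma it_norm0_eq0 (T : injective_tensor) : (it_norm T)%:C = 0 -> T = 0.
Proof.
move=> [T0]; apply/val_inj/funext => p; apply: eq0_normc.
by apply/eqP; rewrite eq_le normc_ge0 -T0 it_norm_ub.
Qed.

HB.instance Definition _ := @Lmodule_isNormed.Build R[i] injective_tensor
  (fun T => (it_norm T)%:C) it_normD it_normZ it_norm0_eq0.

Lemma injective_tensor_normE (T : injective_tensor) : `|T| = (it_norm T)%:C.
Proof. by []. Qed.

Lemma injective_tensor_complete (F : set_system injective_tensor) :
  ProperFilter F -> cauchy F -> cvg F.
Proof.
apply: (@complete_criterion R dual_pair injective_tensor (fun T => it_fun T)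
  [set s | exists p, s = [:: (p, 1)]]) => //.
- by move=> _ [p ->] /=; rewrite ler01.
- move=> T e _; rewrite it_normP; split=> [h _ [p ->]|h p].
    by rewrite big_seq1 mul1r.
  have /(_ [:: (p, 1)]) := h; rewrite big_seq1 mul1r; apply.
  by exists p.
- by move=> p; exists 1 => // T; rewrite mul1r it_norm_ub.
move=> h hh; suff hp : h \in injective_tensor_pred.
  by exists (InjectiveTensor hp).
apply/asboolP => e e0.
have e2 : 0 < e / 2 by rewrite divr_gt0.
have [T hT] := hh _ e2; have /asboolP/(_ _ e2)[s hs] := it_funP T.
exists s => p; have := hT [:: (p, 1)]; rewrite big_seq1 mul1r/= => hTp.
rewrite -(subrKA (T p)) (le_trans (normcD _ _))// [e]splitr lerD//.
by rewrite normcB hTp//; exists p.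
Qed.

HB.instance Definition _ :=
  Uniform_isComplete.Build injective_tensor injective_tensor_complete.

Lemma elt_form_pred x y : elt_form x y \in injective_tensor_pred.
Proof.
apply/asboolP => e e0; exists [:: (x, y)] => p.
by rewrite tensor_formE big_seq1 subrr normc0 ltW.
Qed.

Definition tensor x y : injective_tensor := InjectiveTensor (elt_form_pred x y).

End InjectiveTensor.

Section BoundedOperators.
Variables (R : realType) (H : normedModType R[i]).

Definition bounded_op_pred : {pred H -> H} :=
  fun T => `[< linear T /\ bounded_map T >].

Lemma bounded_op_submod : submod_closed bounded_op_pred.
Proof.
split.
  apply/asboolP; split=> [a u v|].
    by change (0 = a *: 0 + 0 :> H); rewrite scaler0 addr0.
  by exists 0 => v; change (`|0 : H| <= 0 * `|v|); rewrite normr0 mul0r.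
move=> a S T /asboolP[lS [c hc]] /asboolP[lT [d hd]]; apply/asboolP; split.
  move=> b u v; rewrite !fctE lS lT !scalerDr !scalerA mulrC -!addrA.
  by congr (_ + _); rewrite addrCA.
exists (`|a| * c + d) => v; rewrite fctE (le_trans (ler_normD _ _))//.
by rewrite mulrDl lerD// normrZ -mulrA ler_wpM2l.
Qed.

HB.instance Definition _ := GRing.isSubmodClosed.Build _ _
  bounded_op_pred bounded_op_submod.

Record bounded_op := BoundedOp {
  op_fun :> H -> H ;
  op_funP : op_fun \in bounded_op_pred }.

HB.instance Definition _ := [isSub for op_fun].
HB.instance Definition _ := [Choice of bounded_op by <:].
HB.instance Definition _ := [SubChoice_isSubLmodule of bounded_op by <:].

Definition op_norm (T : bounded_op) : R :=
  sup [set rnorm (T x) | x in [set x | rnorm x <= 1]].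

Lemma rnormZ (V : normedModType R[i]) (a : R[i]) (v : V) :
  rnorm (a *: v) = normc a * rnorm v.
Proof. by apply: (@complexI R); rewrite rmorphM/= -!normE normrZ. Qed.

Lemma rnormD (V : normedModType R[i]) (u v : V) :
  rnorm (u + v) <= rnorm u + rnorm v.
Proof. by rewrite -lecR rmorphD/= -!normE ler_normD. Qed.

Lemma rnorm0 (V : normedModType R[i]) : rnorm (0 : V) = 0.
Proof. by rewrite /rnorm normr0. Qed.

Lemma rnorm0_eq0 (V : normedModType R[i]) (v : V) : rnorm v = 0 -> v = 0.
Proof. by move=> v0; apply: normr0_eq0; rewrite normE v0. Qed.

Lemma op_normP (T : bounded_op) (e : R) : 0 <= e ->
  op_norm T <= e <-> forall x, rnorm (T x) <= e * rnorm x.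
Proof.
have /asboolP[lT [c hc]] := op_funP T.
have T0 : T 0 = 0.
  apply: (addrI (T 0)); have := lT 1 0 0.
  by rewrite scale1r addr0 addr0 scale1r => <-.
have TZ a x : T (a *: x) = a *: T x by have := lT a x 0; rewrite T0 !addr0.
have hub : has_ubound [set rnorm (T x) | x in [set x | rnorm x <= 1]].
  exists (normc c) => _ [x /= x1 <-]; rewrite -lecR -normE (le_trans (hc _))//.
  have := hc x; have [->|x0] := eqVneq x 0.
    by rewrite normr0 mulr0 lecR normc_ge0.
  move=> /(le_trans (normr_ge0 _)) cx.
  have c0 : 0 <= c by move: cx; rewrite pmulr_lge0// normr_gt0.
  rewrite -[(normc c)%:C]/(`|c|) ger0_norm// ler_piMr// normE.
  by rewrite -[1]/(1%:C) lecR.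
move=> e0; split=> [Te x|h].
  have [->|x0] := eqVneq x 0; first by rewrite T0 rnorm0 mulr0.
  have rx : 0 < rnorm x.
    by rewrite lt_def rnorm_ge0 andbT; apply: contra x0 => /eqP/rnorm0_eq0 ->.
  have rV : `|(rnorm x)^-1| = (rnorm x)^-1.
    by rewrite ger0_norm// invr_ge0 ltW.
  have : rnorm (T ((rnorm x)^-1%:C *: x)) <= e.
    rewrite (le_trans _ Te)//; apply: ub_le_sup => //.
    exists ((rnorm x)^-1%:C *: x) => //=.
    by rewrite rnormZ normc_real rV mulVf// gt_eqF.
  rewrite TZ rnormZ normc_real rV.
  by rewrite mulrC ler_pdivrMr.
apply: ge_sup => [|_ [x /= x1 <-]].
  by exists (rnorm (T 0)), 0 => //=; rewrite rnorm0.
by rewrite (le_trans (h x))// ler_piMr.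
Qed.

Lemma op_norm_ge0 T : 0 <= op_norm T.
Proof.
rewrite leNgt; apply/negP => T0.
have /op_normP : op_norm T <= 0 by exact: ltW.
move=> /(_ (lexx _)) h; suff : op_norm T = 0 by move: T0 => /[swap] ->; rewrite ltxx.
rewrite /op_norm (_ : [set _ | _ in _] = [set 0]) ?sup1//.
apply/seteqP; split=> [_ [x _ <-]|_ ->] /=.
  by apply/eqP; rewrite eq_le rnorm_ge0 andbT; have := h x; rewrite mul0r.
exists 0; rewrite /= ?rnorm0//; apply/eqP; rewrite eq_le rnorm_ge0 andbT.
by have := h 0; rewrite mul0r.
Qed.

Lemma op_norm_ub (T : bounded_op) x : rnorm (T x) <= op_norm T * rnorm x.
Proof. exact: (op_normP T (op_norm_ge0 T)).1. Qed.

Lemma op_normD (S T : bounded_op) :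
  (op_norm (S + T))%:C <= (op_norm S)%:C + (op_norm T)%:C.
Proof.
rewrite -rmorphD lecR; apply/op_normP => [|x].
  by rewrite addr_ge0 ?op_norm_ge0.
by rewrite (le_trans (rnormD _ _))// mulrDl lerD// op_norm_ub.
Qed.

Lemma op_normZ (a : R[i]) (T : bounded_op) :
  (op_norm (a *: T))%:C = `|a| * (op_norm T)%:C.
Proof.
have le b S : op_norm (b *: S) <= normc b * op_norm S.
  apply/op_normP => [|x]; first by rewrite mulr_ge0 ?normc_ge0 ?op_norm_ge0.
  rewrite [op_fun _ _]/(b *: S x) rnormZ -mulrA.
  by rewrite ler_wpM2l ?normc_ge0// op_norm_ub.
rewrite -[`|a|]/((normc a)%:C) -rmorphM; congr (_%:C).
apply/eqP; rewrite eq_le le/=.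
have [->|a0] := eqVneq a 0.
  by rewrite normc0 mul0r op_norm_ge0.
have na : 0 < normc a.
  by rewrite lt_def normc_ge0 andbT; apply: contra a0 => /eqP/eq0_normc ->.
rewrite mulrC -ler_pdivlMr// -{1}(scale1r T) -(mulVf a0) -scalerA.
by rewrite (le_trans (le _ _))// normcV mulrC.
Qed.

Lemma op_norm0_eq0 (T : bounded_op) : (op_norm T)%:C = 0 -> T = 0.
Proof.
move=> [T0]; apply/val_inj/funext => x; apply: rnorm0_eq0.
by apply/eqP; rewrite eq_le rnorm_ge0 andbT; have := op_norm_ub T x; rewrite T0 mul0r.
Qed.

HB.instance Definition _ := @Lmodule_isNormed.Build R[i] bounded_op
  (fun T => (op_norm T)%:C) op_normD op_normZ op_norm0_eq0.

Lemma bounded_op_normE (T : bounded_op) : `|T| = (op_norm T)%:C.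
Proof. by []. Qed.

Lemma comp_op_pred (S T : bounded_op) : (S \o T : H -> H) \in bounded_op_pred.
Proof.
have /asboolP[lS _] := op_funP S; have /asboolP[lT _] := op_funP T.
apply/asboolP; split=> [a u v|]; first by rewrite /= lT lS.
exists (op_norm S * op_norm T)%:C => v; rewrite !normE -rmorphM lecR.
rewrite (le_trans (op_norm_ub _ _))// -mulrA.
by rewrite ler_wpM2l ?op_norm_ge0// op_norm_ub.
Qed.

Definition comp_op S T : bounded_op := BoundedOp (comp_op_pred S T).

End BoundedOperators.

(* The form [dot] is linear in its first and conjugate-linear in its second
   argument. *)
Definition is_hilbert (R : realType) (H : completeNormedModType R[i]) :=
  exists dot : {dot H for @conjc R}, forall x : H, `|x| ^+ 2 = dot x x.

Definition operator_algebra (R : realType) (H : normedModType R[i])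
    (B : set (bounded_op H)) :=
  [/\ closed B, B 0,
      forall (a : R[i]) S T, B S -> B T -> B (a *: S + T) &
      forall S T, B S -> B T -> B (comp_op S T)].

(* Banach algebras are not assumed unital, so the MathComp ring structures do not
   apply. *)
HB.mixin Record isBanachAlgebra (K : numFieldType) A
    & CompleteNormedModule K A := {
  amul : A -> A -> A ;
  amulA : associative amul ;
  amulDl : left_distributive amul +%R ;
  amulDr : right_distributive amul +%R ;
  amulZl : forall (k : K) a b, amul (k *: a) b = k *: amul a b ;
  amulZr : forall (k : K) a b, amul a (k *: b) = k *: amul a b ;
  amul_norm : forall a b, `|amul a b| <= `|a| * `|b| }.

#[short(type="banachAlgType")]
HB.structure Definition BanachAlgebra (K : numFieldType) :=
  {A of CompleteNormedModule K A & isBanachAlgebra K A}.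

Definition injective_algebra (R : realType) (A : banachAlgType R[i]) :=
  exists M : {linear injective_tensor A A -> A},
    bounded_map M /\ forall a b, M (tensor a b) = amul a b.

(* [Psi] is the inverse of [Phi] on its range [B]; its values off [B] are
   irrelevant. *)
Definition isomorphic_to_operator_algebra (R : realType)
    (A : banachAlgType R[i]) :=
  exists (H : completeNormedModType R[i]) (B : set (bounded_op H))
         (Phi : {linear A -> bounded_op H}) (Psi : bounded_op H -> A),
  [/\ is_hilbert H /\ operator_algebra B,
      forall a b, Phi (amul a b) = comp_op (Phi a) (Phi b),
      range Phi = B /\ cancel Phi Psi,
      bounded_map Phi &
      exists c : R[i], forall T, B T -> `|Psi T| <= c * `|T|].

Section UnorderedSum.
Variable R : realType.

(* Unordered sums over an arbitrary index type.  They are meaningful for absolutely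
   summable families, the only ones to which they are applied below. *)
Definition rsum (I : choiceType) (a : I -> R) : R :=
  fine (\esum_(i in [set: I]) (Num.max (a i) 0)%:E) -
  fine (\esum_(i in [set: I]) (Num.max (- a i) 0)%:E).

Definition csum (I : choiceType) (a : I -> R[i]) : R[i] :=
  rsum (fun i => complex.Re (a i)) +i* rsum (fun i => complex.Im (a i)).

Definition rsummable (I : choiceType) (a : I -> R) : Prop :=
  (\esum_(i in [set: I]) (`|a i|)%:E < +oo)%E.

Definition csummable (I : choiceType) (a : I -> R[i]) : Prop :=
  (\esum_(i in [set: I]) (normc (a i))%:E < +oo)%E.

Section Real.
Variable I : choiceType.
Implicit Types (a b : I -> R).

Lemma esum_fin (a : I -> R) : (forall i, 0 <= a i) ->
  (\esum_(i in [set: I]) (a i)%:E < +oo)%E ->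
  (\esum_(i in [set: I]) (a i)%:E)%E \is a fin_num.
Proof.
move=> a0 aoo; rewrite ge0_fin_numE//.
by apply: esum_ge0 => i _; rewrite lee_fin.
Qed.

Lemma rsummable_le a b : (forall i, `|a i| <= `|b i|) -> rsummable b ->
  rsummable a.
Proof.
by move=> ab; apply: le_lt_trans; apply: le_esum => i _; rewrite lee_fin.
Qed.

Lemma rsummableD a b : rsummable a -> rsummable b ->
  rsummable (fun i => a i + b i).
Proof.
move=> sa sb; rewrite /rsummable.
apply: (@le_lt_trans _ _ (\esum_(i in [set: I]) (`|a i|%:E + `|b i|%:E))%E).
  by apply: le_esum => i _; rewrite -EFinD lee_fin ler_normD.
by rewrite esumD ?lte_add_pinfty// => i _; rewrite lee_fin.
Qed.

Lemma rsummableZ (c : R) a : rsummable a -> rsummable (fun i => c * a i).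
Proof.
move=> sa; have h (n : nat) : rsummable (fun i => n%:R * a i).
  elim: n => [|n IH].
    rewrite /rsummable esum1 ?ltry// => i _.
    by rewrite mul0r normr0.
  apply: rsummable_le (rsummableD IH sa) => i.
  by rewrite -natr1 mulrDl mul1r.
have [n cn] : exists n : nat, `|c| <= n%:R.
  by exists (Num.truncn `|c|).+1; rewrite ltW// truncnS_gt.
apply: rsummable_le (h n) => i.
rewrite !normrM; apply: ler_wpM2r => //.
by rewrite normr_nat.
Qed.

Lemma rsum_ge0E a : (forall i, 0 <= a i) ->
  rsum a = fine (\esum_(i in [set: I]) (a i)%:E).
Proof.
move=> a0; rewrite /rsum [X in _ - fine X]esum1 ?subr0; last first.
  by move=> i _; rewrite (_ : Num.max _ _ = 0)//; apply/max_idPr; rewrite oppr_le0.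
by congr fine; apply: eq_esum => i _; rewrite (max_idPl (a0 i)).
Qed.

Lemma rsum_sub a b : rsummable a -> rsummable b ->
  (forall i, 0 <= a i) -> (forall i, 0 <= b i) ->
  rsum (fun i => a i - b i) = rsum a - rsum b.
Proof.
move=> sa sb a0 b0.
have sab : rsummable (fun i => a i - b i).
  apply: rsummableD => //; apply: rsummable_le sb => i; by rewrite normrN.
have fin (c d : I -> R) : rsummable d -> (forall i, 0 <= c i <= `|d i|) ->
    (\esum_(i in [set: I]) (c i)%:E)%E \is a fin_num.
  move=> sd cd; apply: esum_fin => [i|]; first by case/andP: (cd i).
  by apply: le_lt_trans sd; apply: le_esum => i _; rewrite lee_fin; case/andP: (cd i).
have fa : (\esum_(i in [set: I]) (a i)%:E)%E \is a fin_num.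
  by apply: (fin _ a) => // i; rewrite a0 ler_norm.
have fb : (\esum_(i in [set: I]) (b i)%:E)%E \is a fin_num.
  by apply: (fin _ b) => // i; rewrite b0 ler_norm.
have fp : (\esum_(i in [set: I]) (Num.max (a i - b i) 0)%:E)%E \is a fin_num.
  apply: (fin _ (fun i => a i - b i)) => // i.
  by rewrite le_max lexx orbT ge_max ler_norm normr_ge0.
have fn : (\esum_(i in [set: I]) (Num.max (- (a i - b i)) 0)%:E)%E \is a fin_num.
  apply: (fin _ (fun i => a i - b i)) => // i.
  by rewrite le_max lexx orbT ge_max -normrN ler_norm normr_ge0.
rewrite (rsum_ge0E a0) (rsum_ge0E b0).
have /(congr1 fine) : (\esum_(i in [set: I]) (Num.max (a i - b i) 0)%:E +
   \esum_(i in [set: I]) (b i)%:E =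
   \esum_(i in [set: I]) (Num.max (- (a i - b i)) 0)%:E +
   \esum_(i in [set: I]) (a i)%:E)%E.
  rewrite -!esumD; try by move=> i _; rewrite lee_fin// le_max lexx orbT.
  apply: eq_esum => i _; rewrite -!EFinD; congr EFin.
  have [ab|ab] := leP 0 (a i - b i).
    by rewrite (max_idPr _ : Num.max _ 0 = 0) ?oppr_le0// subrK add0r.
  by rewrite (max_idPl _ : Num.max _ 0 = _) ?oppr_ge0 ?ltW// add0r opprB subrK.
by rewrite !fineD// /rsum => e; lra.
Qed.

Lemma posneg (x : R) : x = Num.max x 0 - Num.max (- x) 0.
Proof.
have [x0|x0] := leP 0 x.
  by rewrite (max_idPr _ : Num.max _ 0 = 0) ?oppr_le0// subr0.
by rewrite (max_idPl _ : Num.max _ 0 = _) ?oppr_ge0 ?ltW// sub0r opprK.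
Qed.

Lemma pos_ge0 (x : R) : 0 <= Num.max x 0.
Proof. by rewrite le_max lexx orbT. Qed.

Lemma pos_le_norm (x : R) : `|Num.max x 0| <= `|x|.
Proof. by rewrite ger0_norm ?pos_ge0// ge_max ler_norm normr_ge0. Qed.

Lemma rsummable_pos a : rsummable a -> rsummable (fun i => Num.max (a i) 0).
Proof. by apply: rsummable_le => i; exact: pos_le_norm. Qed.

Lemma rsummable_neg a : rsummable a -> rsummable (fun i => Num.max (- a i) 0).
Proof. by apply: rsummable_le => i; rewrite -[`|a i|]normrN pos_le_norm. Qed.

Lemma rsum_posneg a : rsum a =
  rsum (fun i => Num.max (a i) 0) - rsum (fun i => Num.max (- a i) 0).
Proof.
by rewrite (@rsum_ge0E (fun i => Num.max (a i) 0)) ?(@rsum_ge0E (fun i => Num.max (- a i) 0))//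
  => i; exact: pos_ge0.
Qed.

Lemma rsumD_ge0 a b : rsummable a -> rsummable b ->
  (forall i, 0 <= a i) -> (forall i, 0 <= b i) ->
  rsum (fun i => a i + b i) = rsum a + rsum b.
Proof.
move=> sa sb a0 b0; rewrite !rsum_ge0E//; last by move=> i; exact: addr_ge0.
have fin (c : I -> R) : rsummable c -> (forall i, 0 <= c i) ->
    (\esum_(i in [set: I]) (c i)%:E)%E \is a fin_num.
  move=> sc c0; apply: esum_fin => //; apply: le_lt_trans sc.
  by apply: le_esum => i _; rewrite lee_fin ler_norm.
rewrite -fineD ?fin// -esumD; try by move=> i _; rewrite lee_fin.
by congr fine; apply: eq_esum.
Qed.

Lemma rsumD a b : rsummable a -> rsummable b ->
  rsum (fun i => a i + b i) = rsum a + rsum b.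
Proof.
move=> sa sb; rewrite (rsum_posneg a) (rsum_posneg b).
have sap := rsummable_pos sa; have san := rsummable_neg sa.
have sbp := rsummable_pos sb; have sbn := rsummable_neg sb.
rewrite addrACA -opprD -!rsumD_ge0//; try by move=> i; exact: pos_ge0.
rewrite -rsum_sub; [|exact: rsummableD|exact: rsummableD| |]; first last.
- by move=> i; rewrite addr_ge0 ?pos_ge0.
- by move=> i; rewrite addr_ge0 ?pos_ge0.
congr rsum; apply/funext => i.
by rewrite {1}(posneg (a i)) {1}(posneg (b i)); ring.
Qed.

Lemma rsum_abs a : rsummable a ->
  rsum a <= fine (\esum_(i in [set: I]) `|a i|%:E).
Proof.
move=> sa; have fin (c : I -> R) : (forall i, 0 <= c i <= `|a i|) ->
    (\esum_(i in [set: I]) (c i)%:E)%E \is a fin_num.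
  move=> ca; apply: esum_fin => [i|]; first by case/andP: (ca i).
  by apply: le_lt_trans sa; apply: le_esum => i _; rewrite lee_fin; case/andP: (ca i).
rewrite /rsum (@le_trans _ _ (fine (\esum_(i in [set: I]) (Num.max (a i) 0)%:E)))//.
  rewrite gerBl// fine_ge0// esum_ge0// => i _; rewrite lee_fin; exact: pos_ge0.
rewrite fine_le//.
- by apply: fin => i; rewrite pos_ge0 -[leLHS]ger0_norm ?pos_ge0// pos_le_norm.
- by apply: fin => i; rewrite normr_ge0 lexx.
by apply: le_esum => i _; rewrite lee_fin ge_max ler_norm normr_ge0.
Qed.

Lemma rsumN a : rsum (fun i => - a i) = - rsum a.
Proof.
rewrite /rsum opprB; congr (_ - fine _).
by apply: eq_esum => i _; rewrite opprK.
Qed.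

Lemma esumZ (c : R) a : 0 <= c -> (forall i, 0 <= a i) ->
  (\esum_(i in [set: I]) (c * a i)%:E =
   c%:E * \esum_(i in [set: I]) (a i)%:E)%E.
Proof.
move=> c0 a0; rewrite le_eqVlt in c0; case/orP : c0 => [/eqP <-|c0].
  by rewrite mul0e esum1// => i _; rewrite mul0r.
have le (d : R) (b : I -> R) : 0 < d -> (forall i, 0 <= b i) ->
  (\esum_(i in [set: I]) (d * b i)%:E <= d%:E * \esum_(i in [set: I]) (b i)%:E)%E.
  move=> d0 b0; apply: ge_ereal_sup => _ [X [finX _] <-].
  rewrite (_ : (\sum_(x \in X) _)%E = d%:E * \sum_(x \in X) (b x)%:E)%E.
    rewrite lee_pmul2l// ?lte_fin//; apply: ereal_sup_ubound; exists X => //.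
  by rewrite ge0_mule_fsumr// => i; rewrite lee_fin.
apply/eqP; rewrite eq_le le//=.
rewrite -lee_pdivlMl// -[X in (X * _)%E]/((c^-1)%:E).
rewrite (le_trans _ (le c^-1 _ _ _)) ?invr_gt0//; last first.
  by move=> i; rewrite mulr_ge0// ltW.
by apply: le_esum => i _; rewrite mulKf ?gt_eqF.
Qed.

Lemma fine_mulr (c : R) (x : \bar R) : fine (c%:E * x)%E = c * fine x.
Proof.
case: x => [x|/=|/=]; first by [].
  by rewrite mulr_infty; case: sgrP; rewrite ?mul0e ?mul1e ?mulN1e /= mulr0.
by rewrite mulr_infty; case: sgrP; rewrite ?mul0e ?mul1e ?mulN1e /= mulr0.
Qed.

Lemma rsumZ (c : R) a : rsum (fun i => c * a i) = c * rsum a.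
Proof.
have pos d : 0 <= d -> rsum (fun i => d * a i) = d * rsum a.
  move=> d0; rewrite /rsum.
  under eq_esum do rewrite -{1}(mulr0 d) -maxr_pMr//.
  under [X in _ - fine X]eq_esum do rewrite -mulrN -{1}(mulr0 d) -maxr_pMr//.
  rewrite !esumZ//; try by move=> i; exact: pos_ge0.
  by rewrite !fine_mulr mulrBr.
have [c0|c0] := leP 0 c; first exact: pos.
rewrite -[c]opprK mulNr -pos ?oppr_ge0 ?ltW// -rsumN.
by congr rsum; apply/funext => i; rewrite mulNr.
Qed.

End Real.

Section Complex.
Variable I : choiceType.
Implicit Types (a b : I -> R[i]).

Lemma csummable_Re a : csummable a -> rsummable (fun i => complex.Re (a i)).
Proof.
by apply: le_lt_trans; apply: le_esum => i _; rewrite lee_fin Re_le_normc.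
Qed.

Lemma csummable_Im a : csummable a -> rsummable (fun i => complex.Im (a i)).
Proof.
by apply: le_lt_trans; apply: le_esum => i _; rewrite lee_fin Im_le_normc.
Qed.

Lemma csummableZ (c : R[i]) a : csummable a -> csummable (fun i => c * a i).
Proof.
rewrite /csummable => sa; under eq_esum do rewrite normcM.
rewrite esumZ ?normc_ge0//; last by move=> i; exact: normc_ge0.
by rewrite lte_mul_pinfty ?lee_fin ?normc_ge0.
Qed.

Lemma csumD a b : csummable a -> csummable b ->
  csum (fun i => a i + b i) = csum a + csum b.
Proof.
move=> sa sb; rewrite /csum -[RHS]/((_ + _) +i* (_ + _)).
rewrite -!rsumD; try exact: csummable_Re; try exact: csummable_Im.
by congr (_ +i* _); congr rsum; apply/funext => i; case: (a i); case: (b i).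
Qed.

Lemma csumZ (c : R[i]) a : csummable a -> csum (fun i => c * a i) = c * csum a.
Proof.
move=> sa; case: c => u v; rewrite /csum -[RHS]/((_ - _) +i* (_ + _)).
rewrite -!rsumZ -rsumN.
have := csummable_Re sa; have := csummable_Im sa => si sr.
rewrite -!rsumD; try exact: rsummableZ.
  by congr (_ +i* _); congr rsum; apply/funext => i; case: (a i).
apply: rsummable_le (rsummableZ v si) => i.
by rewrite normrN.
Qed.

Lemma normc_csum a :
  ((normc (csum a))%:E <= \esum_(i in [set: I]) (normc (a i))%:E)%E.
Proof.
have [sa|] := ltP (\esum_(i in [set: I]) (normc (a i))%:E)%E +oo%E; last first.
  by rewrite leye_eq => /eqP ->; rewrite leey.
have fa : (\esum_(i in [set: I]) (normc (a i))%:E)%E \is a fin_num.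
  by apply: esum_fin => // i; exact: normc_ge0.
have [->|z0] := eqVneq (csum a) 0.
  by rewrite normc0 esum_ge0// => i _; rewrite lee_fin normc_ge0.
pose u := (csum a)^-1 * (normc (csum a))%:C.
have nz : normc (csum a) != 0 by apply: contra z0 => /eqP/eq0_normc ->.
have nu : normc u = 1.
  rewrite /u normcM normcV normc_real ger0_norm ?normc_ge0//.
  by rewrite mulVf.
have -> : normc (csum a) = rsum (fun i => complex.Re (u * a i)).
  transitivity (complex.Re (u * csum a)); last by rewrite -csumZ.
  by rewrite /u mulrAC mulVf// mul1r.
have su := csummableZ u sa.
rewrite -(fineK fa) lee_fin (le_trans (rsum_abs (csummable_Re su)))//.
have le : (\esum_(i in [set: I]) `|complex.Re (u * a i)|%:E <=
  \esum_(i in [set: I]) (normc (a i))%:E)%E.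
  apply: le_esum => i _; rewrite lee_fin (le_trans (Re_le_normc _))//.
  by rewrite normcM nu mul1r.
rewrite fine_le//; apply: esum_fin => [i|]; first exact: normr_ge0.
by rewrite (le_lt_trans le)// -ge0_fin_numE// esum_ge0// => i _;
  rewrite lee_fin normc_ge0.
Qed.

End Complex.

Lemma esum_exchange (I J : choiceType) (a : I -> J -> \bar R) :
  (forall i j, 0 <= a i j)%E ->
  (\esum_(i in [set: I]) \esum_(j in [set: J]) a i j =
   \esum_(j in [set: J]) \esum_(i in [set: I]) a i j)%E.
Proof.
move=> a0; rewrite !esum_esum//.
rewrite (reindex_esum ([set: J] `*`` (fun=> [set: I])) _ (fun k => (k.2, k.1)))//.
split => //; first by move=> [i j] [i' j'] _ _ /= [-> ->].
by move=> [i j] _; exists (j, i).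
Qed.

Lemma reindex_esumT (I J : choiceType) (e : I -> J) (a : J -> \bar R) :
  bijective e ->
  (\esum_(j in [set: J]) a j = \esum_(i in [set: I]) a (e i))%E.
Proof. by move=> be; apply: reindex_esum; rewrite setTT_bijective. Qed.

Lemma csum_reindex (I J : choiceType) (e : I -> J) (a : J -> R[i]) :
  bijective e -> csum a = csum (fun i => a (e i)).
Proof.
by move=> be; rewrite /csum /rsum; do 4! rewrite (reindex_esumT _ be).
Qed.

Lemma rsum_exchange (I J : choiceType) (a : I -> J -> R) :
  (\esum_(i in [set: I]) \esum_(j in [set: J]) `|a i j|%:E < +oo)%E ->
  rsum (fun i => rsum (a i)) = rsum (fun j => rsum (fun i => a i j)).
Proof.
move=> sa.
have fin (K L : choiceType) (b : K -> L -> R) :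
  (\esum_(i in [set: K]) \esum_(j in [set: L]) `|b i j|%:E < +oo)%E ->
  forall i, rsummable (b i).
  move=> sb i; apply: le_lt_trans sb.
  rewrite -(@esum_set1 R K i (fun i => \esum_(j in [set: L]) `|b i j|%:E)%E).
    rewrite esum_mkcond; apply: le_esum => k _.
    by case: ifP => // _; apply: esum_ge0 => l _; rewrite lee_fin.
  by apply: esum_ge0 => l _; rewrite lee_fin.
have fins (K L : choiceType) (b : K -> L -> R) : (forall i j, 0 <= b i j) ->
  (\esum_(i in [set: K]) \esum_(j in [set: L]) `|b i j|%:E < +oo)%E ->
  rsummable (fun i => rsum (b i)) /\
  rsum (fun i => rsum (b i)) =
  fine (\esum_(i in [set: K]) \esum_(j in [set: L]) (b i j)%:E)%E.
  move=> b0 sb.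
  have e : (\esum_(i in [set: K]) (rsum (b i))%:E =
     \esum_(i in [set: K]) \esum_(j in [set: L]) (b i j)%:E)%E.
    apply: eq_esum => i _; rewrite rsum_ge0E// fineK// esum_fin//.
    by have := fin _ _ _ sb i; rewrite /rsummable; under eq_esum do rewrite ger0_norm//.
  have r0 i : 0 <= rsum (b i).
    by rewrite rsum_ge0E// fine_ge0// esum_ge0// => j _; rewrite lee_fin.
  split; last by rewrite rsum_ge0E// e.
  rewrite /rsummable; under eq_esum do rewrite ger0_norm//.
  rewrite e; apply: le_lt_trans sb; apply: le_esum => i _.
  by apply: le_esum => j _; rewrite lee_fin ler_norm.
have exch (b : I -> J -> R) : (forall i j, 0 <= b i j) ->
  (\esum_(i in [set: I]) \esum_(j in [set: J]) `|b i j|%:E < +oo)%E ->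
  rsum (fun i => rsum (b i)) = rsum (fun j => rsum (fun i => b i j)).
  move=> b0 sb; rewrite (fins _ _ _ b0 sb).2 esum_exchange//.
  have sb' : (\esum_(j in [set: J]) \esum_(i in [set: I]) `|b i j|%:E < +oo)%E.
    by rewrite esum_exchange.
  by rewrite (fins _ _ (fun j i => b i j) (fun j i => b0 i j) sb').2.
have spos : (\esum_(i in [set: I]) \esum_(j in [set: J])
    `|Num.max (a i j) 0|%:E < +oo)%E.
  apply: le_lt_trans sa; apply: le_esum => i _; apply: le_esum => j _.
  by rewrite lee_fin pos_le_norm.
have sneg : (\esum_(i in [set: I]) \esum_(j in [set: J])
    `|Num.max (- a i j) 0|%:E < +oo)%E.
  apply: le_lt_trans sa; apply: le_esum => i _; apply: le_esum => j _.
  by rewrite lee_fin -[leRHS]normrN pos_le_norm.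
have sub (K L : choiceType) (b : K -> L -> R) :
  (\esum_(i in [set: K]) \esum_(j in [set: L]) `|Num.max (b i j) 0|%:E < +oo)%E ->
  (\esum_(i in [set: K]) \esum_(j in [set: L]) `|Num.max (- b i j) 0|%:E < +oo)%E ->
  rsum (fun i => rsum (b i)) =
  rsum (fun i => rsum (fun j => Num.max (b i j) 0)) -
  rsum (fun i => rsum (fun j => Num.max (- b i j) 0)).
  move=> sp sn; rewrite -rsum_sub.
  - by congr rsum; apply/funext => i; exact: rsum_posneg.
  - by apply: (fins _ _ _ _ sp).1 => i j; exact: pos_ge0.
  - by apply: (fins _ _ _ _ sn).1 => i j; exact: pos_ge0.
  - by move=> i; rewrite rsum_ge0E ?fine_ge0 ?esum_ge0// => j *; rewrite ?lee_fin pos_ge0.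
  - by move=> i; rewrite rsum_ge0E ?fine_ge0 ?esum_ge0// => j *; rewrite ?lee_fin pos_ge0.
rewrite sub// (sub _ _ (fun j i => a i j)); [|by rewrite esum_exchange..].
by rewrite (exch _ _ spos) ?(exch _ _ sneg)// => i j; exact: pos_ge0.
Qed.

Lemma csum_exchange (I J : choiceType) (a : I -> J -> R[i]) :
  (\esum_(i in [set: I]) \esum_(j in [set: J]) (normc (a i j))%:E < +oo)%E ->
  csum (fun i => csum (a i)) = csum (fun j => csum (fun i => a i j)).
Proof.
move=> sa; rewrite /csum /=; congr (_ +i* _); apply: rsum_exchange;
  apply: le_lt_trans sa; apply: le_esum => i _; apply: le_esum => j _.
  by rewrite lee_fin Re_le_normc.
by rewrite lee_fin Im_le_normc.
Qed.

End UnorderedSum.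

Record weight (R : realType) (G : groupType) := Weight {
  weight_fun :> G -> R ;
  weight_gt0 : forall x, 0 < weight_fun x ;
  weightM : forall x y, weight_fun (x * y)%g <= weight_fun x * weight_fun y }.

Section Ell1.
Variables (R : realType) (G : groupType) (w : weight R G).
Implicit Types f g h : G -> R[i]^o.

Definition wsum f : \bar R := (\esum_(x in [set: G]) (normc (f x) * w x)%:E)%E.

Definition ell1_pred : {pred G -> R[i]^o} := fun f => `[< (wsum f < +oo)%E >].

Lemma weight_ge0 x : 0 <= w x.
Proof. exact/ltW/weight_gt0. Qed.

Let term_ge0 f x : 0 <= normc (f x) * w x.
Proof. by rewrite mulr_ge0 ?normc_ge0// weight_ge0. Qed.

Lemma wsum_ge0 f : (0 <= wsum f)%E.
Proof. by apply: esum_ge0 => x _; rewrite lee_fin. Qed.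

Lemma wsumD f g : (wsum (f + g)%R <= wsum f + wsum g)%E.
Proof.
rewrite /wsum -esumD; try by move=> x _; rewrite lee_fin.
apply: le_esum => x _; rewrite -EFinD lee_fin -mulrDl.
by rewrite ler_wpM2r ?normcD// weight_ge0.
Qed.

Lemma wsumZ (a : R[i]) f : wsum (a *: f)%R = ((normc a)%:E * wsum f)%E.
Proof.
rewrite /wsum -esumZ ?normc_ge0//; apply: eq_esum => x _.
by rewrite -[(a *: f) x]/(a * f x) normcM mulrA.
Qed.

Lemma ell1_submod : submod_closed ell1_pred.
Proof.
split.
  apply/asboolP; rewrite /wsum esum1 ?ltry// => x _.
  by rewrite -[(0 : G -> R[i]^o) x]/(0 : R[i]) normc0 mul0r.
move=> a f g /asboolP sf /asboolP sg; apply/asboolP.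
rewrite (le_lt_trans (wsumD _ _))// lte_add_pinfty// wsumZ.
by rewrite lte_mul_pinfty ?lee_fin ?normc_ge0.
Qed.

HB.instance Definition _ := GRing.isSubmodClosed.Build _ _ ell1_pred ell1_submod.

Record ell1 := Ell1 { ell1_fun :> G -> R[i]^o ; ell1P : ell1_fun \in ell1_pred }.

HB.instance Definition _ := [isSub for ell1_fun].
HB.instance Definition _ := [Choice of ell1 by <:].
HB.instance Definition _ := [SubChoice_isSubLmodule of ell1 by <:].

Definition ell1_norm (f : ell1) : R := fine (wsum f).

Lemma ell1_normE (f : ell1) : (ell1_norm f)%:E = wsum f.
Proof.
rewrite fineK// ge0_fin_numE ?wsum_ge0//.
by have /asboolP := ell1P f.
Qed.

Lemma ell1_norm_ge0 (f : ell1) : 0 <= ell1_norm f.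
Proof. by rewrite fine_ge0// wsum_ge0. Qed.

Lemma ell1_normD (f g : ell1) :
  (ell1_norm (f + g))%:C <= (ell1_norm f)%:C + (ell1_norm g)%:C.
Proof. by rewrite -rmorphD lecR -lee_fin EFinD !ell1_normE wsumD. Qed.

Lemma ell1_normZ (a : R[i]) (f : ell1) :
  (ell1_norm (a *: f))%:C = `|a| * (ell1_norm f)%:C.
Proof.
rewrite -[`|a|]/((normc a)%:C) -rmorphM; congr (_%:C).
by apply: EFin_inj; rewrite EFinM !ell1_normE wsumZ.
Qed.

Lemma ell1_coord (f : ell1) x : normc (f x) * w x <= ell1_norm f.
Proof.
rewrite -lee_fin ell1_normE /wsum.
rewrite -(@esum_set1 R G x (fun x => (normc (f x) * w x)%:E)) ?lee_fin//.
rewrite esum_mkcond; apply: le_esum => y _.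
by case: ifP => // _; rewrite lee_fin.
Qed.

Lemma ell1_norm0_eq0 (f : ell1) : (ell1_norm f)%:C = 0 -> f = 0.
Proof.
move=> [f0]; apply/val_inj/funext => x; apply: eq0_normc.
apply/eqP; rewrite eq_le normc_ge0 andbT.
by have := ell1_coord f x; rewrite f0 pmulr_lle0// weight_gt0.
Qed.

HB.instance Definition _ := @Lmodule_isNormed.Build R[i] ell1
  (fun f : ell1 => (ell1_norm f)%:C) ell1_normD ell1_normZ ell1_norm0_eq0.

Lemma ell1_normrE (f : ell1) : `|f| = (ell1_norm f)%:C.
Proof. by []. Qed.

Let finite_parts : set (seq (G * R)) :=
  [set s | exists2 r : seq G, uniq r & s = [seq (x, w x) | x <- r]].

Lemma wsum_leP f (e : R) : (wsum f <= e%:E)%E <->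
  forall s, finite_parts s -> \sum_(p <- s) p.2 * normc (f p.1) <= e.
Proof.
split=> [fe _ [r ur ->]|h].
  rewrite -lee_fin (le_trans _ fe)//; apply: ereal_sup_ubound => /=.
  exists [set` r]; first by split=> //; exact: finite_seq.
  rewrite -fsbig_seq// big_map -sumEFin; apply: eq_bigr => x _.
  by rewrite mulrC.
apply: ge_ereal_sup => _ [X [finX _] <-].
rewrite fsbig_finite//= sumEFin lee_fin.
have /h : finite_parts [seq (x, w x) | x <- finmap.enum_fset (fset_set X)].
  by exists (finmap.enum_fset (fset_set X)) => //; exact: finmap.fset_uniq.
by rewrite big_map; under eq_bigr do rewrite mulrC.
Qed.

Lemma ell1_complete (F : set_system ell1) : ProperFilter F -> cauchy F -> cvg F.
Proof.
apply: (@complete_criterion R G ell1 (fun f : ell1 => ell1_fun f) finite_parts) => //.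
- move=> _ [r _ ->]; apply/allP => _ /mapP[x _ ->] /=.
  by rewrite weight_ge0.
- by move=> f e _; rewrite -wsum_leP -ell1_normE lee_fin.
- move=> x; exists (w x)^-1; first by rewrite invr_gt0 weight_gt0.
  by move=> f; rewrite mulrC ler_pdivlMr ?weight_gt0// ell1_coord.
move=> h hh; suff hp : h \in ell1_pred by exists (Ell1 hp).
have [f fh0] := hh 1 ltr01.
have fh : (wsum ((f : G -> R[i]^o) - h)%R <= 1%:E)%E by apply/wsum_leP.
have sfh : ell1_fun f - h \in ell1_pred.
  by apply/asboolP; apply: (le_lt_trans fh); rewrite ltry.
by rewrite -[h](subKr (ell1_fun f)) rpredB//; exact: ell1P.
Qed.

HB.instance Definition _ := Uniform_isComplete.Build ell1 ell1_complete.

Definition convolution f g : G -> R[i]^o :=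
  fun x => csum (fun y => f y * g (y^-1 * x)%g).

Lemma bij_mulgl (y : G) : bijective (fun x : G => y * x)%g.
Proof. by exists (fun x => y^-1 * x)%g => x; rewrite ?mulKg ?mulVKg. Qed.

Lemma convolution_abs (f g : ell1) :
  (\esum_(x in [set: G]) \esum_(y in [set: G])
     (normc (f y * g (y^-1 * x)%g) * w x)%:E <=
   (ell1_norm f * ell1_norm g)%:E)%E.
Proof.
rewrite esum_exchange; last by move=> x y; rewrite lee_fin mulr_ge0 ?normc_ge0// weight_ge0.
rewrite mulrC EFinM (ell1_normE f) /wsum -esumZ ?ell1_norm_ge0//.
apply: le_esum => y _; rewrite mulrC EFinM ell1_normE /wsum.
rewrite (reindex_esumT (fun x => (normc (g x) * w x)%:E) (bij_mulgl y^-1)).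
rewrite -esumZ//; apply: le_esum => x _; rewrite lee_fin normcM.
rewrite -!mulrA ler_wpM2l ?normc_ge0// mulrCA ler_wpM2l ?normc_ge0//.
by rewrite -{1}(mulVKg y x) weightM.
Qed.

Lemma convolution_summable (f g : ell1) x :
  csummable (fun y => f y * g (y^-1 * x)%g).
Proof.
have := convolution_abs f g => h; have w0 := weight_gt0 w x.
have {h} : (\esum_(y in [set: G]) (normc (f y * g (y^-1 * x)%g) * w x)%:E < +oo)%E.
  apply: le_lt_trans (le_lt_trans h (ltry _)).
  rewrite -(@esum_set1 R G x (fun x => \esum_(y in [set: G]) (normc (f y * g (y^-1 * x)%g) * w x)%:E)%E).
    rewrite esum_mkcond; apply: le_esum => k _; case: ifP => // _.
    by apply: esum_ge0 => l _; rewrite lee_fin mulr_ge0 ?normc_ge0// weight_ge0.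
  by apply: esum_ge0 => l _; rewrite lee_fin mulr_ge0 ?normc_ge0// weight_ge0.
under eq_esum do rewrite mulrC.
rewrite esumZ ?weight_ge0//; last by move=> y; exact: normc_ge0.
rewrite /csummable => h; rewrite ltNge leye_eq; apply/negP => /eqP e.
by move: h; rewrite e gt0_muley ?lte_fin// ltxx.
Qed.

Lemma wsum_convolution (f g : ell1) :
  (wsum (convolution f g) <= (ell1_norm f * ell1_norm g)%:E)%E.
Proof.
apply: le_trans (convolution_abs f g); apply: le_esum => x _.
under eq_esum do rewrite mulrC.
rewrite esumZ ?weight_ge0//; last by move=> y; exact: normc_ge0.
rewrite (mulrC (normc (convolution f g x))) EFinM lee_pmul2l ?lte_fin ?weight_gt0//.
exact: normc_csum.
Qed.

Lemma convolution_pred (f g : ell1) : convolution f g \in ell1_pred.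
Proof.
by apply/asboolP; apply: (le_lt_trans (wsum_convolution f g)); rewrite ltry.
Qed.

Definition ell1_mul (f g : ell1) : ell1 := Ell1 (convolution_pred f g).

Lemma ell1_mulDl : left_distributive ell1_mul +%R.
Proof.
move=> f g h; apply/val_inj/funext => x.
rewrite -[RHS]/(_ + _) -csumD; try exact: convolution_summable.
by congr csum; apply/funext => y; rewrite -mulrDl.
Qed.

Lemma ell1_mulDr : right_distributive ell1_mul +%R.
Proof.
move=> f g h; apply/val_inj/funext => x.
rewrite -[RHS]/(_ + _) -csumD; try exact: convolution_summable.
by congr csum; apply/funext => y; rewrite -mulrDr.
Qed.

Lemma ell1_mulZl (k : R[i]) (f g : ell1) : ell1_mul (k *: f) g = k *: ell1_mul f g.
Proof.
apply/val_inj/funext => x.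
rewrite -[RHS]/(k * _) -csumZ; last exact: convolution_summable.
by congr csum; apply/funext => y; rewrite mulrA.
Qed.

Lemma ell1_mulZr (k : R[i]) (f g : ell1) : ell1_mul f (k *: g) = k *: ell1_mul f g.
Proof.
apply/val_inj/funext => x.
rewrite -[RHS]/(k * _) -csumZ; last exact: convolution_summable.
by congr csum; apply/funext => y; rewrite mulrCA.
Qed.

Lemma ell1_mulA : associative ell1_mul.
Proof.
move=> f g h; apply/val_inj/funext => x; symmetry.
transitivity (csum (fun z => csum (fun y =>
    f y * (g (y^-1 * z)%g * h (z^-1 * x)%g)))).
  congr csum; apply/funext => z; rewrite mulrC -[X in _ * X]/(csum _).
  rewrite -csumZ; last exact: convolution_summable.
  by congr csum; apply/funext => y; rewrite mulrC mulrA.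
rewrite csum_exchange; last first.
  pose c := ell1_norm h / w x.
  have c0 : 0 <= c by rewrite divr_ge0 ?ell1_norm_ge0// weight_ge0.
  apply: (@le_lt_trans _ _ (c%:E * (\esum_(z in [set: G]) \esum_(y in [set: G])
     (normc (f y * g (y^-1 * z)%g) * w z)%:E))%E); last first.
    rewrite lte_mul_pinfty ?lee_fin//.
    by apply: le_lt_trans (convolution_abs f g) _; rewrite ltry.
  have fin z : (\esum_(y in [set: G]) (normc (f y * g (y^-1 * z)%g) * w z)%:E)%E \is a fin_num.
    under eq_esum do rewrite mulrC.
    rewrite esumZ ?weight_ge0//; last by move=> y; exact: normc_ge0.
    by rewrite fin_numM// esum_fin ?convolution_summable// => y; exact: normc_ge0.
  pose s z := fine (\esum_(y in [set: G]) (normc (f y * g (y^-1 * z)%g) * w z)%:E)%E.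
  rewrite [X in (_ <= _ * X)%E](@eq_esum _ _ _ _ (fun z => (s z)%:E)); last first.
    by move=> z _; rewrite /s fineK.
  rewrite -esumZ//; last first.
    move=> z; rewrite fine_ge0// esum_ge0// => y _.
    by rewrite lee_fin mulr_ge0 ?normc_ge0// weight_ge0.
  apply: le_esum => z _; rewrite EFinM /s fineK//.
  rewrite -esumZ//; last by move=> y; rewrite mulr_ge0 ?normc_ge0// weight_ge0.
  apply: le_esum => y _; rewrite lee_fin mulrA normcM [leRHS]mulrCA.
  rewrite ler_wpM2l ?normc_ge0// /c mulrAC ler_pdivlMr ?weight_gt0//.
  rewrite (@le_trans _ _ (normc (h (z^-1 * x)%g) * (w z * w (z^-1 * x)%g)))//.
    by rewrite ler_wpM2l ?normc_ge0// -{1}(mulVKg z x) weightM.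
  by rewrite [leLHS]mulrCA [leRHS]mulrC ler_wpM2l ?weight_ge0// ell1_coord.
congr csum; apply/funext => y.
rewrite -[X in _ = _ * X]/(csum _).
rewrite -csumZ; last exact: convolution_summable.
rewrite [LHS](csum_reindex _ (bij_mulgl y)).
congr csum; apply/funext => t.
by rewrite mulKg invgM mulgA.
Qed.

Lemma ell1_mul_norm (f g : ell1) : `|ell1_mul f g| <= `|f| * `|g|.
Proof.
rewrite -[leRHS]/((ell1_norm f)%:C * (ell1_norm g)%:C) -rmorphM.
rewrite -[leLHS]/((ell1_norm (ell1_mul f g))%:C) lecR -lee_fin ell1_normE.
exact: wsum_convolution.
Qed.

HB.instance Definition _ := isBanachAlgebra.Build R[i] ell1 ell1_mulA
  ell1_mulDl ell1_mulDr ell1_mulZl ell1_mulZr ell1_mul_norm.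

Lemma ell1_amulE (f g : ell1) x :
  amul f g x = csum (fun y => f y * g (y^-1 * x)%g).
Proof. by []. Qed.

End Ell1.

(* Main.v *)
(* Both properties are compared with the inequality
     |sum_k a_k b_k| <= C |sum_k a_k (x) b_k|_inj   on finite sums.

   If it holds, Hahn-Banach gives, for each phi in the dual ball S, a positive
   functional L_phi on the bounded functions on S with
     |phi(ab)|^2 <= C |b|^2 L_phi(psi |-> |psi(a)|^2).
   Put q_0^phi(a) = |phi(a)|^2, q_(k+1)^phi(a) = L_phi(psi |-> q_k^psi(a)).  Then
   q^phi = sum_k (2C)^-k q_k^phi is the square of a Hilbertian seminorm that
   dominates |phi| and satisfies q^phi(ab) <= 2 C^2 |b|^2 q^phi(a).  Right
   multiplications therefore act boundedly on the l^2-sum of the seminormed spaces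
   (A, q^phi), and A acts on the Hilbert space dual to that sum.  Because A has a
   unit, the functionals phi make this representation bounded below.

   Conversely, if Phi represents l^1(G, w) on H and is bounded below, the norm of
   sum_k a_k b_k is at most a constant times the supremum over unit vectors xi, eta
   of |sum_k <Phi(a_k) Phi(b_k) xi, eta>|.  Expanding a_k and b_k in point masses,
   this is a finite matrix applied to the bounded functionals
   <Phi(delta_x) _, eta> / w(x) and the bounded vectors Phi(delta_y) xi / w(y), so
   Grothendieck's inequality bounds it by the injective norm. *)
From HB Require Import structures.
Require Import Defs.
From mathcomp Require Import all_boot all_order all_algebra.
From mathcomp Require Import all_classical all_reals all_analysis.
From mathcomp Require Import complex ring lra.

Set Implicit Arguments.
Unset Strict Implicit.
Unset Printing Implicit Defensive.

Import Order.TTheory GRing.Theory Num.Theory.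
Import numFieldNormedType.Exports.
Import ComplexField.Normc.

Local Open Scope classical_set_scope.
Local Open Scope ring_scope.
Local Open Scope complex_scope.

Section NormAux.
Variables (R : realType) (V : normedModType R[i]).
Implicit Types u v : V.

Lemma rnormN v : rnorm (- v) = rnorm v.
Proof. by rewrite /rnorm normrN. Qed.

Lemma rnormB u v : rnorm (u - v) = rnorm (v - u).
Proof. by rewrite /rnorm distrC. Qed.

Lemma rnorm_leP v (x : R) : `|v| <= x%:C <-> rnorm v <= x.
Proof. by rewrite normE lecR. Qed.

Lemma rnorm_triangle u v t : rnorm (u - t) <= rnorm (u - v) + rnorm (v - t).
Proof. by rewrite -(subrKA v) rnormD. Qed.

Lemma bounded_mapP (W : normedModType R[i]) (f : V -> W) :
  bounded_map f -> exists2 c : R, 0 < c & forall v, rnorm (f v) <= c * rnorm v.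
Proof.
move=> [c hc]; exists (normc c + 1); first by rewrite ltr_wpDl ?normc_ge0.
move=> v; have h : rnorm (f v) <= normc c * rnorm v.
  rewrite -lecR -normE rmorphM/= -normE -[X in _ <= X * _]/(`|c|).
  have y0 := le_trans (normr_ge0 (f v)) (hc v).
  by rewrite (le_trans (hc v))// -[leLHS](ger0_norm y0) normrM normr_id.
by rewrite mulrDl mul1r (le_trans h)// lerDl rnorm_ge0.
Qed.

End NormAux.

Lemma approx_limit (R : realType) (V : completeNormedModType R[i])
    (P : R -> set V) (K : R) :
  (forall e, 0 < e -> exists a, P e a) ->
  (forall e d a b, P e a -> P d b -> rnorm (a - b) <= K * (e + d)) ->
  exists l, forall e a, P e a -> rnorm (a - l) <= K * e.
Proof.
move=> Pex PK.
have /choice[u Pu] (n : nat) : exists a, P n.+1%:R^-1 a.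
  by apply: Pex; rewrite invr_gt0.
have small (e : R) : 0 < e -> \forall n \near \oo, K * n.+1%:R^-1 <= e.
  move=> e0; near=> n.
  rewrite ler_pdivrMr// mulrC -ler_pdivrMr//.
  rewrite (le_trans (ler_norm _))// (@le_trans _ _ n%:R) ?ler_nat//.
  by near: n; apply: nbhs_infty_ger; rewrite num_real.
have : cvg (u @ \oo).
  apply/cauchy_cvgP/cauchyP => e e0.
  have [r er] : exists r, e = r%:C by apply/complex_realP; rewrite realE ltW.
  move: e0; rewrite er ltcR => r0.
  near \oo => m; exists (u m).
  change (\forall n \near \oo, ball (u m) r%:C (u n)); near=> n.
  rewrite -ball_normE/= normE ltcR (le_lt_trans (PK _ _ _ _ (Pu m) (Pu n)))//.
  rewrite mulrDr (@le_lt_trans _ _ (r / 3 + r / 3))//; last by lra.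
  rewrite lerD//; first by near: m; apply/small; rewrite divr_gt0.
  by near: n; apply/small; rewrite divr_gt0.
move=> /cvg_ex[l /cvgrPdist_le ul]; exists l => e a Pa.
apply/ler_addgt0Pr => d d0.
have d4 : (0 : R[i]) < (d / 2)%:C by rewrite ltcR divr_gt0.
have un := ul _ d4.
near \oo => n.
have h1 : rnorm (u n - l) <= d / 2.
  rewrite rnormB; apply/rnorm_leP; near: n; exact: un.
have h2 : K * n.+1%:R^-1 <= d / 2 by near: n; apply/small; rewrite divr_gt0.
rewrite (le_trans (rnorm_triangle a (u n) l))//.
rewrite (le_trans (lerD (PK _ _ _ _ Pa (Pu n)) h1))//.
rewrite mulrDr -addrA lerD2l.
by move: h2; set x := K * _ => h2; lra.
Unshelve. all: by end_near. Qed.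

Section JordanVonNeumann.
Variables (R : realType) (V : normedModType R[i]).
Hypothesis par : forall u v : V,
  rnorm (u + v) ^+ 2 + rnorm (u - v) ^+ 2 = 2 * rnorm u ^+ 2 + 2 * rnorm v ^+ 2.

Definition polar (u v : V) : R :=
  (rnorm (u + v) ^+ 2 - rnorm (u - v) ^+ 2) / 4.

Lemma polarC u v : polar u v = polar v u.
Proof. by rewrite /polar [u + v]addrC rnormB. Qed.

Lemma polar_vv u : polar u u = rnorm u ^+ 2.
Proof.
have := par u u; rewrite /polar subrr rnorm0 expr0n/=; lra.
Qed.

Lemma polar0 v : polar 0 v = 0.
Proof. by rewrite /polar add0r sub0r rnormN subrr mul0r. Qed.

Lemma polarD u v t : polar (u + v) t = polar u t + polar v t.
Proof.
have half x y z : polar x z + polar y z = polar (x + y) (z *+ 2) / 2.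
  have := par (x + z) (y + z); have := par (x - z) (y - z).
  have -> : x + z + (y + z) = x + y + z *+ 2 by rewrite addrACA mulr2n.
  have -> : x + z - (y + z) = x - y by rewrite opprD addrACA subrr addr0.
  have -> : x - z + (y - z) = x + y - z *+ 2 by rewrite addrACA -opprD mulr2n.
  have -> : x - z - (y - z) = x - y by rewrite opprD addrACA subrr addr0.
  by rewrite /polar; lra.
by rewrite half -[LHS]addr0 -(polar0 t) half addr0.
Qed.

Lemma polarN u v : polar (- u) v = - polar u v.
Proof. by apply/eqP; rewrite -addr_eq0 -polarD addNr polar0. Qed.

Lemma polar_bound u v : `|polar u v| <= (rnorm u + rnorm v) ^+ 2.
Proof.
have h1 : rnorm (u + v) ^+ 2 <= (rnorm u + rnorm v) ^+ 2.
  by rewrite ler_pXn2r ?nnegrE ?rnorm_ge0 ?addr_ge0 ?rnorm_ge0// rnormD.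
have h2 : rnorm (u - v) ^+ 2 <= (rnorm u + rnorm v) ^+ 2.
  rewrite ler_pXn2r ?nnegrE ?rnorm_ge0 ?addr_ge0 ?rnorm_ge0//.
  by rewrite -(rnormN v) rnormD.
have := sqr_ge0 (rnorm (u + v)); have := sqr_ge0 (rnorm (u - v)).
rewrite /polar ler_norml => *; apply/andP; split; lra.
Qed.

Lemma additive_bounded_linear (f : R -> R) (B : R) :
  {morph f : x y / x + y} -> (forall x, 0 <= x <= 1 -> `|f x| <= B) ->
  forall x, f x = x * f 1.
Proof.
move=> fD fB x; pose d y := f y - y * f 1.
have dD y z : d (y + z) = d y + d z by rewrite /d fD; ring.
have d1 : d 1 = 0 by rewrite /d mul1r subrr.
have d0 : d 0 = 0 by apply: (addrI (d 0)); rewrite -dD !addr0.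
have dN y : d (- y) = - d y by apply/eqP; rewrite -addr_eq0 -dD addNr d0.
have dMn y n : d (n%:R * y) = n%:R * d y.
  elim: n => [|n IH]; first by rewrite !mul0r d0.
  by rewrite -!natr1 !mulrDl !mul1r dD IH.
have dz (m : int) : d m%:~R = 0.
  case: m => n; first by rewrite -pmulrn -[n%:R]mulr1 dMn d1 mulr0.
  by rewrite NegzE mulrNz dN -pmulrn -[n.+1%:R]mulr1 dMn d1 mulr0 oppr0.
have dB y : `|d y| <= B + `|f 1|.
  have /andP[l1 l2] := floor_itv y.
  have -> : d y = d (y - (Num.floor y)%:~R) by rewrite dD dN dz oppr0 addr0.
  rewrite (le_trans (ler_normB _ _))// lerD ?fB ?normrM//.
    by apply/andP; split; move: l1 l2; rewrite intrD; lra.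
  rewrite ler_piMl// ger0_norm; first by move: l2; rewrite intrD; lra.
  by rewrite subr_ge0.
suff : d x = 0 by rewrite /d => /eqP; rewrite subr_eq0 => /eqP.
apply/eqP; rewrite -normr_le0; apply/ler_addgt0Pr => e e0; rewrite add0r.
have B0 : 0 <= B + `|f 1| by exact: le_trans (dB 0).
pose n := (Num.truncn ((B + `|f 1|) / e)).+1.
have nB : (B + `|f 1|) / e < n%:R by exact: truncnS_gt.
have := dB (n%:R * x); rewrite dMn normrM normr_nat => h.
have n0 : 0 < n%:R :> R by rewrite ltr0n.
rewrite -(ler_pM2l n0) (le_trans h)// ltW//.
by move: nB; rewrite ltr_pdivrMr.
Qed.

Lemma polarZ (r : R) u v : polar (r%:C *: u) v = r * polar u v.
Proof.
have := @additive_bounded_linear (fun r => polar (r%:C *: u) v)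
  ((rnorm u + rnorm v) ^+ 2).
rewrite scale1r; apply=> [x y|x /andP[x0 x1]].
  by rewrite rmorphD scalerDl polarD.
rewrite (le_trans (polar_bound _ _))//.
rewrite ler_pXn2r ?nnegrE ?addr_ge0 ?rnorm_ge0// lerD2r rnormZ normc_real.
by rewrite ger0_norm// ler_piMl// rnorm_ge0.
Qed.

Let iC : R[i] := 0 +i* 1.

Lemma rnormiZ v : rnorm (iC *: v : V) = rnorm v.
Proof. by rewrite rnormZ /= expr0n expr1n add0r sqrtr1 mul1r. Qed.

Lemma polar_i u v : polar (iC *: u) (iC *: v) = polar u v.
Proof. by rewrite /polar -scalerDr -scalerBr !rnormiZ. Qed.

Lemma i_i v : iC *: (iC *: v) = - v :> V.
Proof. by rewrite scalerA -expr2 sqr_i scaleN1r. Qed.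

Lemma polar_il u v : polar (iC *: u) v = - polar u (iC *: v).
Proof. by rewrite -(polar_i u) i_i [in RHS]polarC polarN opprK polarC. Qed.

Definition jvn_dot (u v : V) : R[i] := polar u v +i* polar u (iC *: v).

Lemma scale_ReIm (a : R[i]) (u : V) :
  a *: u = (complex.Re a)%:C *: u + (complex.Im a)%:C *: (iC *: u).
Proof. by rewrite scalerA -scalerDl [a in LHS]complexE mulrC. Qed.

Lemma jvn_dot_linear v : linear_for *%R (jvn_dot ^~ v).
Proof.
have lin (a : R[i]) (x y t : V) : polar (a *: x + y) t =
    complex.Re a * polar x t - complex.Im a * polar x (iC *: t) + polar y t.
  by rewrite polarD scale_ReIm polarD !polarZ polar_il mulrN.
move=> a x y; rewrite /jvn_dot !lin i_i -(polarC (- v)) polarN -(polarC x).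
by case: a => a b /=; simpc; congr (_ +i* _); ring.
Qed.

Lemma jvn_dotC u v : jvn_dot u v = (jvn_dot v u)^*%C.
Proof.
by rewrite /jvn_dot /= polarC; congr (_ +i* _); rewrite polarC polar_il.
Qed.

Lemma jvn_dot_vv u : jvn_dot u u = `|u| ^+ 2.
Proof.
have h : polar u (iC *: u) = 0.
  by have := polar_il u u; rewrite polarC => h; lra.
by rewrite /jvn_dot h polar_vv normE -rmorphXn.
Qed.

Lemma jvn_dot_bilinear : bilinear_for *%R (@conjc R \; *%R) jvn_dot.
Proof.
split=> [v|u] a x y; first exact: jvn_dot_linear.
rewrite jvn_dotC jvn_dot_linear rmorphD rmorphM /=.
by rewrite [in RHS]jvn_dotC [in X in _ = _ + X]jvn_dotC.
Qed.

HB.instance Definition _ := bilinear_isBilinear.Build R[i] V V R[i]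
  *%R (@conjc R \; *%R) jvn_dot jvn_dot_bilinear.

Lemma jvn_dot_hermitian u v : jvn_dot u v = (-1) ^+ false * conjc (jvn_dot v u).
Proof. by rewrite mul1r jvn_dotC. Qed.

HB.instance Definition _ := isHermitianSesquilinear.Build R[i] V false
  (@conjc R) jvn_dot jvn_dot_hermitian.

Lemma jvn_dot_gt0 u : u != 0 -> 0 < jvn_dot u u.
Proof. by move=> u0; rewrite jvn_dot_vv exprn_gt0// normr_gt0. Qed.

HB.instance Definition _ := isDotProduct.Build R[i] V jvn_dot jvn_dot_gt0.

Lemma parallelogram_dot : exists dot : {dot V for @conjc R},
  forall x : V, `|x| ^+ 2 = dot x x.
Proof. by exists jvn_dot => x; rewrite -jvn_dot_vv. Qed.

End JordanVonNeumann.

(* A Hilbertian seminorm, given by its square. *)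
Record qform (R : realType) (V : lmodType R[i]) := QForm {
  qf :> V -> R ;
  qf_ge0 : forall v, 0 <= qf v ;
  qfZ : forall (a : R[i]) v, qf (a *: v) = normc a ^+ 2 * qf v ;
  qf_par : forall u v, qf (u + v) + qf (u - v) = 2 * qf u + 2 * qf v }.

Section DualOfQForm.
Variables (R : realType) (V : lmodType R[i]) (q : qform V).

Let sq v : R := Num.sqrt (q v).

Lemma qsqrt_sqr v : sq v ^+ 2 = q v.
Proof. by rewrite sqr_sqrtr// qf_ge0. Qed.

Lemma qsqrtZ (a : R[i]) v : sq (a *: v) = normc a * sq v.
Proof.
by rewrite /sq qfZ sqrtrM ?sqr_ge0// sqrtr_sqr ger0_norm// normc_ge0.
Qed.

Lemma qf0 : q 0 = 0.
Proof. by have := qfZ q 0 0; rewrite scale0r normc0 expr0n/= mul0r. Qed.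

Definition qdual_pred : {pred V -> R[i]^o} :=
  fun f => `[< linear f /\ exists c : R, forall v, normc (f v) <= c * sq v >].

Lemma qdual_submod : submod_closed qdual_pred.
Proof.
split.
  apply/asboolP; split=> [a u v|].
    by change (0 = a *: 0 + 0 :> R[i]^o); rewrite scaler0 addr0.
  by exists 0 => v; rewrite mul0r [X in normc X](_ : _ = 0)// normc0.
move=> a f g /asboolP[lf [c hc]] /asboolP[lg [d hd]]; apply/asboolP; split.
  move=> b u v; rewrite !fctE lf lg !scalerDr !scalerA mulrC -!addrA.
  by congr (_ + _); rewrite addrCA.
exists (normc a * c + d) => v; rewrite fctE (le_trans (normcD _ _))//.
by rewrite mulrDl lerD// normcM -mulrA ler_wpM2l// normc_ge0.
Qed.

HB.instance Definition _ := GRing.isSubmodClosed.Build _ _ qdual_pred qdual_submod.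

Record qdual := QDual { qdual_fun :> V -> R[i]^o ; qdualP : qdual_fun \in qdual_pred }.

HB.instance Definition _ := [isSub for qdual_fun].
HB.instance Definition _ := [Choice of qdual by <:].
HB.instance Definition _ := [SubChoice_isSubLmodule of qdual by <:].

Lemma qdual_linear (f : qdual) : linear f.
Proof. by have /asboolP[] := qdualP f. Qed.

Lemma qdual0 (f : qdual) : f 0 = 0.
Proof.
apply: (addrI (f 0)); have := qdual_linear f 1 0 0.
by rewrite scale1r addr0 addr0 scale1r => <-.
Qed.

Lemma qdualZ (f : qdual) (a : R[i]) v : f (a *: v) = a * f v.
Proof. by have := qdual_linear f a v 0; rewrite qdual0 !addr0. Qed.

Lemma qdualD (f : qdual) u v : f (u + v) = f u + f v.
Proof. by have := qdual_linear f 1 u v; rewrite !scale1r. Qed.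

Definition qdual_norm (f : qdual) : R :=
  sup [set normc (f v) | v in [set v | sq v <= 1]].

Lemma qdual_normP (f : qdual) (e : R) : 0 <= e ->
  qdual_norm f <= e <-> forall v, normc (f v) <= e * sq v.
Proof.
move=> e0; have /asboolP[_ [c hc]] := qdualP f.
have hub : has_ubound [set normc (f v) | v in [set v | sq v <= 1]].
  exists `|c| => _ [v /= v1 <-]; rewrite (le_trans (hc _))//.
  rewrite (@le_trans _ _ (`|c| * sq v))//.
    by rewrite ler_wpM2r ?sqrtr_ge0// ler_norm.
  by rewrite ler_piMr.
split=> [fe v|h].
  have [v0|v0] := eqVneq (sq v) 0.
    by rewrite v0 mulr0; have := hc v; rewrite v0 mulr0.
  have sv : 0 < sq v by rewrite lt_def v0 sqrtr_ge0.
  have sV : `|(sq v)^-1| = (sq v)^-1 by rewrite ger0_norm// invr_ge0 ltW.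
  have : normc (f ((sq v)^-1%:C *: v)) <= e.
    rewrite (le_trans _ fe)//; apply: ub_le_sup => //.
    exists ((sq v)^-1%:C *: v) => //=.
    by rewrite qsqrtZ normc_real sV mulVf.
  by rewrite qdualZ normcM normc_real sV mulrC ler_pdivrMr.
apply: ge_sup => [|_ [v /= v1 <-]].
  exists (normc (f 0)), 0 => //=; rewrite /sq.
  by rewrite qf0 sqrtr0.
by rewrite (le_trans (h v))// ler_piMr.
Qed.

Lemma qdual_norm_ge0 f : 0 <= qdual_norm f.
Proof.
rewrite leNgt; apply/negP => f0.
have s0 : sq 0 = 0 by rewrite /sq qf0 sqrtr0.
have /qdual_normP : qdual_norm f <= 0 by exact: ltW.
move=> /(_ (lexx _)) h; suff : qdual_norm f = 0 by move: f0 => /[swap] ->; rewrite ltxx.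
rewrite /qdual_norm (_ : [set _ | _ in _] = [set 0]) ?sup1//.
apply/seteqP; split=> [_ [x _ <-]|_ ->] /=.
  by apply/eqP; rewrite eq_le normc_ge0 andbT; have := h x; rewrite mul0r.
by exists 0; rewrite /= ?s0// qdual0 normc0.
Qed.

Lemma qdual_norm_ub (f : qdual) v : normc (f v) <= qdual_norm f * sq v.
Proof. exact: (qdual_normP f (qdual_norm_ge0 f)).1. Qed.

Lemma qdual_normD (f g : qdual) :
  (qdual_norm (f + g))%:C <= (qdual_norm f)%:C + (qdual_norm g)%:C.
Proof.
rewrite -rmorphD lecR; apply/qdual_normP => [|v].
  by rewrite addr_ge0 ?qdual_norm_ge0.
by rewrite (le_trans (normcD _ _))// mulrDl lerD// qdual_norm_ub.
Qed.

Lemma qdual_normZ (a : R[i]) (f : qdual) :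
  (qdual_norm (a *: f))%:C = `|a| * (qdual_norm f)%:C.
Proof.
have le b g : qdual_norm (b *: g) <= normc b * qdual_norm g.
  apply/qdual_normP => [|v]; first by rewrite mulr_ge0 ?normc_ge0 ?qdual_norm_ge0.
  rewrite [qdual_fun _ _]/(b * g v) normcM -mulrA.
  by rewrite ler_wpM2l ?normc_ge0// qdual_norm_ub.
rewrite -[`|a|]/((normc a)%:C) -rmorphM; congr (_%:C).
apply/eqP; rewrite eq_le le/=.
have [->|a0] := eqVneq a 0.
  by rewrite normc0 mul0r qdual_norm_ge0.
have na : 0 < normc a.
  by rewrite lt_def normc_ge0 andbT; apply: contra a0 => /eqP/eq0_normc ->.
rewrite mulrC -ler_pdivlMr// -{1}(scale1r f) -(mulVf a0) -scalerA.
by rewrite (le_trans (le _ _))// normcV mulrC.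
Qed.

Lemma qdual_norm2 (f : qdual) : qdual_norm (2 *: f) = 2 * qdual_norm f.
Proof. by apply: (@complexI R); rewrite qdual_normZ normr_nat rmorphM rmorph_nat. Qed.

Lemma qdual_norm0_eq0 (f : qdual) : (qdual_norm f)%:C = 0 -> f = 0.
Proof.
move=> [f0]; apply/val_inj/funext => v; apply: eq0_normc.
by apply/eqP; rewrite eq_le normc_ge0 andbT; have := qdual_norm_ub f v; rewrite f0 mul0r.
Qed.

HB.instance Definition _ := @Lmodule_isNormed.Build R[i] qdual
  (fun f => (qdual_norm f)%:C) qdual_normD qdual_normZ qdual_norm0_eq0.

Lemma qdual_rnormE (f : qdual) : rnorm f = qdual_norm f.
Proof. by []. Qed.

Lemma qdual_complete (F : set_system qdual) : ProperFilter F -> cauchy F -> cvg F.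
Proof.
apply: (@complete_criterion R V qdual (fun f => qdual_fun f)
  [set s | exists v r, [/\ 0 <= r, r * sq v <= 1 & s = [:: (v, r)]]]) => //.
- by move=> _ [v [r [r0 _ ->]]] /=; rewrite r0.
- move=> f e e0; rewrite qdual_rnormE qdual_normP//.
  split=> [h _ [v [r [r0 rv ->]]]|h v].
    rewrite big_seq1 /= (le_trans (ler_wpM2l r0 (h v)))// mulrCA.
    by rewrite ler_piMr.
  have [v0|v0] := eqVneq (sq v) 0; last first.
    have sv : 0 < sq v by rewrite lt_def v0 sqrtr_ge0.
    have := h [:: (v, (sq v)^-1)]; rewrite big_seq1/=.
    rewrite ler_pdivrMl// mulrC; apply.
    by exists v, (sq v)^-1; rewrite invr_ge0 ltW// mulVf.
  by have := qdual_norm_ub f v; rewrite v0 !mulr0.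
- move=> v; exists (sq v + 1); first by rewrite ltr_wpDl// sqrtr_ge0.
  move=> f; rewrite (le_trans (qdual_norm_ub f v))// mulrC.
  by rewrite ler_wpM2r ?qdual_norm_ge0// lerDl.
move=> h happrox.
have {}happrox (e : R) : 0 < e ->
    exists f : qdual, forall v r, 0 <= r -> r * sq v <= 1 ->
      r * normc (f v - h v) <= e.
  move=> /happrox[f hf]; exists f => v r r0 rv.
  by have := hf [:: (v, r)]; rewrite big_seq1; apply; exists v, r.
have hpt (e : R) : 0 < e -> exists f : qdual,
    forall v, normc (f v - h v) <= e * (sq v + 1).
  move=> /happrox[f hf]; exists f => v.
  have s1 : 0 < sq v + 1 by rewrite ltr_wpDl// sqrtr_ge0.
  rewrite -ler_pdivrMr// mulrC; apply: hf; first by rewrite invr_ge0 ltW.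
  by rewrite ler_pdivrMl// mulr1 lerDl.
suff hp : h \in qdual_pred by exists (QDual hp).
apply/asboolP; split.
  move=> a u v; apply/eqP; rewrite -subr_eq0; apply/eqP/eq0_normc/eqP.
  rewrite eq_le normc_ge0 andbT; apply/ler_addgt0Pr => e e0; rewrite add0r.
  pose k := sq (a *: u + v) + 1 + (normc a * (sq u + 1) + (sq v + 1)).
  have k0 : 0 < k.
    have s1 t : 0 < sq t + 1 by rewrite ltr_wpDl// sqrtr_ge0.
    apply: addr_gt0 => //; apply: ltr_wpDl => //.
    by rewrite mulr_ge0 ?normc_ge0// ltW.
  have [|f hf] := hpt (e / k); first by rewrite divr_gt0.
  rewrite [X in normc X](_ : _ = (h (a *: u + v) - f (a *: u + v)) +
     (a * (f u - h u) + (f v - h v))); last first.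
    rewrite qdualD qdualZ -[a *: h u]/(a * h u); ring.
  rewrite (le_trans (normcD _ _))// (le_trans (lerD (lexx _) (normcD _ _)))//.
  rewrite normcM normcB.
  rewrite (le_trans (lerD (hf _) (lerD (ler_wpM2l (normc_ge0 _) (hf u)) (hf v))))//.
  rewrite (_ : _ + _ = e / k * k); last by rewrite /k; ring.
  by rewrite divfK// gt_eqF.
have [f hf] := happrox 1 ltr01; exists (1 + qdual_norm f) => v.
rewrite -[h v](subKr (f v)) (le_trans (normcD _ _))// normcN addrC mulrDl lerD//.
  rewrite mul1r; have [v0|v0] := eqVneq (sq v) 0; last first.
    have sv : 0 < sq v by rewrite lt_def v0 sqrtr_ge0.
    rewrite -[leRHS]mulr1 -ler_pdivrMl//; apply: hf.
      by rewrite invr_ge0 ltW.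
    by rewrite mulVf.
  rewrite v0 leNgt; apply/negP => d0.
  have r0 : 0 <= 2 / normc (f v - h v) by rewrite divr_ge0// ltW.
  by have := hf v _ r0; rewrite v0 mulr0 ler01 divfK ?gt_eqF// => /(_ isT); lra.
exact: qdual_norm_ub.
Qed.

HB.instance Definition _ := Uniform_isComplete.Build qdual qdual_complete.

(* [2 Re f(v) - q v] has supremum [|f|^2], and the parallelogram law for [q]
   turns the sum of two such expressions into two others. *)
Lemma qdual_par_le (f g : qdual) :
  qdual_norm (f + g) ^+ 2 + qdual_norm (f - g) ^+ 2 <=
  2 * qdual_norm f ^+ 2 + 2 * qdual_norm g ^+ 2.
Proof.
pose Re := @complex.Re R.
have up (h : qdual) v : 2 * Re (h v) - q v <= qdual_norm h ^+ 2.
  have := Re_le_normc (h v); have := qdual_norm_ub h v; rewrite -qsqrt_sqr.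
  have := sqr_ge0 (qdual_norm h - sq v); have := ler_norm (Re (h v)).
  rewrite sqrrB /Re -mulr_natl; nra.
have low (h : qdual) (e : R) : 0 < e ->
    exists v, qdual_norm h ^+ 2 - e <= 2 * Re (h v) - q v.
  move=> e0; have [h0|h0] := eqVneq (qdual_norm h) 0.
    exists 0; rewrite qdual0 h0 expr0n/= qf0.
    by rewrite mulr0 !sub0r oppr0 oppr_le0 ltW.
  have hp : 0 < qdual_norm h by rewrite lt_def h0 qdual_norm_ge0.
  have [v hv] : exists v, Num.max 0 (qdual_norm h - e / (2 * qdual_norm h)) * sq v < normc (h v).
    apply: contrapT => /forallNP nv.
    have : qdual_norm h <= Num.max 0 (qdual_norm h - e / (2 * qdual_norm h)).
      apply/qdual_normP; first by rewrite le_max lexx.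
      by move=> v; rewrite leNgt; apply/negP/nv.
    apply/negP; rewrite -ltNge gt_max hp/= gtrBl divr_gt0// mulr_gt0//.
  have sv : 0 < sq v.
    rewrite lt_def sqrtr_ge0 andbT; apply/eqP => v0.
    by have := qdual_norm_ub h v; move: hv; rewrite v0 !mulr0 => /lt_le_trans h1 /h1; rewrite ltxx.
  have nz : normc (h v) != 0.
    rewrite gt_eqF// (le_lt_trans _ hv)// mulr_ge0 ?sqrtr_ge0// le_max lexx//.
  pose c : R[i] := (qdual_norm h / sq v)%:C * (normc (h v))%:C / h v.
  have hz : h v != 0 by apply: contra nz => /eqP ->; rewrite normc0.
  exists (c *: v); rewrite qdualZ qfZ -qsqrt_sqr.
  have -> : normc c = qdual_norm h / sq v.
    rewrite /c !normcM normcV !normc_real !ger0_norm ?normc_ge0 ?divr_ge0 ?sqrtr_ge0 ?qdual_norm_ge0//.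
    by rewrite -mulrA mulfV// mulr1.
  have -> : c * h v = (qdual_norm h / sq v * normc (h v))%:C.
    by rewrite [RHS]rmorphM /c divfK.
  rewrite /Re /= exprMn exprVn divfK ?expf_neq0 ?gt_eqF//.
  have : (qdual_norm h - e / (2 * qdual_norm h)) * sq v <= normc (h v).
    rewrite (le_trans _ (ltW hv))// ler_wpM2r ?sqrtr_ge0// le_max lexx orbT//.
  rewrite -ler_pdivlMr// => /(ler_wpM2l (ltW hp)).
  have -> : qdual_norm h * (qdual_norm h - e / (2 * qdual_norm h)) =
     qdual_norm h ^+ 2 - e / 2 by field.
  rewrite (_ : qdual_norm h / sq v * normc (h v) =
    qdual_norm h * (normc (h v) / sq v)); last by ring.
  by move: (qdual_norm h * (_ / _)) => x; lra.
apply/ler_addgt0Pr => e e0.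
have e2 : 0 < e / 2 by rewrite divr_gt0.
have [u hu] := low (f + g) _ e2; have [v hv] := low (f - g) _ e2.
have h1 : (2 * qdual_norm f) ^+ 2 >= 2 * Re (2 * f (u + v)) - q (u + v).
  have := up (2 *: f) (u + v); rewrite -[(2 *: f) _]/(2 * f (u + v)). by rewrite qdual_norm2.
have h2 : (2 * qdual_norm g) ^+ 2 >= 2 * Re (2 * g (u - v)) - q (u - v).
  have := up (2 *: g) (u - v); rewrite -[(2 *: g) _]/(2 * g (u - v)). by rewrite qdual_norm2.
have h3 := qf_par q u v.
have h4 : Re (2 * f (u + v)) + Re (2 * g (u - v)) =
   2 * Re ((f + g) u) + 2 * Re ((f - g) v).
  rewrite -[(f + g) u]/(f u + g u) -[(f - g) v]/(f v - g v).
  rewrite -[- v]scaleN1r !qdualD qdualZ.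
  by case: (f u) (f v) (g u) (g v) => [? ?] [? ?] [? ?] [? ?] /=; rewrite /Re; simpc => /=; ring.
rewrite !exprMn in h1 h2; lra.
Qed.

Lemma qdual_hilbert : is_hilbert qdual.
Proof.
apply: parallelogram_dot => f g; rewrite !qdual_rnormE.
apply/eqP; rewrite eq_le qdual_par_le/=.
have := qdual_par_le (f + g) (f - g).
have -> : f + g + (f - g) = 2 *: f by rewrite addrACA subrr addr0 scaler_nat mulr2n.
have -> : f + g - (f - g) = 2 *: g.
  by rewrite opprB [g - f]addrC addrACA subrr add0r scaler_nat mulr2n.
by rewrite !qdual_norm2 !exprMn; lra.
Qed.

End DualOfQForm.

Section HahnBanach.
Variables (R : realType) (V : lmodType R) (D : set V).
Hypotheses (D0 : D 0) (DL : forall t x y, D x -> D y -> D (t *: x + y)).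

Definition sublinear_on (f : V -> R) :=
  (forall x y, D x -> D y -> f (x + y) <= f x + f y) /\
  (forall t x, 0 <= t -> D x -> f (t *: x) <= t * f x).

Let DD x y : D x -> D y -> D (x + y).
Proof. by move=> Dx /(DL 1 Dx); rewrite scale1r. Qed.

Let DZ t x : D x -> D (t *: x).
Proof. by move=> /(DL t)/(_ D0); rewrite addr0. Qed.

Let DN x : D x -> D (- x).
Proof. by rewrite -scaleN1r; exact: DZ. Qed.

Lemma sublinear_on0 f : sublinear_on f -> f 0 = 0.
Proof.
move=> [fD fZ]; have := fD _ _ D0 D0; have := fZ 0 0 (lexx _) D0.
rewrite scale0r addr0; lra.
Qed.

Lemma sublinear_onZ f t x : sublinear_on f -> 0 <= t -> D x ->
  f (t *: x) = t * f x.
Proof.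
move=> fs; rewrite le_eqVlt => /predU1P[<-|t0] Dx.
  by rewrite scale0r mul0r sublinear_on0.
apply/eqP; rewrite eq_le fs.2 ?(ltW t0)//= -ler_pdivlMl//.
have tn0 : t != 0 by rewrite gt_eqF.
rewrite -{1}(scale1r x) -(mulVf tn0) -scalerA.
by apply: fs.2; [rewrite invr_ge0 ltW|exact: DZ].
Qed.

Lemma sublinear_onN f x : sublinear_on f -> D x -> - f (- x) <= f x.
Proof.
move=> fs Dx; have := fs.1 _ _ Dx (DN Dx).
by rewrite subrr sublinear_on0//; lra.
Qed.

(* For [y] in [D] the functional [x |-> inf_(t >= 0) (f (x + t y) - t f y)] is
   sublinear and below [f], hence equal to [f]; take [t = 1]. *)
Lemma minimal_sublinear f : sublinear_on f ->
  (forall g, sublinear_on g -> (forall x, D x -> g x <= f x) ->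
    forall x, D x -> f x <= g x) ->
  forall x y, D x -> D y -> f (x + y) = f x + f y.
Proof.
move=> fs fmin x y Dx Dy; apply/eqP; rewrite eq_le fs.1//=.
pose E z := [set f (z + t *: y) - t * f y | t in [set t | 0 <= t]].
have Elb z : D z -> lbound (E z) (- f (- z)).
  move=> Dz _ [t /= t0 <-].
  have := fs.1 _ _ (DD Dz (DZ t Dy)) (DN Dz).
  by rewrite addrAC subrr add0r sublinear_onZ//; lra.
have E0 z : E z !=set0 by exists (f (z + 0 *: y) - 0 * f y), 0 => /=.
have Ein z t : D z -> 0 <= t -> inf (E z) <= f (z + t *: y) - t * f y.
  by move=> Dz t0; apply: ge_inf; [exists (- f (- z)); exact: Elb|exists t].
have : f x <= inf (E x).
  apply: (fmin (fun z => inf (E z))) => //.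
    split=> [u v Du Dv|t u].
      rewrite -lerBlDl; apply: lb_le_inf => // _ [t /= t0 <-].
      rewrite lerBlDl -lerBlDr; apply: lb_le_inf => // _ [s /= s0 <-].
      rewrite lerBlDr (le_trans (Ein _ (t + s) _ _)) ?addr_ge0//; first exact: DD.
      have := fs.1 _ _ (DD Du (DZ s Dy)) (DD Dv (DZ t Dy)).
      by rewrite addrACA -scalerDl [s + t]addrC; lra.
    rewrite le_eqVlt => /predU1P[<-|t0] Du.
      by rewrite scale0r mul0r (le_trans (Ein _ 0 _ _))// scale0r addr0 mul0r subr0 sublinear_on0.
    rewrite -ler_pdivrMl//; apply: lb_le_inf => // _ [s /= s0 <-].
    rewrite ler_pdivrMl// (le_trans (Ein _ (t * s) _ _)) ?mulr_ge0 ?(ltW t0)//; first exact: DZ.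
    rewrite -scalerA -scalerDr sublinear_onZ ?(ltW t0)//; last by apply: DD => //; exact: DZ.
    by rewrite mulrBr mulrA.
  by move=> z Dz; rewrite (le_trans (Ein _ 0 _ _))// scale0r addr0 mul0r subr0.
move=> /le_trans/(_ (Ein x 1 Dx ler01)); rewrite scale1r mul1r; lra.
Qed.

Lemma hahn_banach p : sublinear_on p ->
  exists L : V -> R, [/\ forall x y, D x -> D y -> L (x + y) = L x + L y,
    forall t x, D x -> L (t *: x) = t * L x & forall x, D x -> L x <= p x].
Proof.
move=> ps.
pose T := {f : V -> R | sublinear_on f /\ forall x, D x -> f x <= p x}.
pose le (f g : T) := `[< forall x, D x -> sval g x <= sval f x >].
have t0 : T by exists p; split.
have [|f g h|A Atot|[f [fs fp]] fmin] := @ZL_preorder T t0 le.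
- by move=> f; apply/asboolP.
- by move=> /asboolP fg /asboolP gh; apply/asboolP => x Dx; rewrite (le_trans (gh x Dx))// fg.
- have [[f0 Af0]|A0] := pselect (A !=set0); last first.
    by exists t0 => s As; exfalso; apply: A0; exists s.
  pose E x := [set sval f x | f in A].
  have E0 x : E x !=set0 by exists (sval f0 x), f0.
  have Elb x : D x -> lbound (E x) (- p (- x)).
    move=> Dx _ [[f [fs fp]] _ <-] /=.
    by rewrite (le_trans _ (sublinear_onN fs Dx))// lerN2 fp//; exact: DN.
  have Ein x f : D x -> A f -> inf (E x) <= sval f x.
    by move=> Dx Af; apply: ge_inf; [exists (- p (- x)); exact: Elb|exists f].
  have Es : sublinear_on (fun x => inf (E x)).
    split=> [x y Dx Dy|t x].
      rewrite -lerBlDl; apply: lb_le_inf => // _ [f Af <-].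
      rewrite lerBlDl -lerBlDr; apply: lb_le_inf => // _ [g Ag <-].
      rewrite lerBlDr.
      have [/asboolP fg|/asboolP gf] := Atot _ _ Af Ag.
        rewrite (le_trans (Ein _ g (DD Dx Dy) Ag))//.
        by rewrite (le_trans ((svalP g).1.1 _ _ Dx Dy))// lerD2l fg.
      rewrite (le_trans (Ein _ f (DD Dx Dy) Af))//.
      by rewrite (le_trans ((svalP f).1.1 _ _ Dx Dy))// lerD2r gf.
    rewrite le_eqVlt => /predU1P[<-|tp] Dx.
      rewrite mul0r (le_trans (Ein _ f0 (DZ 0 Dx) Af0))//.
      by rewrite scale0r (sublinear_on0 (svalP f0).1).
    rewrite -ler_pdivrMl//; apply: lb_le_inf => // _ [f Af <-].
    rewrite ler_pdivrMl// (le_trans (Ein _ f (DZ t Dx) Af))//.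
    by apply: (svalP f).1.2 => //; exact: ltW.
  have Ep x : D x -> inf (E x) <= p x.
    by move=> Dx; rewrite (le_trans (Ein _ _ Dx Af0))//; apply: (svalP f0).2.
  exists (exist _ (fun x => inf (E x)) (conj Es Ep)) => f Af.
  by apply/asboolP => x Dx /=; exact: Ein.
have fD : forall x y, D x -> D y -> f (x + y) = f x + f y.
  apply: minimal_sublinear => // g gs gf.
  have gp x : D x -> g x <= p x by move=> Dx; rewrite (le_trans (gf _ Dx))// fp.
  have /(_ _)/asboolP := fmin (exist _ g (conj gs gp)).
  by apply; apply/asboolP.
exists f; split=> // t x Dx.
have [tp|tn] := leP 0 t; first exact: sublinear_onZ.
have := fD _ _ (DZ t Dx) (DZ (- t) Dx).
rewrite -scalerDl subrr scale0r sublinear_on0// (@sublinear_onZ f (- t))//.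
  by move=> h; lra.
by rewrite oppr_ge0 (ltW tn).
Qed.

End HahnBanach.

Definition bounded_fun_set (R : realType) (S : Type) : set (S -> R^o) :=
  [set g | exists B, forall s, `|g s| <= B].
Arguments bounded_fun_set {R S}.

Definition positive_functional (R : realType) (S : Type) (C : R)
    (L : (S -> R^o) -> R) :=
  [/\ forall g h, bounded_fun_set g -> bounded_fun_set h -> L (g + h) = L g + L h,
      forall t g, bounded_fun_set g -> L (t *: g) = t * L g &
      forall B g, bounded_fun_set g -> (forall s, g s <= B) -> L g <= C * B].

Section Domination.
Variables (R : realType) (S : Type).

Lemma bounded_fun_set0 : @bounded_fun_set R S 0.
Proof. by exists 0 => s; rewrite -[0 s]/(0 : R) normr0. Qed.

Lemma bounded_fun_setL t (g h : S -> R^o) :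
  bounded_fun_set g -> bounded_fun_set h -> bounded_fun_set (t *: g + h).
Proof.
move=> [B gB] [B' hB]; exists (`|t| * B + B') => s.
rewrite -[(t *: g + h) s]/(t * g s + h s) (le_trans (ler_normD _ _))//.
by rewrite lerD// normrM ler_wpM2l.
Qed.

Lemma bounded_fun_setZ t (g : S -> R^o) : bounded_fun_set g -> bounded_fun_set (t *: g).
Proof.
by move=> gb; rewrite -[_ *: _]addr0; apply: bounded_fun_setL => //; exact: bounded_fun_set0.
Qed.

Lemma positive_functional_mono C L (g h : S -> R^o) : positive_functional C L ->
  bounded_fun_set g -> bounded_fun_set h -> (forall s, g s <= h s) -> L g <= L h.
Proof.
move=> [LD LZ LB] gb hb gh.
have nb : bounded_fun_set (- h).
  by rewrite -scaleN1r; exact: bounded_fun_setZ.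
have Lnh : L (- h) = - L h by rewrite -scaleN1r LZ// mulN1r.
have := LB 0 (g + - h); rewrite mulr0 LD// Lnh subr_le0; apply.
  by rewrite -[g]scale1r; exact: bounded_fun_setL.
by move=> s; rewrite subr_le0.
Qed.

Lemma pietsch_domination (N : Type) (C : R) (u : N -> S -> R^o) (c : N -> R) :
  0 <= C -> (forall n, bounded_fun_set (u n)) ->
  (forall (r : seq (N * R)) e, all (fun n => 0 <= n.2) r ->
     (forall s, \sum_(n <- r) n.2 * u n.1 s <= e) ->
     \sum_(n <- r) n.2 * c n.1 <= C * e) ->
  exists L, positive_functional C L /\ forall n, c n <= L (u n).
Proof.
move=> C0 ub uc.
pose D := @bounded_fun_set R S.
pose ok (g : S -> R^o) (B : R) (r : seq (N * R)) :=
  all (fun n => 0 <= n.2) r /\ forall s, g s + \sum_(n <- r) n.2 * u n.1 s <= B.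
pose E g := [set x | exists B r, ok g B r /\ x = C * B - \sum_(n <- r) n.2 * c n.1].
have Elb g : D g -> has_lbound (E g).
  move=> [K gK]; exists (- (C * K)) => _ [B [r [[r0 h] ->]]].
  suff : \sum_(n <- r) n.2 * c n.1 <= C * (B + K) by rewrite mulrDr; lra.
  apply: uc => // s; have := h s; have := gK s; rewrite ler_norml => /andP[]; lra.
have E0 g : D g -> E g !=set0.
  move=> [K gK]; exists (C * K), K, [::]; split; last by rewrite big_nil subr0.
  by split=> // s; rewrite big_nil addr0 (le_trans (ler_norm _)).
have Ein g B r : D g -> ok g B r -> inf (E g) <= C * B - \sum_(n <- r) n.2 * c n.1.
  by move=> Dg h; apply: ge_inf; [exact: Elb|exists B, r].
have Es : sublinear_on D (fun g => inf (E g)).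
  split=> [g h Dg Dh|t g].
    rewrite -lerBlDl; apply: lb_le_inf; first exact: E0.
    move=> _ [B [r [[r0 rB] ->]]].
    rewrite lerBlDl -lerBlDr; apply: lb_le_inf; first exact: E0.
    move=> _ [B' [r' [[r'0 rB'] ->]]].
    have Dgh : D (g + h) by rewrite -[g]scale1r; exact: bounded_fun_setL.
    rewrite lerBlDr (le_trans (Ein _ (B' + B) (r' ++ r) Dgh _))//.
      split=> [|s]; first by rewrite all_cat r'0.
      by rewrite big_cat/= -[(g + h) s]/(g s + h s) addrACA lerD.
    by rewrite big_cat/= mulrDr; lra.
  rewrite le_eqVlt => /predU1P[<-|t0] Dg.
    rewrite mul0r scale0r (le_trans (Ein _ 0 [::] _ _)) ?big_nil ?mulr0 ?subr0//.
      exact: bounded_fun_set0.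
    by split=> // s; rewrite big_nil addr0.
  rewrite -ler_pdivrMl//; apply: lb_le_inf; first exact: E0.
  move=> _ [B [r [[r0 rB] ->]]]; rewrite ler_pdivrMl//.
  have Dtg : D (t *: g) by exact: bounded_fun_setZ.
  rewrite (le_trans (Ein _ (t * B) [seq (n.1, t * n.2) | n <- r] Dtg _))//.
    split=> [|s].
      rewrite all_map; apply: sub_all r0 => n /= n0.
      by rewrite mulr_ge0// ltW.
    rewrite big_map/=; under eq_bigr do rewrite -mulrA.
    by rewrite -mulr_sumr -[(t *: g) s]/(t * g s) -mulrDr ler_pM2l.
  rewrite big_map/=; under eq_bigr do rewrite -mulrA.
  by rewrite -mulr_sumr mulrBr mulrCA.
have [L [LD LZ Lp]] := hahn_banach bounded_fun_set0 bounded_fun_setL Es.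
have LB B g : D g -> (forall s, g s <= B) -> L g <= C * B.
  move=> Dg gB; rewrite (le_trans (Lp g Dg))//.
  rewrite (le_trans (Ein g B [::] Dg _)) ?big_nil ?subr0//.
  by split=> // s; rewrite big_nil addr0.
exists L; split=> // n.
have nb : D (- u n).
  by rewrite -scaleN1r; exact: bounded_fun_setZ.
have : L (- u n) <= C * 0 - c n.
  rewrite (le_trans (Lp _ nb))// (le_trans (Ein _ 0 [:: (n, 1)] nb _))//.
    by split=> [|s]; rewrite /= ?ler01// big_seq1/= mul1r addNr.
  by rewrite big_seq1 mul1r.
rewrite -scaleN1r LZ//; lra.
Qed.

End Domination.

Section DualBall.
Variables (R : realType) (X : normedModType R[i]) (phi : dual_ball X).

Lemma dual_ball0 : val phi 0 = 0.
Proof.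
apply: (addrI (val phi 0)); have := (dual_ballP phi).1 1 0 0.
by rewrite scale1r addr0 addr0 scale1r => <-.
Qed.

Lemma dual_ballZ (a : R[i]) x : val phi (a *: x) = a * val phi x.
Proof. by have := (dual_ballP phi).1 a x 0; rewrite dual_ball0 !addr0. Qed.

Lemma dual_ballD x y : val phi (x + y) = val phi x + val phi y.
Proof. by have := (dual_ballP phi).1 1 x y; rewrite !scale1r. Qed.

Lemma dual_ballB x y : val phi (x - y) = val phi x - val phi y.
Proof. by rewrite -scaleN1r dual_ballD dual_ballZ mulN1r. Qed.

Lemma dual_ball_sum (I : Type) (r : seq I) (F : I -> X) :
  val phi (\sum_(i <- r) F i) = \sum_(i <- r) val phi (F i).
Proof.
by elim: r => [|i r IH]; rewrite ?big_nil ?dual_ball0// !big_cons dual_ballD IH.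
Qed.

Lemma dual_ball_le x : normc (val phi x) <= rnorm x.
Proof. by rewrite -lecR -normE; exact: (dual_ballP phi).2. Qed.

End DualBall.

(* The multiplication is bounded for the injective norm on the algebraic tensor
   product. *)
Definition injectively_bounded (R : realType) (A : banachAlgType R[i]) (C : R) :=
  forall (s : seq (A * A)) (e : R),
    (forall p : dual_pair A A, normc (tensor_form s p) <= e) ->
    rnorm (\sum_(t <- s) amul t.1 t.2) <= C * e.

Lemma normc_sum (R : realType) (I : Type) (r : seq I) (F : I -> R[i]) :
  normc (\sum_(i <- r) F i) <= \sum_(i <- r) normc (F i).
Proof.
elim: r => [|i r IH]; first by rewrite !big_nil normc0.
by rewrite !big_cons (le_trans (normcD _ _))// lerD2l.
Qed.

Lemma normc_conj (R : realType) (z : R[i]) : normc z^*%C = normc z.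
Proof. by case: z => a b /=; rewrite sqrrN. Qed.

Section InjectiveBound.
Variables (R : realType) (A : banachAlgType R[i]).

Lemma it_fun_sum (s : seq (A * A)) p :
  (\sum_(t <- s) tensor t.1 t.2 : injective_tensor A A) p = tensor_form s p.
Proof.
rewrite tensor_formE; elim: s => [|t s IH]; first by rewrite !big_nil.
by rewrite !big_cons -IH.
Qed.

Lemma injective_algebra_bounded : injective_algebra A ->
  exists2 C : R, 0 < C & injectively_bounded A C.
Proof.
move=> [M [/bounded_mapP[C C0 MC] Mt]]; exists C => // s e se.
have -> : \sum_(t <- s) amul t.1 t.2 = M (\sum_(t <- s) tensor t.1 t.2).
  by rewrite linear_sum; apply: eq_bigr => t _; rewrite Mt.
rewrite (le_trans (MC _))// ler_pM2l//.
by rewrite -lecR -normE injective_tensor_normE lecR it_normP => p; rewrite it_fun_sum.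
Qed.

Variables (C : R).
Hypotheses (C0 : 0 < C) (AC : injectively_bounded A C).

Let S : Type := dual_ball A.

Let usq (a : A) : S -> R^o := fun psi => normc (val psi a) ^+ 2.

Lemma usq_le a psi : usq a psi <= rnorm a ^+ 2.
Proof. by rewrite ler_pXn2r ?nnegrE ?normc_ge0 ?rnorm_ge0// dual_ball_le. Qed.

Lemma usq_bounded a : bounded_fun_set (usq a).
Proof.
by exists (rnorm a ^+ 2) => psi; rewrite ger0_norm ?sqr_ge0// usq_le.
Qed.

Lemma dual_ball_amul_dominated (phi : S) : exists L : (S -> R^o) -> R,
  positive_functional C L /\ forall a b,
    normc (val phi (amul a b)) ^+ 2 <= C * rnorm b ^+ 2 * L (usq a).
Proof.
pose u (n : A * A) : S -> R^o := rnorm n.2 ^+ 2 *: usq n.1.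
pose c (n : A * A) := normc (val phi (amul n.1 n.2)) ^+ 2 / C.
have ub n : bounded_fun_set (u n).
  by apply: bounded_fun_setZ; exact: usq_bounded.
have [|L [pL Lc]] := @pietsch_domination R S _ C u c (ltW C0) ub; last first.
  exists L; split=> // a b; have := Lc (a, b); rewrite /c /u /=.
  have [_ LZ _] := pL; rewrite LZ; last exact: usq_bounded.
  by rewrite ler_pdivrMr// mulrC mulrA.
move=> r e r0 re.
pose f (n : A * A) := val phi (amul n.1 n.2).
pose X := \sum_(n <- r) n.2 * normc (f n.1) ^+ 2.
have -> : \sum_(n <- r) n.2 * c n.1 = X / C.
  by rewrite mulr_suml; apply: eq_bigr => n _; rewrite mulrA.
pose s := [seq (n.1.1, (n.2%:C * (f n.1)^*%C) *: n.1.2) | n <- r].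
have XE : X%:C = val phi (\sum_(t <- s) amul t.1 t.2).
  rewrite big_map/= dual_ball_sum /X rmorph_sum; apply: eq_bigr => n _.
  rewrite amulZr dual_ballZ -/(f n.1) rmorphM/= -mulrA; congr (_ * _).
  rewrite /f; case: (val phi _) => x y /=; rewrite sqr_sqrtr ?addr_ge0 ?sqr_ge0//.
  by simpc; congr (_ +i* _); ring.
have X0 : 0 <= X.
  rewrite /X; elim: (r) r0 => [|n r' IH]; first by rewrite big_nil.
  by rewrite big_cons/= => /andP[n0 /IH]; apply: addr_ge0; rewrite mulr_ge0 ?sqr_ge0.
have : X <= C * (X / (2 * C) + C * e / 2).
  rewrite -[leLHS](ger0_norm X0) -normc_real XE (le_trans (dual_ball_le _ _))//.
  apply: AC => p; rewrite tensor_formE big_map/= (le_trans (normc_sum _ _))//.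
  apply: (@le_trans _ _ (X / (2 * C) + C * (\sum_(n <- r) n.2 * u n.1 p.1) / 2)); last first.
    by rewrite lerD2l ler_pM2r ?invr_gt0// ler_pM2l.
  rewrite /X mulr_sumr !mulr_suml -big_split /=.
  elim: (r) r0 => [|n r' IH]; first by rewrite !big_nil.
  rewrite !big_cons/= => /andP[n0 /IH]; apply: lerD.
  rewrite dual_ballZ !normcM normc_real (ger0_norm n0) normc_conj.
  rewrite -[u n.1 p.1]/(rnorm n.1.2 ^+ 2 * normc (val p.1 n.1.1) ^+ 2).
  have h2 := dual_ball_le p.2 n.1.2.
  have h0 := normc_ge0 (val p.1 n.1.1); have hf := normc_ge0 (f n.1).
  set x := normc (val p.1 _) in h0 *; set y := normc (val p.2 _) in h2 *.
  rewrite -/(f n.1); set z := normc (f _) in hf *; set w := rnorm _ in h2 *.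
  move: hf h0 h2; move: x y z w => x y z w hf h0 h2.
  move: n.2 n0 => t t0.
  apply: (@le_trans _ _ (t * (x * z * w))).
    rewrite (_ : x * (t * z * y) = t * (x * z * y)); last by ring.
    by rewrite ler_wpM2l// ler_wpM2l// mulr_ge0.
  rewrite [leRHS](_ : _ = t * (z ^+ 2 / (2 * C) + C * (w ^+ 2 * x ^+ 2) / 2)); last by ring.
  rewrite ler_wpM2l// -subr_ge0.
  rewrite [leRHS](_ : _ = (z - C * w * x) ^+ 2 / (2 * C)); last by field; rewrite gt_eqF.
  by rewrite divr_ge0 ?sqr_ge0// mulr_ge0// ltW.
have -> : C * (X / (2 * C) + C * e / 2) = X / 2 + C * C * e / 2.
  by field; rewrite gt_eqF.
by rewrite ler_pdivrMr// => h; rewrite mulrAC; lra.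
Qed.

End InjectiveBound.

Lemma normc_par (R : realType) (x y : R[i]) :
  normc (x + y) ^+ 2 + normc (x - y) ^+ 2 = 2 * normc x ^+ 2 + 2 * normc y ^+ 2.
Proof.
case: x y => [x1 y1] [x2 y2] /=.
by rewrite !sqr_sqrtr ?addr_ge0 ?sqr_ge0//; ring.
Qed.

(* Iterating the domination [|phi(ab)|^2 <= C |b|^2 L_phi(|psi(a)|^2)] inside the
   positive functionals and summing the iterates geometrically gives a Hilbertian
   seminorm above [|phi|] for which right multiplications are bounded. *)
Section InvariantForm.
Variables (R : realType) (A : banachAlgType R[i]) (C : R).
Hypotheses (C0 : 0 < C) (AC : injectively_bounded A C).

Let S : Type := dual_ball A.

Variable L : S -> (S -> R^o) -> R.
Hypothesis Lpos : forall phi, positive_functional C (L phi).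
Hypothesis Ldom : forall phi a b, normc (val phi (amul a b)) ^+ 2 <=
  C * rnorm b ^+ 2 * L phi (fun psi => normc (val psi a) ^+ 2).

Fixpoint dom_iter (k : nat) (phi : S) (a : A) : R :=
  if k is k'.+1 then L phi (fun psi => dom_iter k' psi a)
  else normc (val phi a) ^+ 2.

Lemma dom_iter_bounds k phi a : 0 <= dom_iter k phi a <= C ^+ k * rnorm a ^+ 2.
Proof.
elim: k phi => [|k IH] phi /=.
  by rewrite sqr_ge0 expr0 mul1r ler_pXn2r ?nnegrE ?normc_ge0 ?rnorm_ge0// dual_ball_le.
have gb : bounded_fun_set (fun psi => dom_iter k psi a : R^o).
  by exists (C ^+ k * rnorm a ^+ 2) => psi; have /andP[h] := IH psi; rewrite ger0_norm.
have [LD LZ LB] := Lpos phi; apply/andP; split.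
  have L0 : L phi 0 = 0.
    by rewrite -(scale0r 0) LZ ?mul0r//; exact: bounded_fun_set0.
  rewrite -L0; apply: (positive_functional_mono (Lpos phi)) => //.
    exact: bounded_fun_set0.
  by move=> psi; have /andP[] := IH psi.
by rewrite exprS -mulrA; apply: LB => // psi; have /andP[] := IH psi.
Qed.

Lemma dom_iter_ge0 k phi a : 0 <= dom_iter k phi a.
Proof. by have /andP[] := dom_iter_bounds k phi a. Qed.

Lemma dom_iter_bounded k a : bounded_fun_set (fun psi => dom_iter k psi a : R^o).
Proof.
exists (C ^+ k * rnorm a ^+ 2) => psi; rewrite ger0_norm ?dom_iter_ge0//.
by have /andP[] := dom_iter_bounds k psi a.
Qed.

Lemma dom_iterZ k phi (z : R[i]) a :
  dom_iter k phi (z *: a) = normc z ^+ 2 * dom_iter k phi a.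
Proof.
elim: k phi => [|k IH] phi /=; first by rewrite dual_ballZ normcM exprMn.
have [_ LZ _] := Lpos phi; rewrite -LZ; last exact: dom_iter_bounded.
by congr (L phi _); apply/funext => psi; rewrite IH.
Qed.

Lemma dom_iter_par k phi a b : dom_iter k phi (a + b) + dom_iter k phi (a - b) =
  2 * dom_iter k phi a + 2 * dom_iter k phi b.
Proof.
elim: k phi => [|k IH] phi /=.
  by rewrite dual_ballD dual_ballB; exact: normc_par.
have [LD LZ _] := Lpos phi; have db := dom_iter_bounded k.
rewrite -!LZ// -!LD//; try exact: bounded_fun_setZ.
by congr (L phi _); apply/funext => psi; exact: IH.
Qed.

Lemma dom_iter_amul k phi a b :
  dom_iter k phi (amul a b) <= C * rnorm b ^+ 2 * dom_iter k.+1 phi a.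
Proof.
elim: k phi => [|k IH] phi; first exact: Ldom.
have [_ LZ _] := Lpos phi.
rewrite -[dom_iter k.+2 phi a]/(L phi (fun psi => dom_iter k.+1 psi a)) -LZ; last exact: dom_iter_bounded.
apply: (positive_functional_mono (Lpos phi)); last exact: IH.
  exact: dom_iter_bounded.
by apply: bounded_fun_setZ; exact: dom_iter_bounded.
Qed.

Let part phi a n : R := \sum_(k < n) (2 * C) ^- k * dom_iter k phi a.

Let part_le phi a n : part phi a n <= 2 * rnorm a ^+ 2.
Proof.
suff : part phi a n <= (2 - 2 ^- n * 2) * rnorm a ^+ 2.
  move=> /le_trans; apply; rewrite ler_wpM2r ?sqr_ge0// gerBl.
  by rewrite mulr_ge0 ?invr_ge0 ?exprn_ge0.
elim: n => [|n IH]; first by rewrite /part big_ord0 expr0 invr1 mul1r subrr mul0r.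
rewrite /part big_ord_recr/= (le_trans (lerD IH (_ : _ <= 2 ^- n * rnorm a ^+ 2)))//.
  have /andP[_ h] := dom_iter_bounds n phi a.
  rewrite exprMn invfM -mulrA ler_pM2l ?invr_gt0 ?exprn_gt0//.
  by rewrite ler_pdivrMl ?exprn_gt0.
rewrite -mulrDl (exprS 2 n) invfM; move: (rnorm a ^+ 2) (2 ^- n) => x y; lra.
Qed.

Let part_nd phi a : nondecreasing_seq (part phi a).
Proof.
apply/nondecreasing_seqP => n; rewrite /part big_ord_recr/= lerDl.
by rewrite mulr_ge0 ?dom_iter_ge0// invr_ge0 exprn_ge0// mulr_ge0// ltW.
Qed.

Let part_cvg phi a : cvgn (part phi a).
Proof.
apply: nondecreasing_is_cvgn => //.
by exists (2 * rnorm a ^+ 2) => _ [n _ <-]; exact: part_le.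
Qed.

Definition inv_form phi a : R := limn (part phi a).

Let part_inv phi a n : part phi a n <= inv_form phi a.
Proof. exact: nondecreasing_cvgn_le. Qed.

Lemma inv_form_le phi a : inv_form phi a <= 2 * rnorm a ^+ 2.
Proof. by apply: limr_le => //; near=> n; exact: part_le. Unshelve. all: by end_near. Qed.

Lemma inv_form_ge phi a : normc (val phi a) ^+ 2 <= inv_form phi a.
Proof.
apply: le_trans (part_inv phi a 1).
by rewrite /part big_ord1 expr0 invr1 mul1r.
Qed.

Lemma inv_form_ge0 phi a : 0 <= inv_form phi a.
Proof. by apply: le_trans (inv_form_ge phi a); exact: sqr_ge0. Qed.

Lemma inv_formZ phi (z : R[i]) a : inv_form phi (z *: a) = normc z ^+ 2 * inv_form phi a.
Proof.
rewrite /inv_form (_ : part phi (z *: a) = (normc z ^+ 2) *: part phi a).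
  by rewrite limZr.
apply/funext => n; rewrite /part fctE /GRing.scale/= mulr_sumr; apply: eq_bigr => k _.
by rewrite dom_iterZ mulrCA.
Qed.

Lemma inv_form_par phi a b : inv_form phi (a + b) + inv_form phi (a - b) =
  2 * inv_form phi a + 2 * inv_form phi b.
Proof.
rewrite /inv_form -limD//.
rewrite (_ : part phi (a + b) + part phi (a - b) = (2 *: part phi a) + (2 *: part phi b)).
  have cz x : cvgn (2 *: part phi x).
    by move: (@part_cvg phi x); move: (part phi x) => f fc; apply: is_cvgZr.
  by apply: etrans (limD (cz a) (cz b)) _; rewrite !limZr.
apply/funext => n; rewrite fctE /= /part.
rewrite -[RHS]/(2 * _ + 2 * _) !mulr_sumr -!big_split/=; apply: eq_bigr => k _.
by rewrite -mulrDr dom_iter_par; ring.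
Qed.

Lemma inv_form_amul phi a b :
  inv_form phi (amul a b) <= 2 * C ^+ 2 * rnorm b ^+ 2 * inv_form phi a.
Proof.
have K0 : 0 <= 2 * C ^+ 2 * rnorm b ^+ 2.
  by apply: mulr_ge0; [apply: mulr_ge0 => //|]; exact: sqr_ge0.
apply: limr_le => //; near=> n.
apply: (@le_trans _ _ (2 * C ^+ 2 * rnorm b ^+ 2 * part phi a n.+1)); last first.
  by rewrite ler_wpM2l ?part_inv.
rewrite /part big_ord_recl/= mulrDr.
apply: (@le_trans _ _ (0 + 2 * C ^+ 2 * rnorm b ^+ 2 *
  (\sum_(k < n) (2 * C) ^- k.+1 * dom_iter k.+1 phi a))); last first.
  rewrite lerD2r; apply: mulr_ge0 => //; rewrite expr0 invr1 mul1r.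
  exact: sqr_ge0.
rewrite add0r mulr_sumr; apply: ler_sum => k _.
rewrite (_ : _ * (_ * _) = (2 * C) ^- k * (C * rnorm b ^+ 2 * dom_iter k.+1 phi a)).
  rewrite ler_pM2l; first exact: dom_iter_amul.
  by rewrite invr_gt0 exprn_gt0// mulr_gt0.
rewrite (exprS (2 * C) k) invfM; set x := (2 * C) ^- k; set y := dom_iter _ _ _.
by field; rewrite gt_eqF.
Unshelve. all: by end_near. Qed.

Definition inv_qform phi : qform A :=
  QForm (inv_form_ge0 phi) (inv_formZ phi) (inv_form_par phi).

End InvariantForm.

Lemma injectively_bounded_qform (R : realType) (A : banachAlgType R[i]) (C : R) :
  0 < C -> injectively_bounded A C ->
  exists (K : R) (q : dual_ball A -> qform A), 0 <= K /\ forall phi a b,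
    [/\ normc (val phi a) ^+ 2 <= q phi a, q phi a <= 2 * rnorm a ^+ 2 &
      q phi (amul a b) <= K * rnorm b ^+ 2 * q phi a].
Proof.
move=> C0 AC; have /choice[L LP] := dual_ball_amul_dominated C0 AC.
have Lpos phi := (LP phi).1; have Ldom phi := (LP phi).2.
exists (2 * C ^+ 2), (fun phi => inv_qform C0 Lpos phi); split=> [|phi a b].
  by rewrite mulr_ge0 ?sqr_ge0.
split; [exact: inv_form_ge|exact: inv_form_le|exact: inv_form_amul].
Qed.

Lemma bounded_below_isomorphic (R : realType) (A : banachAlgType R[i])
    (H : completeNormedModType R[i]) (Phi : {linear A -> bounded_op H}) (c : R) :
  0 <= c -> is_hilbert H -> bounded_map Phi ->
  (forall a b, Phi (amul a b) = comp_op (Phi a) (Phi b)) ->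
  (forall a, rnorm a <= c * rnorm (Phi a)) -> isomorphic_to_operator_algebra A.
Proof.
move=> c0 hilH bPhi PhiM lowPhi.
have [d d0 upPhi] := bounded_mapP bPhi.
have Phi_inj : injective Phi.
  move=> a b ab; apply/eqP; rewrite -subr_eq0; apply/eqP/rnorm0_eq0/eqP.
  rewrite eq_le rnorm_ge0 andbT (le_trans (lowPhi _))//.
  by rewrite linearB/= ab subrr rnorm0 mulr0.
pose Psi (T : bounded_op H) : A := xget 0 [set a | Phi a = T].
have PhiK : cancel Phi Psi.
  by move=> a; rewrite /Psi; case: xgetP => [b _ /Phi_inj//|/(_ a)/=].
exists H, (range Phi), Phi, Psi; split=> //; last first.
  exists c%:C => T [a _ <-]; rewrite PhiK !normE -rmorphM lecR; exact: lowPhi.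
split=> //; split.
- move=> T clT; pose P e a := rnorm (Phi a - T) <= e.
  have Pex e : 0 < e -> exists a, P e a.
    move=> e0; have e0' : 0 < e%:C by rewrite ltcR.
    have [S [[a _ <-] aT]] := clT _ (nbhsx_ballx T _ e0').
    exists a; rewrite /P rnormB ltW//.
    by move: aT; rewrite -ball_normE/= normE ltcR.
  have [//|e1 e2 a b Pa Pb|l hl] := @approx_limit R A P c.
    rewrite (le_trans (lowPhi _))// ler_wpM2l// linearB/=.
    rewrite (le_trans (rnorm_triangle _ T _))// lerD//.
    by rewrite rnormB.
  exists l => //; apply/eqP; rewrite -subr_eq0; apply/eqP/rnorm0_eq0/eqP.
  rewrite eq_le rnorm_ge0 andbT; apply/ler_addgt0Pr => e e0; rewrite add0r.
  have k0 : 0 < d * c + 1 by rewrite ltr_wpDl// mulr_ge0// ltW.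
  have [|a Pa] := Pex (e / (d * c + 1)); first by rewrite divr_gt0.
  rewrite (le_trans (rnorm_triangle _ (Phi a) _))//.
  rewrite (le_trans (lerD _ Pa) (_ : d * (c * (e / (d * c + 1))) + _ <= _))//.
    by rewrite -linearB (le_trans (upPhi _))// ler_pM2l// rnormB hl.
  rewrite [leLHS](_ : _ = e / (d * c + 1) * (d * c + 1)); last by ring.
  by rewrite divfK// gt_eqF.
- by exists 0 => //; rewrite linear0.
- by move=> a _ _ [x _ <-] [y _ <-]; exists (a *: x + y) => //; rewrite linearP.
- by move=> _ _ [x _ <-] [y _ <-]; exists (amul x y).
Qed.

Section Representation.
Variables (R : realType) (A : banachAlgType R[i]) (K : R).
Let S : choiceType := dual_ball A.
Variable q : S -> qform A.
Hypotheses (K0 : 0 <= K)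
  (qamul : forall phi a b, q phi (amul a b) <= K * rnorm b ^+ 2 * q phi a).

Definition qsum (v : S -> A) : \bar R := (\esum_(phi in [set: S]) (q phi (v phi))%:E)%E.

Lemma qsum_ge0 v : (0 <= qsum v)%E.
Proof. by apply: esum_ge0 => phi _; rewrite lee_fin qf_ge0. Qed.

Definition dsum_pred : {pred S -> A} := fun v => `[< (qsum v < +oo)%E >].

Lemma qsumZ (a : R[i]) v : qsum (a *: v) = ((normc a ^+ 2)%:E * qsum v)%E.
Proof.
rewrite /qsum -esumZ ?sqr_ge0//; last by move=> phi; exact: qf_ge0.
by apply: eq_esum => phi _; rewrite -qfZ.
Qed.

Lemma qsum_par u v :
  (qsum (u + v)%R + qsum (u - v)%R = 2%:E * qsum u + 2%:E * qsum v)%E.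
Proof.
have q0 w phi : (0 <= (q phi (w phi))%:E)%E by rewrite lee_fin qf_ge0.
rewrite /qsum -!esumZ//; try by move=> phi; exact: qf_ge0.
rewrite -!esumD; try by move=> phi _; rewrite ?q0// lee_fin mulr_ge0// qf_ge0.
by apply: eq_esum => phi _; rewrite -!EFinD qf_par.
Qed.

Lemma dsum_submod : submod_closed dsum_pred.
Proof.
split.
  apply/asboolP; rewrite /qsum esum1 ?ltry// => phi _.
  by rewrite -[X in q phi X]/(0 : A) qf0.
move=> a u v /asboolP su /asboolP sv; apply/asboolP.
have h : (qsum (a *: u + v)%R <= qsum (a *: u + v)%R + qsum (a *: u - v)%R)%E.
  by rewrite leeDl// qsum_ge0.
rewrite (le_lt_trans h)// qsum_par qsumZ.
by rewrite lte_add_pinfty// lte_mul_pinfty// ?lee_fin ?sqr_ge0// lte_mul_pinfty ?lee_fin ?sqr_ge0.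
Qed.

HB.instance Definition _ := GRing.isSubmodClosed.Build _ _ dsum_pred dsum_submod.

Record dsum := DSum { dsum_fun :> S -> A ; dsumP : dsum_fun \in dsum_pred }.

HB.instance Definition _ := [isSub for dsum_fun].
HB.instance Definition _ := [Choice of dsum by <:].
HB.instance Definition _ := [SubChoice_isSubLmodule of dsum by <:].

Definition dsum_q (v : dsum) : R := fine (qsum v).

Lemma dsum_qE v : (dsum_q v)%:E = qsum v.
Proof.
rewrite fineK// ge0_fin_numE ?qsum_ge0//.
by have /asboolP := dsumP v.
Qed.

Lemma dsum_q_ge0 v : 0 <= dsum_q v.
Proof. by rewrite fine_ge0// qsum_ge0. Qed.

Lemma dsum_qZ (a : R[i]) v : dsum_q (a *: v) = normc a ^+ 2 * dsum_q v.
Proof. by apply: EFin_inj; rewrite EFinM !dsum_qE qsumZ. Qed.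

Lemma dsum_q_par u v : dsum_q (u + v) + dsum_q (u - v) = 2 * dsum_q u + 2 * dsum_q v.
Proof. by apply: EFin_inj; rewrite !EFinD !EFinM !dsum_qE qsum_par. Qed.

Definition dsum_qform : qform dsum := QForm dsum_q_ge0 dsum_qZ dsum_q_par.

Lemma dsum_q_coord (v : dsum) phi : q phi (v phi) <= dsum_q v.
Proof.
rewrite -lee_fin dsum_qE /qsum.
rewrite -(@esum_set1 R S phi (fun phi => (q phi (v phi))%:E)) ?lee_fin ?qf_ge0//.
rewrite esum_mkcond; apply: le_esum => psi _.
by case: ifP => // _; rewrite lee_fin qf_ge0.
Qed.

Lemma qsum_rmul (v : dsum) b :
  (qsum (fun phi => amul (v phi) b) <= (K * rnorm b ^+ 2 * dsum_q v)%:E)%E.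
Proof.
have Kb : 0 <= K * rnorm b ^+ 2 by rewrite mulr_ge0// sqr_ge0.
rewrite EFinM dsum_qE /qsum -esumZ//; last by move=> phi; exact: qf_ge0.
by apply: le_esum => phi _; rewrite lee_fin.
Qed.

Lemma dsum_rmul_pred (v : dsum) b : (fun phi => amul (v phi) b) \in dsum_pred.
Proof. by apply/asboolP; rewrite (le_lt_trans (qsum_rmul v b))// ltry. Qed.

Definition dsum_rmul v b := DSum (dsum_rmul_pred v b).

Lemma dsum_q_rmul v b : dsum_q (dsum_rmul v b) <= K * rnorm b ^+ 2 * dsum_q v.
Proof. by rewrite -lee_fin dsum_qE qsum_rmul. Qed.

Local Notation H := (qdual dsum_qform).

Lemma qdual_rmul_bound (f : H) b v : normc (f (dsum_rmul v b)) <=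
  Num.sqrt K * rnorm b * qdual_norm f * Num.sqrt (dsum_q v).
Proof.
rewrite (le_trans (qdual_norm_ub f _))//= mulrC mulrAC.
rewrite ler_wpM2r ?qdual_norm_ge0//.
have -> : rnorm b = Num.sqrt (rnorm b ^+ 2).
  by rewrite sqrtr_sqr ger0_norm// rnorm_ge0.
have Kb : 0 <= K * rnorm b ^+ 2 by rewrite mulr_ge0// sqr_ge0.
by rewrite -!sqrtrM// ler_wsqrtr// dsum_q_rmul.
Qed.

Lemma rep_fun_pred (b : A) (f : H) :
  (fun v => f (dsum_rmul v b)) \in qdual_pred dsum_qform.
Proof.
apply/asboolP; split=> [a u v|].
  have -> : dsum_rmul (a *: u + v) b = a *: dsum_rmul u b + dsum_rmul v b.
    by apply/val_inj/funext => phi; rewrite /= amulDl amulZl.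
  exact: qdual_linear.
by exists (Num.sqrt K * rnorm b * qdual_norm f) => v; exact: qdual_rmul_bound.
Qed.

Definition rep_fun b f : H := QDual (rep_fun_pred b f).

Lemma rep_fun_norm b f :
  qdual_norm (rep_fun b f) <= Num.sqrt K * rnorm b * qdual_norm f.
Proof.
apply/qdual_normP => [|v]; last exact: qdual_rmul_bound.
by rewrite !mulr_ge0 ?sqrtr_ge0 ?rnorm_ge0 ?qdual_norm_ge0.
Qed.

Lemma rep_pred b : rep_fun b \in @bounded_op_pred R H.
Proof.
apply/asboolP; split=> [a f g|].
  by apply/val_inj/funext.
exists (Num.sqrt K * rnorm b)%:C => f.
by rewrite !normE -rmorphM lecR; exact: rep_fun_norm.
Qed.

Definition rep (b : A) : bounded_op H := BoundedOp (rep_pred b).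

Lemma rep_linear : linear rep.
Proof.
move=> a b c; apply/val_inj/funext => f; apply/val_inj/funext => v.
rewrite -[RHS]/(a * f (dsum_rmul v b) + f (dsum_rmul v c)).
rewrite -[LHS]/(f (dsum_rmul v (a *: b + c))) -(qdualZ f) -(qdualD f).
by congr (f _); apply/val_inj/funext => phi; rewrite /= amulDr amulZr.
Qed.

HB.instance Definition _ := GRing.isLinear.Build R[i] A (bounded_op H) *:%R rep rep_linear.

Lemma rep_amul a b : rep (amul a b) = comp_op (rep a) (rep b).
Proof.
apply/val_inj/funext => f; apply/val_inj/funext => v.
rewrite -[LHS]/(f (dsum_rmul v (amul a b))).
rewrite -[RHS]/(f (dsum_rmul (dsum_rmul v a) b)).
by congr (f _); apply/val_inj/funext => phi; rewrite /= amulA.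
Qed.

Lemma rep_op_norm b : op_norm (rep b) <= Num.sqrt K * rnorm b.
Proof.
apply/op_normP => [|f]; first by rewrite mulr_ge0 ?sqrtr_ge0 ?rnorm_ge0.
exact: rep_fun_norm.
Qed.

Hypotheses (qge : forall phi a, normc (val phi a) ^+ 2 <= q phi a)
  (qle : forall phi a, q phi a <= 2 * rnorm a ^+ 2).

Lemma coord_form_bound phi (v : dsum) :
  normc (val phi (v phi)) <= 1 * Num.sqrt (dsum_q v).
Proof.
rewrite mul1r -[leLHS]ger0_norm ?normc_ge0// -sqrtr_sqr ler_wsqrtr//.
by rewrite (le_trans (qge _ _))// dsum_q_coord.
Qed.

Lemma coord_form_pred phi : (fun v : dsum => val phi (v phi)) \in qdual_pred dsum_qform.
Proof.
apply/asboolP; split=> [a u v|]; last by exists 1; exact: coord_form_bound.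
exact: (dual_ballP phi).1.
Qed.

Definition coord_form phi : H := QDual (coord_form_pred phi).

Lemma coord_form_norm phi : qdual_norm (coord_form phi) <= 1.
Proof. by apply/qdual_normP => // v; exact: coord_form_bound. Qed.

Definition dsum_single_fun phi (a : A) : S -> A := fun psi => if psi == phi then a else 0.

Lemma qsum_single phi a : qsum (dsum_single_fun phi a) = (q phi a)%:E.
Proof.
rewrite /qsum -(@esum_set1 R S phi (fun phi => (q phi a)%:E)) ?lee_fin ?qf_ge0//.
rewrite [RHS]esum_mkcond; apply: eq_esum => psi _; rewrite /dsum_single_fun.
have [->|/eqP ne] := eqVneq psi phi; first by rewrite mem_set.
by rewrite memNset ?qf0.
Qed.

Lemma dsum_single_pred phi a : dsum_single_fun phi a \in dsum_pred.
Proof. by apply/asboolP; rewrite qsum_single ltry. Qed.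

Definition dsum_single phi a : dsum := DSum (dsum_single_pred phi a).

Lemma dsum_q_single phi a : dsum_q (dsum_single phi a) = q phi a.
Proof. by apply: EFin_inj; rewrite dsum_qE qsum_single. Qed.

Variable e : A.
Hypothesis amul_e : forall a, amul e a = a.

Lemma rep_lower (phi : dual_ball A) b : normc (val phi b) <= Num.sqrt 2 * rnorm e * op_norm (rep b).
Proof.
have -> : val phi b = rep b (coord_form phi) (dsum_single phi e).
  by rewrite -[RHS]/(val phi (amul (dsum_single_fun phi e phi) b)) /dsum_single_fun eqxx amul_e.
rewrite (le_trans (qdual_norm_ub _ _))//= mulrC ler_pM ?sqrtr_ge0 ?qdual_norm_ge0//.
  rewrite dsum_q_single -[X in _ <= _ * X]ger0_norm ?rnorm_ge0// -sqrtr_sqr -sqrtrM//.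
  by rewrite ler_wsqrtr.
rewrite (le_trans (op_norm_ub (rep b) (coord_form phi)))//.
by rewrite ler_piMr ?op_norm_ge0// coord_form_norm.
Qed.

Lemma qform_isomorphic :
  (forall b, exists phi : dual_ball A, rnorm b <= normc (val phi b)) ->
  isomorphic_to_operator_algebra A.
Proof.
move=> norming.
apply: (@bounded_below_isomorphic R A H rep (Num.sqrt 2 * rnorm e)).
- by rewrite mulr_ge0 ?sqrtr_ge0 ?rnorm_ge0.
- exact: qdual_hilbert.
- exists (Num.sqrt K)%:C => b; rewrite !normE -rmorphM lecR; exact: rep_op_norm.
- exact: rep_amul.
- by move=> b; have [phi /le_trans] := norming b; apply; exact: rep_lower.
Qed.

End Representation.

Section BoundedInjective.
Variables (R : realType) (A : banachAlgType R[i]) (C : R).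
Hypotheses (C0 : 0 < C) (AC : injectively_bounded A C).

Let mulsum (s : seq (A * A)) : A := \sum_(t <- s) amul t.1 t.2.

Let comb (k : R[i]) (s s' : seq (A * A)) := [seq (k *: t.1, t.2) | t <- s] ++ s'.

Let tensor_form_comb k s s' p :
  tensor_form (comb k s s') p = k * tensor_form s p + tensor_form s' p.
Proof. by rewrite -tensor_formZ !tensor_formE big_cat. Qed.

Let mulsum_comb k s s' : mulsum (comb k s s') = k *: mulsum s + mulsum s'.
Proof.
rewrite /mulsum big_cat big_map /= scaler_sumr; congr (_ + _).
by apply: eq_bigr => t _; rewrite amulZl.
Qed.

Let near (T : injective_tensor A A) (e : R) (s : seq (A * A)) :=
  forall p, normc (T p - tensor_form s p) <= e.

Let near_comb k T T' e e' s s' : near T e s -> near T' e' s' ->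
  near (k *: T + T') (normc k * e + e') (comb k s s').
Proof.
move=> h h' p; rewrite tensor_form_comb.
rewrite -[it_fun _ p]/(k * T p + T' p) opprD addrACA -mulrBr.
by rewrite (le_trans (normcD _ _))// lerD// normcM ler_wpM2l// normc_ge0.
Qed.

Let near_ex T e : 0 < e -> exists s, near T e s.
Proof. by have /asboolP := it_funP T; apply. Qed.

Let mulsum_near T e e' s s' : near T e s -> near T e' s' ->
  rnorm (mulsum s - mulsum s') <= C * (e + e').
Proof.
move=> h h'; have -> : mulsum s - mulsum s' = mulsum (comb (-1) s' s).
  by rewrite mulsum_comb scaleN1r addrC.
apply: AC => p; rewrite tensor_form_comb mulN1r addrC -(subrKA (T p)).
by rewrite (le_trans (normcD _ _))// lerD// normcB.
Qed.

Lemma injectively_bounded_injective : injective_algebra A.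
Proof.
have /choice[M MP] (T : injective_tensor A A) : exists m : A,
    forall e s, near T e s -> rnorm (mulsum s - m) <= C * e.
  have [|e e' a b [s [hs ->]] [s' [hs' ->]]|l hl] :=
    @approx_limit R A (fun e a => exists s, near T e s /\ a = mulsum s) C.
  - by move=> e /(near_ex T)[s hs]; exists (mulsum s), s.
  - exact: mulsum_near hs hs'.
  - by exists l => e s hs; apply: hl; exists s.
have Mlin : linear M.
  move=> k T T'; apply/eqP; rewrite -subr_eq0; apply/eqP/rnorm0_eq0/eqP.
  rewrite eq_le rnorm_ge0 andbT; apply/ler_addgt0Pr => e e0; rewrite add0r.
  pose c := C * (normc k + 1) * 2.
  have c0 : 0 < c by rewrite !mulr_gt0// ltr_wpDl ?normc_ge0.
  have d0 : 0 < e / c by rewrite divr_gt0.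
  have [s hs] := near_ex T d0; have [s' hs'] := near_ex T' d0.
  have h := MP _ _ _ (near_comb k hs hs'); rewrite mulsum_comb in h.
  have h1 := MP _ _ _ hs; have h2 := MP _ _ _ hs'.
  rewrite (le_trans (rnorm_triangle _ (k *: mulsum s + mulsum s') _))//.
  rewrite rnormB opprD addrACA -scalerBr (le_trans (lerD h (rnormD _ _)))//.
  rewrite rnormZ (le_trans (lerD (lexx _) (lerD (ler_wpM2l (normc_ge0 k) h1) h2)))//.
  rewrite [leLHS](_ : _ = e / c * c); last by rewrite /c; ring.
  by rewrite divfK// gt_eqF.
pose ML := @GRing.isLinear.Build _ _ _ _ M Mlin.
pose L : {linear injective_tensor A A -> A} := HB.pack M ML.
exists L; split=> [|a b].
  exists C%:C => T; rewrite injective_tensor_normE normE -rmorphM lecR.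
  rewrite -[rnorm _]/(rnorm (M T)); apply/ler_addgt0Pr => e e0.
  have d0 : 0 < e / (C * 2) by rewrite divr_gt0// mulr_gt0.
  have [s hs] := near_ex T d0.
  have h : rnorm (mulsum s) <= C * (it_norm T + e / (C * 2)).
    apply: AC => p; rewrite -[tensor_form s p](subKr (T p)).
    rewrite (le_trans (normcD _ _))// normcN lerD// it_norm_ub//.
  have := rnorm_triangle (M T) (mulsum s) 0; rewrite !subr0 rnormB.
  move=> /le_trans; apply; rewrite (le_trans (lerD (MP _ _ _ hs) h))//.
  rewrite [leLHS](_ : _ = C * it_norm T + e)//; field.
  by rewrite gt_eqF.
have h : near (tensor a b) 0 [:: (a, b)].
  by move=> p; rewrite tensor_formE big_seq1 subrr normc0.
apply/eqP; rewrite eq_sym -subr_eq0; apply/eqP/rnorm0_eq0/eqP.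
have := MP _ _ _ h; rewrite /mulsum big_seq1/= mulr0 => h'.
by rewrite eq_le rnorm_ge0 andbT.
Qed.

End BoundedInjective.

Section Rademacher.
Variables (R : realType) (K : Type).
Implicit Types (s : seq K) (p q : K -> R[i]).

Fixpoint cube (n : nat) : finType := if n is n'.+1 then (bool * cube n')%type else unit.

Lemma card_cube n : #|{: cube n}| = (2 ^ n)%N.
Proof. by elim: n => [|n IH]; rewrite ?card_unit// card_prod card_bool IH expnS. Qed.

Fixpoint rad_sum p s : cube (size s) -> R[i] :=
  match s return cube (size s) -> R[i] with
  | [::] => fun=> 0
  | k :: s' => fun e : bool * cube (size s') => (-1) ^+ e.1 * p k + rad_sum p e.2
  end.
Arguments rad_sum p s e : clear implicits.

Lemma sum_cube (V : nmodType) n (F : cube n.+1 -> V) :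
  \sum_e F e = \sum_(e : cube n) (F (false, e) + F (true, e)).
Proof.
transitivity (\sum_(p : bool * cube n) F (p.1, p.2)).
  by apply: eq_bigr => -[].
rewrite -(pair_bigA _ (fun b (e : cube n) => F (b, e)))/= big_bool/= addrC.
by rewrite big_split.
Qed.

Lemma rad_sum_prod p q s : \sum_e rad_sum p s e * rad_sum q s e =
  (2 ^+ size s) * \sum_(k <- s) p k * q k.
Proof.
elim: s => [|k s IH]; first by rewrite big_nil mulr0 big1// => e _; rewrite mulr0.
rewrite sum_cube/= big_cons.
rewrite (eq_bigr (fun e => 2 * (p k * q k) + 2 * (rad_sum p s e * rad_sum q s e))).
  2: by move=> e _; rewrite expr0 expr1; ring.
rewrite big_split/= -!mulr_sumr IH sumr_const card_cube exprS.
rewrite -(mulr_natl _ (2 ^ _)) natrX; ring.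
Qed.

Lemma rad_sum_sqr p s : \sum_e normc (rad_sum p s e) ^+ 2 =
  (2 ^+ size s) * \sum_(k <- s) normc (p k) ^+ 2.
Proof.
elim: s => [|k s IH]; first by rewrite big_nil mulr0 big1// => e _; rewrite normc0 expr0n.
rewrite sum_cube/= big_cons.
rewrite (eq_bigr (fun e => 2 * normc (p k) ^+ 2 + 2 * normc (rad_sum p s e) ^+ 2)).
  2: by move=> e _; rewrite expr0 expr1 mul1r mulN1r -normc_par -(normcN (- p k + _)) opprD opprK.
rewrite big_split/= -!mulr_sumr IH sumr_const card_cube exprS.
rewrite -(mulr_natl _ (2 ^ _)) natrX; ring.
Qed.

Lemma normc_pow4_par (x y : R[i]) : normc (x + y) ^+ 4 + normc (x - y) ^+ 4 <=
  2 * (normc x ^+ 4 + 6 * (normc x ^+ 2 * normc y ^+ 2) + normc y ^+ 4).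
Proof.
have e4 (z : R[i]) : normc z ^+ 4 = (normc z ^+ 2) ^+ 2 by rewrite -exprM.
rewrite !e4; case: x y => [x1 y1] [x2 y2] /=.
rewrite !sqr_sqrtr ?addr_ge0 ?sqr_ge0// -subr_ge0.
rewrite [leRHS](_ : _ = 8 * (x1 * y2 - y1 * x2) ^+ 2); last by ring.
by rewrite mulr_ge0// sqr_ge0.
Qed.

Lemma rad_sum_pow4 p s : \sum_e normc (rad_sum p s e) ^+ 4 <=
  (2 ^+ size s) * 3 * (\sum_(k <- s) normc (p k) ^+ 2) ^+ 2.
Proof.
elim: s => [|k s IH].
  by rewrite big_nil expr0n/= mulr0 big1//= => e _; rewrite expr0n/= addr0 sqrtr0 expr0n.
rewrite sum_cube/= big_cons.
set a := normc (p k) ^+ 2; set t := \sum_(j <- s) _.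
apply: (@le_trans _ _ (\sum_(e : cube (size s)) 2 * (normc (rad_sum p s e) ^+ 4 +
    6 * a * normc (rad_sum p s e) ^+ 2 + a ^+ 2))).
  apply: ler_sum => e _; rewrite expr0 expr1 mul1r mulN1r.
  rewrite ![_ + rad_sum _ _ _]addrC (le_trans (normc_pow4_par _ _))//.
  by rewrite le_eqVlt; apply/orP; left; apply/eqP; rewrite /a; ring.
rewrite -mulr_sumr !big_split/= -mulr_sumr rad_sum_sqr -/t sumr_const card_cube.
rewrite -(mulr_natl _ (2 ^ _)) natrX (exprS 2 (size s)).
move: IH; move: (\sum_e _) (2 ^+ size s : R) (@exprn_ge0 R (size s) 2 (ler0n _ 2)) => x N N0 IH.
have -> : 2 * N * 3 * (a + t) ^+ 2 = 2 * (N * 3 * t ^+ 2 + 6 * a * (N * t) + 3 * N * a ^+ 2).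
  by ring.
rewrite ler_pM2l//; apply: lerD; first exact: lerD.
by have := mulr_ge0 N0 (sqr_ge0 a); lra.
Qed.

End Rademacher.
Arguments rad_sum {R K} p s e.

Section Grothendieck.
Variables (R : realType) (I J : finType) (t : I -> J -> R[i]) (tau : R).
Hypothesis t_le : forall (x : I -> R[i]) (y : J -> R[i]),
  (forall i, normc (x i) <= 1) -> (forall j, normc (y j) <= 1) ->
  normc (\sum_i \sum_j t i j * (x i * y j)) <= tau.

Definition hilbert_bound (c : R) :=
  forall (K : finType) (p : I -> K -> R[i]) (q : J -> K -> R[i]),
  (forall i, \sum_k normc (p i k) ^+ 2 <= 1) ->
  (forall j, \sum_k normc (q j k) ^+ 2 <= 1) ->
  normc (\sum_i \sum_j t i j * \sum_k p i k * q j k) <= c.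

Lemma cauchy_schwarz_sum (K : finType) (x y : K -> R[i]) :
  \sum_k normc (x k) ^+ 2 <= 1 -> \sum_k normc (y k) ^+ 2 <= 1 ->
  normc (\sum_k x k * y k) <= 1.
Proof.
move=> x1 y1; rewrite (le_trans (normc_sum _ _))//.
apply: (@le_trans _ _ ((\sum_k normc (x k) ^+ 2 + \sum_k normc (y k) ^+ 2) / 2)).
  rewrite -big_split mulr_suml/=; apply: ler_sum => k _; rewrite normcM.
  have := sqr_ge0 (normc (x k) - normc (y k)); rewrite sqrrB -mulr_natl; lra.
lra.
Qed.

Lemma hilbert_bound_trivial : hilbert_bound (\sum_i \sum_j normc (t i j)).
Proof.
move=> K p q p1 q1; rewrite (le_trans (normc_sum _ _))//; apply: ler_sum => i _.
rewrite (le_trans (normc_sum _ _))//; apply: ler_sum => j _.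
by rewrite normcM ler_piMr ?normc_ge0// cauchy_schwarz_sum.
Qed.

Lemma hilbert_bound_scale c (K : finType) (a b : R) (p : I -> K -> R[i])
    (q : J -> K -> R[i]) : hilbert_bound c -> 0 < a -> 0 < b ->
  (forall i, \sum_k normc (p i k) ^+ 2 <= a ^+ 2) ->
  (forall j, \sum_k normc (q j k) ^+ 2 <= b ^+ 2) ->
  normc (\sum_i \sum_j t i j * \sum_k p i k * q j k) <= c * (a * b).
Proof.
move=> hc a0 b0 pa qb.
have sc (d : R) (z : K -> R[i]) : 0 < d -> \sum_k normc (z k) ^+ 2 <= d ^+ 2 ->
    \sum_k normc (d^-1%:C * z k) ^+ 2 <= 1.
  move=> d0 zd; under eq_bigr do rewrite normcM exprMn normc_real.
  rewrite -mulr_sumr ger0_norm ?invr_ge0 ?(ltW d0)// exprVn.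
  by rewrite ler_pdivrMl ?exprn_gt0// mulr1.
have := hc K (fun i k => a^-1%:C * p i k) (fun j k => b^-1%:C * q j k)
  (fun i => sc a _ a0 (pa i)) (fun j => sc b _ b0 (qb j)).
rewrite (_ : \sum_i _ = (a * b)^-1%:C * \sum_i \sum_j t i j * \sum_k p i k * q j k).
  rewrite normcM normc_real ger0_norm ?invr_ge0 ?mulr_ge0 ?(ltW a0) ?(ltW b0)//.
  by rewrite ler_pdivrMl ?mulr_gt0// mulrC.
rewrite mulr_sumr; apply: eq_bigr => i _; rewrite mulr_sumr; apply: eq_bigr => j _.
rewrite mulrCA; congr (_ * _); rewrite mulr_sumr; apply: eq_bigr => k _.
by rewrite invfM rmorphM/= mulrACA.
Qed.

(* Replace each vector by its Rademacher sum.  Truncating the sums at level 7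
   leaves scalars bounded by 7, and by the fourth moment estimate the remainders
   have [L^2] norm at most [sqrt 3 / 7 <= 1 / 4]. *)
Lemma hilbert_bound_improve c : 0 <= c -> hilbert_bound c ->
  hilbert_bound (49 * tau + c / 2).
Proof.
move=> c0 hc K p q p1 q1.
pose s := enum K; pose N : R := 2 ^+ size s.
have N0 : 0 < N by rewrite exprn_gt0.
pose X i e := rad_sum (p i) s e; pose Y j e := rad_sum (q j) s e.
pose cut (z : R[i]) := if normc z <= 7 then z else 0.
have cut7 z : normc (cut z) <= 7 by rewrite /cut; case: ifP => // _; rewrite normc0.
have cut_sqr z : normc (cut z) ^+ 2 <= normc z ^+ 2.
  by rewrite /cut; case: ifP => // _; rewrite normc0 expr0n/= sqr_ge0.
have rem_sqr z : normc (z - cut z) ^+ 2 <= normc z ^+ 4 / 49.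
  rewrite /cut; case: (leP (normc z) 7) => [_|z7].
    by rewrite subrr normc0 expr0n/= divr_ge0// exprn_ge0// normc_ge0.
  rewrite subr0 ler_pdivlMr// -[4%N]/(2 + 2)%N exprD ler_wpM2l ?sqr_ge0//.
  by rewrite (_ : 49 = 7 ^+ 2); [rewrite ler_pXn2r ?nnegrE ?normc_ge0// ltW|ring].
have E2 (z : K -> R[i]) : \sum_k normc (z k) ^+ 2 <= 1 ->
    \sum_e normc (rad_sum z s e) ^+ 2 <= N.
  by move=> z1; rewrite rad_sum_sqr big_enum ler_piMr// ltW.
have E4 (z : K -> R[i]) : \sum_k normc (z k) ^+ 2 <= 1 ->
    \sum_e normc (rad_sum z s e - cut (rad_sum z s e)) ^+ 2 <= N / 16.
  move=> z1; apply: (@le_trans _ _ (\sum_e normc (rad_sum z s e) ^+ 4 / 49)).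
    exact: ler_sum.
  rewrite -mulr_suml ler_pdivrMr// (le_trans (rad_sum_pow4 _ _))// big_enum/=.
  rewrite -/N; have h : (\sum_k normc (z k) ^+ 2) ^+ 2 <= 1.
    by rewrite expr_le1// sumr_ge0// => k _; rewrite sqr_ge0.
  rewrite (le_trans (ler_wpM2l _ h)) ?mulr_ge0 ?(ltW N0)//; lra.
pose T (P : I -> cube (size s) -> R[i]) (Q : J -> cube (size s) -> R[i]) :=
  \sum_i \sum_j t i j * \sum_e P i e * Q j e.
have TE : N%:C * (\sum_i \sum_j t i j * \sum_k p i k * q j k) =
    T (fun i e => cut (X i e)) (fun j e => cut (Y j e)) +
    (T (fun i e => cut (X i e)) (fun j e => Y j e - cut (Y j e)) +
     T (fun i e => X i e - cut (X i e)) Y).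
  rewrite /T -!big_split mulr_sumr; apply: eq_bigr => i _.
  rewrite -!big_split mulr_sumr; apply: eq_bigr => j _ /=.
  rewrite -!mulrDr mulrCA; congr (_ * _); rewrite -!big_split/=.
  rewrite (eq_bigr (fun e => X i e * Y j e)); last by move=> e _; ring.
  by rewrite rad_sum_prod big_enum/= /N rmorphXn rmorph_nat.
pose sN := Num.sqrt N.
have sN0 : 0 < sN by rewrite sqrtr_gt0.
have sN2 : sN ^+ 2 = N by rewrite sqr_sqrtr// ltW.
have T1 : normc (T (fun i e => cut (X i e)) (fun j e => cut (Y j e))) <= N * (49 * tau).
  rewrite /T.
  rewrite (_ : \sum_i _ = \sum_e 49 * \sum_i \sum_j t i j * (7^-1 * cut (X i e) * (7^-1 * cut (Y j e)))).
    rewrite (le_trans (normc_sum _ _))//.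
    apply: (@le_trans _ _ (\sum_(e : cube (size s)) 49 * tau)); last first.
      by rewrite sumr_const card_cube -(mulr_natl _ (2 ^ _)) natrX.
    apply: ler_sum => e _; rewrite normcM.
    have n7 (z : R[i]) : normc (7^-1 * cut z) <= 1.
      rewrite normcM -(rmorph_nat (real_complex R)) -rmorphV ?unitfE// normc_real.
      by rewrite ger0_norm// ler_pdivrMl// mulr1.
    rewrite -(rmorph_nat (real_complex R)) normc_real ger0_norm// ler_pM2l//.
    by apply: t_le => *; exact: n7.
  under [RHS]eq_bigr do rewrite mulr_sumr.
  rewrite [RHS]exchange_big/=; apply: eq_bigr => i _.
  under [RHS]eq_bigr do rewrite mulr_sumr.
  rewrite [RHS]exchange_big/=; apply: eq_bigr => j _.
  by rewrite mulr_sumr; apply: eq_bigr => e _; field.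
have T2 : normc (T (fun i e => cut (X i e)) (fun j e => Y j e - cut (Y j e))) <= c * (sN * (sN / 4)).
  apply: hilbert_bound_scale => // [|i|j]; first by rewrite divr_gt0.
    by rewrite sN2 (le_trans _ (E2 _ (p1 i)))//; apply: ler_sum.
  by rewrite exprMn sN2 (le_trans (E4 _ (q1 j)))// exprVn; lra.
have T3 : normc (T (fun i e => X i e - cut (X i e)) Y) <= c * (sN / 4 * sN).
  apply: hilbert_bound_scale => // [|i|j]; first by rewrite divr_gt0.
    by rewrite exprMn sN2 (le_trans (E4 _ (p1 i)))// exprVn; lra.
  by rewrite sN2; exact: E2.
rewrite -(ler_pM2l N0) -[X in X * _ <= _]ger0_norm ?(ltW N0)// -normc_real -normcM TE.
rewrite (le_trans (normcD _ _))// (le_trans (lerD T1 (le_trans (normcD _ _) (lerD T2 T3))))//.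
rewrite -sN2; lra.
Qed.

Lemma tau_ge0 : 0 <= tau.
Proof.
have := @t_le (fun=> 0) (fun=> 0); rewrite normc0 => /(_ (fun=> ler01) (fun=> ler01)).
by apply: le_trans; exact: normc_ge0.
Qed.

Theorem grothendieck_inequality : hilbert_bound (98 * tau).
Proof.
pose B := \sum_i \sum_j normc (t i j).
have B0 : 0 <= B by do 2!apply: sumr_ge0 => ? _; exact: normc_ge0.
have hn (n : nat) : hilbert_bound (98 * tau + B / 2 ^+ n).
  elim: n => [|n IH].
    move=> K p q p1 q1; rewrite (le_trans (hilbert_bound_trivial p1 q1))//.
    by rewrite expr0 divr1 lerDr mulr_ge0// tau_ge0.
  have := hilbert_bound_improve _ IH.
  rewrite (_ : 49 * tau + _ = 98 * tau + B / 2 ^+ n.+1).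
    by apply; rewrite addr_ge0 ?mulr_ge0 ?tau_ge0 ?invr_ge0 ?exprn_ge0.
  by rewrite exprS invfM; lra.
move=> K p q p1 q1; apply/ler_addgt0Pr => e e0.
pose n := (Num.truncn (B / e)).+1.
rewrite (le_trans (hn n _ _ _ p1 q1))// lerD2l ler_pdivrMr ?exprn_gt0// mulrC.
rewrite -ler_pdivrMr//; apply: (@le_trans _ _ n%:R).
  by rewrite ltW// truncnS_gt.
by rewrite -natrX ler_nat ltnW// ltn_expl.
Qed.

End Grothendieck.

Lemma mul_conj_normc (R : realType) (z : R[i]) : z * z^*%C = (normc z ^+ 2)%:C.
Proof.
case: z => x y; apply/eqP; rewrite eq_complex /= sqr_sqrtr ?addr_ge0 ?sqr_ge0//.
by apply/andP; split; apply/eqP; ring.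
Qed.

Section GramSchmidt.
Variables (R : realType) (H : normedModType R[i]) (dot : {dot H for @conjc R}).
Hypothesis dot_norm : forall x : H, `|x| ^+ 2 = dot x x.

Lemma dotC x y : dot x y = (dot y x)^*%C.
Proof. by rewrite (hermitian_subproof x y) expr0 mul1r. Qed.

Lemma dotDl x y z : dot (x + y) z = dot x z + dot y z.
Proof. exact: linearDl. Qed.

Lemma dotZl (a : R[i]) x z : dot (a *: x) z = a * dot x z.
Proof. exact: linearZl. Qed.

Lemma dot0l z : dot 0 z = 0.
Proof. by rewrite -(scale0r 0) dotZl mul0r. Qed.

Lemma dot_suml (I : Type) (r : seq I) (F : I -> H) z :
  dot (\sum_(i <- r) F i) z = \sum_(i <- r) dot (F i) z.
Proof.
by elim: r => [|i r IH]; rewrite ?big_nil ?dot0l// !big_cons dotDl IH.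
Qed.

Lemma dotBl x y z : dot (x - y) z = dot x z - dot y z.
Proof. by rewrite -scaleN1r dotDl dotZl mulN1r. Qed.

Lemma dotxx x : dot x x = (rnorm x ^+ 2)%:C.
Proof. by rewrite -dot_norm normE rmorphXn. Qed.

Definition orthonormal_seq (es : seq H) :=
  uniq es /\ forall e f, e \in es -> f \in es -> dot e f = (e == f)%:R.

Definition spans (es : seq H) v := v = \sum_(e <- es) dot v e *: e.

Lemma dot_comb es (a : H -> R[i]) f : orthonormal_seq es -> f \in es ->
  dot (\sum_(e <- es) a e *: e) f = a f.
Proof.
move=> [ues oes] fes; rewrite dot_suml (bigD1_seq f)//= dotZl oes// eqxx mulr1.
rewrite big_seq_cond big1 ?addr0// => e /andP[ees ef].
by rewrite dotZl oes// (negPf ef) mulr0.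
Qed.

Lemma rnorm_comb es (a : H -> R[i]) : orthonormal_seq es ->
  rnorm (\sum_(e <- es) a e *: e) ^+ 2 = \sum_(e <- es) normc (a e) ^+ 2.
Proof.
move=> oes; apply: (@complexI R); rewrite -dotxx {1}dot_suml rmorph_sum.
rewrite big_seq [RHS]big_seq; apply: eq_bigr => e ees.
by rewrite dotZl dotC dot_comb// mul_conj_normc.
Qed.

Lemma gram_schmidt (vs : seq H) :
  exists es, orthonormal_seq es /\ forall v, v \in vs -> spans es v.
Proof.
elim: vs => [|v vs [es [oes ses]]]; first by exists [::].
pose r := v - \sum_(e <- es) dot v e *: e.
have re e : e \in es -> dot r e = 0 by move=> ees; rewrite dotBl dot_comb// subrr.
have [r0|r0] := eqVneq r 0.
  exists es; split=> // v'; rewrite inE => /predU1P[->|/ses//].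
  by apply/eqP; rewrite -subr_eq0; apply/eqP.
have n0 : rnorm r != 0 by apply: contra r0 => /eqP/rnorm0_eq0 ->.
pose e0 := (rnorm r)^-1%:C *: r.
have e0e e : e \in es -> dot e0 e = 0 by move=> /re ree; rewrite dotZl ree mulr0.
have ee0 e : e \in es -> dot e e0 = 0 by move=> ees; rewrite dotC e0e// rmorph0.
have re0 : dot r e0 = (rnorm r)%:C.
  rewrite dotC dotZl dotxx -rmorphM conjc_real expr2 mulKf//.
have e0e0 : dot e0 e0 = 1 by rewrite dotZl re0 -rmorphM mulVf.
have e0n : e0 \notin es.
  apply/negP => /e0e; rewrite e0e0 => /eqP; by rewrite oner_eq0.
exists (e0 :: es); split.
  split; first by rewrite /= e0n oes.1.
  move=> e f; rewrite !inE => /predU1P[->|ees] /predU1P[->|fes].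
  - by rewrite eqxx.
  - by rewrite e0e//; case: eqP => // e0f; rewrite -e0f (negPf e0n) in fes.
  - by rewrite ee0//; case: eqP => // e0f; rewrite e0f (negPf e0n) in ees.
  - exact: oes.2.
have span0 w : spans es w -> dot w e0 = 0.
  move=> ->; rewrite dot_suml big_seq big1// => e ees.
  by rewrite dotZl ee0// mulr0.
move=> w; rewrite inE => /predU1P[->|/ses sw]; rewrite /spans big_cons; last first.
  by rewrite span0// scale0r add0r.
have -> : dot v e0 = (rnorm r)%:C.
  rewrite -re0 /r [RHS]dotBl dot_suml big_seq big1 ?subr0// => e ees.
  by rewrite dotZl ee0// mulr0.
by rewrite scalerA -rmorphM mulfV// scale1r /r subrK.
Qed.

Lemma orthonormal_functional es (u : H -> R[i]) (d : R) : orthonormal_seq es ->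
  (forall a x y, u (a *: x + y) = a * u x + u y) ->
  (forall x, normc (u x) <= d * rnorm x) -> 0 <= d ->
  \sum_(e <- es) normc (u e) ^+ 2 <= d ^+ 2.
Proof.
move=> oes ul ud d0.
have u0 : u 0 = 0.
  by apply: (addrI (u 0)); have := ul 1 0 0; rewrite scale1r addr0 addr0 mul1r => <-.
have usum (a : H -> R[i]) : u (\sum_(e <- es) a e *: e) = \sum_(e <- es) a e * u e.
  by elim: (es) => [|e es' IH]; rewrite ?big_nil// !big_cons ul IH.
pose x := \sum_(e <- es) normc (u e) ^+ 2.
pose w := \sum_(e <- es) (u e)^*%C *: e.
have x0 : 0 <= x by apply: sumr_ge0 => e _; exact: sqr_ge0.
have wx : rnorm w ^+ 2 = x.
  by rewrite rnorm_comb//; apply: eq_bigr => e _; rewrite normc_conj.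
have uw : u w = x%:C.
  rewrite usum rmorph_sum; apply: eq_bigr => e _.
  by rewrite mulrC mul_conj_normc.
have := ud w; rewrite uw normc_real ger0_norm// => xw.
rewrite -/x; have [->|xn0] := eqVneq x 0; first exact: sqr_ge0.
have xp : 0 < x by rewrite lt_def xn0.
rewrite -(ler_pM2l xp) -[X in _ <= X * _]wx -exprMn mulrC.
by rewrite -expr2 ler_pXn2r ?nnegrE ?mulr_ge0 ?rnorm_ge0// mulrC.
Qed.

Variables (I J : finType) (t : I -> J -> R[i]) (tau : R).
Hypothesis t_le : forall (x : I -> R[i]) (y : J -> R[i]),
  (forall i, normc (x i) <= 1) -> (forall j, normc (y j) <= 1) ->
  normc (\sum_i \sum_j t i j * (x i * y j)) <= tau.

Lemma grothendieck_hilbert (u : I -> H -> R[i]) (v : J -> H) (c d : R) :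
  0 < c -> 0 < d -> (forall i a x y, u i (a *: x + y) = a * u i x + u i y) ->
  (forall i x, normc (u i x) <= d * rnorm x) -> (forall j, rnorm (v j) <= c) ->
  normc (\sum_i \sum_j t i j * u i (v j)) <= 98 * tau * (d * c).
Proof.
move=> c0 d0 ul ud vc.
have [es [oes ses]] := gram_schmidt [seq v j | j <- enum J].
have {}ses j : spans es (v j).
  by apply: ses; apply/mapP; exists j => //; rewrite mem_enum.
pose k2 (k : 'I_(size es)) := nth 0 es k.
have sumE (F : H -> R[i]) : \sum_(e <- es) F e = \sum_k F (k2 k).
  by rewrite (big_nth 0) big_mkord.
have sumER (F : H -> R) : \sum_(e <- es) F e = \sum_k F (k2 k).
  by rewrite (big_nth 0) big_mkord.
have u0 i : u i 0 = 0.
  by apply: (addrI (u i 0)); have := ul i 1 0 0; rewrite scale1r addr0 addr0 mul1r => <-.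
have usum i (a : H -> R[i]) : u i (\sum_(e <- es) a e *: e) = \sum_(e <- es) a e * u i e.
  by elim: (es) => [|e es' IH]; rewrite ?big_nil// !big_cons ul IH.
rewrite (_ : \sum_i _ = \sum_i \sum_j t i j * \sum_k u i (k2 k) * dot (v j) (k2 k)).
  apply: (hilbert_bound_scale _ d0 c0).
  - exact: grothendieck_inequality t_le.
  - by move=> i; rewrite -(sumER (fun e => normc (u i e) ^+ 2)); apply: orthonormal_functional => //; exact: ltW.
  - move=> j; rewrite -(sumER (fun e => normc (dot (v j) e) ^+ 2)) -rnorm_comb//.
    by rewrite -ses ler_pXn2r ?nnegrE ?rnorm_ge0// ltW.
apply: eq_bigr => i _; apply: eq_bigr => j _; congr (_ * _).
rewrite {1}(ses j) usum sumE; apply: eq_bigr => k _; exact: mulrC.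
Qed.

End GramSchmidt.

Section Ell1Facts.
Variables (R : realType) (G : groupType) (w : weight R G).
Local Notation A := (ell1 w).

Lemma csum_single (I : choiceType) (a : I -> R[i]) x :
  (forall y, y != x -> a y = 0) -> csum a = a x.
Proof.
move=> a0.
have single (b : I -> R) : (forall y, 0 <= b y) -> (forall y, y != x -> b y = 0) ->
    fine (\esum_(y in [set: I]) (b y)%:E)%E = b x.
  move=> bp b0; rewrite -[RHS]/(fine (b x)%:E); congr fine.
  rewrite -(@esum_set1 R I x (fun y => (b y)%:E)) ?lee_fin//.
  rewrite [RHS]esum_mkcond; apply: eq_esum => y _.
  have [->|/eqP yx] := eqVneq y x; first by rewrite mem_set.
  by rewrite memNset// b0//; apply/eqP.
have rs (b : I -> R) : (forall y, y != x -> b y = 0) -> rsum b = b x.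
  move=> b0; rewrite /rsum (single (fun y => Num.max (b y) 0)).
  - rewrite (single (fun y => Num.max (- b y) 0)) -?posneg// => y; first exact: pos_ge0.
    by move=> /b0 ->; rewrite oppr0 maxxx.
  - by move=> y; exact: pos_ge0.
  - by move=> y /b0 ->; rewrite maxxx.
rewrite /csum !rs; first by case: (a x).
  by move=> y /a0 ->.
by move=> y /a0 ->.
Qed.

Definition delta_fun (x : G) : G -> R[i]^o := fun y => (y == x)%:R.

Lemma wsum_delta x : wsum w (delta_fun x) = (w x)%:E.
Proof.
rewrite /wsum -(@esum_set1 R G x (fun y => (w y)%:E)) ?lee_fin ?weight_ge0//.
rewrite [RHS]esum_mkcond; apply: eq_esum => y _; rewrite /delta_fun.
have [->|/eqP yx] := eqVneq y x; first by rewrite mem_set// normc1 mul1r.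
by rewrite memNset// normc0 mul0r.
Qed.

Lemma delta_pred x : delta_fun x \in ell1_pred w.
Proof. by apply/asboolP; rewrite wsum_delta ltry. Qed.

Definition delta x : A := Ell1 (delta_pred x).

Lemma rnorm_ell1 (f : A) : rnorm f = ell1_norm f.
Proof. by []. Qed.

Lemma rnorm_delta x : rnorm (delta x) = w x.
Proof. by apply: EFin_inj; rewrite rnorm_ell1 ell1_normE wsum_delta. Qed.

Lemma amul_delta1 (f : A) : amul (delta 1%g) f = f.
Proof.
apply/val_inj/funext => x; rewrite -[LHS]/(amul (delta 1%g) f x) ell1_amulE.
rewrite (@csum_single _ _ 1%g) => [|y y1].
  by rewrite /= /delta_fun eqxx mul1r invg1 mul1g.
by rewrite /= /delta_fun (negPf y1) mul0r.
Qed.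

Section Form.
Variable al : G -> R[i].
Hypothesis al_le : forall x, normc (al x) <= w x.

Definition ell1_form (f : A) : R[i]^o := csum (fun x => f x * al x).

Let esum_form (f : A) :
  (\esum_(x in [set: G]) (normc (f x * al x))%:E <= wsum w f)%E.
Proof.
apply: le_esum => x _; rewrite lee_fin normcM.
by rewrite ler_wpM2l ?normc_ge0.
Qed.

Let form_summable (f : A) : csummable (fun x => f x * al x).
Proof. by rewrite /csummable (le_lt_trans (esum_form f))// -ell1_normE ltry. Qed.

Lemma ell1_form_dual_ball : dual_ball A ell1_form.
Proof.
split=> [a f g|f].
  rewrite /ell1_form -[a *: csum _]/(a * csum _) -csumZ// -csumD//.
    by congr csum; apply/funext => x; rewrite mulrA -mulrDl.
  exact: csummableZ.
rewrite -[leLHS]/((normc (ell1_form f))%:C) normE lecR rnorm_ell1.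
by rewrite -lee_fin ell1_normE (le_trans (normc_csum _)).
Qed.

End Form.

Lemma ell1_norming (f : A) : exists phi : dual_ball A, rnorm f <= normc (val phi f).
Proof.
pose al (x : G) : R[i] := (f x)^*%C / (normc (f x))%:C * (w x)%:C.
have al_le x : normc (al x) <= w x.
  rewrite /al !normcM normcV normc_conj !normc_real !ger0_norm ?normc_ge0 ?weight_ge0//.
  have [->|n0] := eqVneq (normc (f x)) 0; first by rewrite mul0r mul0r weight_ge0.
  by rewrite mulfV// mul1r.
have fal x : f x * al x = (normc (f x) * w x)%:C.
  rewrite /al mulrA mulrA mul_conj_normc !rmorphM/=; congr (_ * _).
  have [->|n0] := eqVneq (normc (f x)) 0; first by rewrite !mul0r.
  rewrite mulfK//.
  by apply: contra n0; rewrite -(inj_eq (@complexI R)).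
exists (SigSub (mem_set (ell1_form_dual_ball al_le))); 
rewrite -[leRHS]/(normc (ell1_form al f)).
apply: le_trans (Re_le_normc _); apply: le_trans (ler_norm _).
rewrite /= rsum_ge0E => [|x]; last by rewrite fal mulr_ge0 ?normc_ge0 ?weight_ge0.
rewrite rnorm_ell1 /ell1_norm /wsum.
by under [in leRHS]eq_esum do rewrite fal.
Qed.

Definition restrict (r : seq G) (f : A) : A := \sum_(x <- r) f x *: delta x.

Lemma ell1_sumE (I : Type) (s : seq I) (F : I -> A) x :
  (\sum_(i <- s) F i) x = \sum_(i <- s) F i x.
Proof. by elim: s => [|i s IH]; rewrite ?big_nil// !big_cons -IH. Qed.

Lemma restrictE r f x : uniq r -> restrict r f x = if x \in r then f x else 0.
Proof.
move=> ur; rewrite /restrict ell1_sumE.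
rewrite (eq_bigr (fun y => f y * (x == y)%:R))//.
case: ifP => xr.
  rewrite (bigD1_seq x)//= eqxx mulr1 big1 ?addr0// => y yx.
  by rewrite eq_sym (negPf yx) mulr0.
rewrite big_seq big1// => y yr; case: eqP => [xy|]; last by rewrite mulr0.
by rewrite xy yr in xr.
Qed.

Lemma ell1_norm_leP (f : A) (e : R) : rnorm f <= e <->
  forall r : seq G, uniq r -> \sum_(x <- r) normc (f x) * w x <= e.
Proof.
rewrite rnorm_ell1 -lee_fin ell1_normE wsum_leP; split=> [h r ur|h _ [r ur ->]].
  have := h [seq (x, w x) | x <- r]; rewrite big_map/=.
  by under eq_bigr do rewrite mulrC; apply; exists r.
by rewrite big_map; under eq_bigr do rewrite mulrC; exact: h.
Qed.

Lemma restrict_approx (f : A) (e : R) : 0 < e -> exists r : seq G,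
  forall r', uniq r' -> {subset r <= r'} -> rnorm (f - restrict r' f) <= e.
Proof.
move=> e0.
have [X uX fX] : exists2 X : seq G, uniq X &
    rnorm f - e < \sum_(x <- X) normc (f x) * w x.
  apply: contrapT => /forall2NP h.
  have : rnorm f <= rnorm f - e.
    by apply/ell1_norm_leP => r ur; have [//|/negP] := h r; rewrite -leNgt.
  by rewrite lerBrDr gerDl leNgt e0.
exists X => r ur Xr; apply/ell1_norm_leP => s us.
pose s' := [seq x <- s | x \notin r].
have -> : \sum_(x <- s) normc ((f - restrict r f) x) * w x =
    \sum_(x <- s') normc (f x) * w x.
  rewrite big_filter [RHS]big_mkcond; apply: eq_bigr => x _.
  rewrite -[(f - _) x]/(f x - restrict r f x) restrictE//.
  by case: ifP => _; rewrite ?subr0// subrr normc0 mul0r.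
have uXs : uniq (X ++ s').
  rewrite cat_uniq uX filter_uniq// andbT /=; apply/hasPn => x.
  by rewrite mem_filter => /andP[xr _]; apply: contra xr; exact: Xr.
have /ell1_norm_leP/(_ _ uXs) := lexx (rnorm f); rewrite big_cat/=; lra.
Qed.

Lemma restrict_approx_seq (fs : seq A) (e : R) : 0 < e -> exists2 r : seq G, uniq r &
  forall f, f \in fs -> rnorm (f - restrict r f) <= e.
Proof.
move=> e0.
have /choice[X HX] f := @restrict_approx f e e0.
exists (undup (flatten [seq X f | f <- fs])); first exact: undup_uniq.
move=> f ffs; apply: HX; first exact: undup_uniq.
by move=> x xf; rewrite mem_undup; apply/flattenP; exists (X f) => //; apply: map_f.
Qed.

Definition finite_form (r : seq G) (al : 'I_(size r) -> R[i]) (f : A) : R[i]^o :=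
  \sum_(i < size r) f (nth 1%g r i) * ((w (nth 1%g r i))%:C * al i).

Lemma finite_form_dual_ball r al : uniq r -> (forall i, normc (al i) <= 1) ->
  dual_ball A (@finite_form r al).
Proof.
move=> ur al1; split=> [a f g|f].
  rewrite -[a *: finite_form al f]/(a * finite_form al f) /finite_form mulr_sumr -big_split /=.
  by apply: eq_bigr => i _; rewrite -[LHS]/((a * f _ + g _) * _) mulrDl -mulrA.
rewrite -[leLHS]/((normc (finite_form al f))%:C) normE lecR.
rewrite (le_trans (normc_sum _ _))//.
have /ell1_norm_leP/(_ _ ur) := lexx (rnorm f); apply: le_trans.
rewrite (big_nth 1%g) big_mkord; apply: ler_sum => i _.
rewrite !normcM normc_real ger0_norm ?weight_ge0// ler_wpM2l ?normc_ge0//.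
by rewrite ler_piMr// weight_ge0.
Qed.

End Ell1Facts.

Section OperatorAlgebraBound.
Variables (R : realType) (G : groupType) (w : weight R G).
Local Notation A := (ell1 w).
Variables (H : normedModType R[i]) (dot : {dot H for @conjc R}).
Hypothesis dot_norm : forall x : H, `|x| ^+ 2 = dot x x.
Variables (Phi : {linear A -> bounded_op H}) (c d : R).
Hypotheses (c0 : 0 < c) (d0 : 0 < d)
  (PhiM : forall a b, Phi (amul a b) = comp_op (Phi a) (Phi b))
  (lowPhi : forall a, rnorm a <= c * rnorm (Phi a))
  (upPhi : forall a, rnorm (Phi a) <= d * rnorm a).

Lemma dot_cauchy_schwarz x y : normc (dot x y) <= rnorm x * rnorm y.
Proof.
have [->|y0] := eqVneq y 0.
  by rewrite dotC dot0l rmorph0 normc0 rnorm0 mulr0.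
have n0 : rnorm y != 0 by apply: contra y0 => /eqP/rnorm0_eq0 ->.
have np : 0 < rnorm y by rewrite lt_def n0 rnorm_ge0.
pose a := dot x y / (rnorm y ^+ 2)%:C; pose z := x - a *: y.
have n2 : (rnorm y ^+ 2)%:C != 0 :> R[i].
  by rewrite -[0]/(0%:C) (inj_eq (@complexI R)) expf_neq0.
have zy : dot z y = 0.
  by rewrite dotBl dotZl (dotxx dot_norm) /a divfK// subrr.
have yz : dot y z = 0 by rewrite dotC zy rmorph0.
have zz : dot z z = (rnorm x ^+ 2 - normc (dot x y) ^+ 2 / rnorm y ^+ 2)%:C.
  rewrite {1}/z dotBl dotZl yz mulr0 subr0 dotC dotBl dotZl (dotxx dot_norm).
  rewrite /a (dotC dot y) mulrAC mul_conj_normc -fmorphV -rmorphM -rmorphB/=.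
  by rewrite oppr0.
have : 0 <= rnorm z ^+ 2 by exact: sqr_ge0.
have /complexI -> : (rnorm z ^+ 2)%:C = _ := etrans (esym (dotxx dot_norm z)) zz.
rewrite subr_ge0 ler_pdivrMr ?exprn_gt0// -exprMn.
by rewrite ler_pXn2r ?nnegrE ?mulr_ge0 ?normc_ge0 ?rnorm_ge0.
Qed.

Lemma op_linearP (T : bounded_op H) : linear T.
Proof. by have /asboolP[] := op_funP T. Qed.

Lemma comp_opE (S T : bounded_op H) x : comp_op S T x = S (T x).
Proof. by []. Qed.

Lemma op_sum (I : Type) (s : seq I) (F : I -> bounded_op H) x :
  (\sum_(i <- s) F i) x = \sum_(i <- s) F i x.
Proof. by elim: s => [|i s IH]; rewrite ?big_nil// !big_cons -IH. Qed.

Lemma op0 (T : bounded_op H) : T 0 = 0.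
Proof.
by apply: (addrI (T 0)); have := op_linearP T 1 0 0; rewrite !scale1r !addr0 => <-.
Qed.

Lemma op_comb (T : bounded_op H) (I : Type) (s : seq I) (a : I -> R[i]) (F : I -> H) :
  T (\sum_(i <- s) a i *: F i) = \sum_(i <- s) a i *: T (F i).
Proof.
by elim: s => [|i s IH]; rewrite ?big_nil ?op0// !big_cons op_linearP IH.
Qed.

Lemma restrict_op (r : seq G) (f : A) h :
  Phi (restrict r f) h = \sum_(x <- r) f x *: Phi (delta w x) h.
Proof.
rewrite /restrict linear_sum op_sum; apply: eq_bigr => x _.
by rewrite linearZ.
Qed.

(* Grothendieck's inequality for the coefficients [t] of the finitely supported
   tensor, applied to the vectors [Phi(delta_y) xi / w y] and to the functionals
   [h |-> <Phi(delta_x) h, eta> / w x]. *)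
Lemma restrict_bound (s : seq (A * A)) (e : R) (r : seq G) : uniq r ->
  (forall p : dual_pair A A, normc (tensor_form s p) <= e) ->
  rnorm (\sum_(t <- s) amul (restrict r t.1) (restrict r t.2)) <=
  c * (98 * e * (d * d)).
Proof.
move=> ur se; pose X (i : 'I_(size r)) := nth 1%g r i.
have e0 : 0 <= e by exact: le_trans (normc_ge0 _) (se (dual_pair0 A A)).
rewrite (le_trans (lowPhi _))// ler_pM2l//; set T := Phi _.
rewrite -[rnorm T]/(op_norm T); apply/op_normP => [|xi].
  by rewrite !mulr_ge0// ltW.
set eta := T xi.
have [->|eta0] := eqVneq eta 0.
  by rewrite rnorm0 !mulr_ge0 ?rnorm_ge0// ltW.
have ne : 0 < rnorm eta.
  by rewrite lt_def rnorm_ge0 andbT; apply: contra eta0 => /eqP/rnorm0_eq0 ->.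
have nx : 0 < rnorm xi.
  have := op_norm_ub T xi; rewrite -/eta lt_def rnorm_ge0 andbT.
  by apply: contraTneq => ->; rewrite mulr0 -ltNge.
have w0 i : w (X i) != 0 by rewrite gt_eqF// weight_gt0.
pose t (i j : 'I_(size r)) : R[i] :=
  \sum_(p <- s) (p.1 (X i) * (w (X i))%:C) * (p.2 (X j) * (w (X j))%:C).
pose u (i : 'I_(size r)) (h : H) : R[i] := (w (X i))^-1%:C * dot (Phi (delta w (X i)) h) eta.
pose v (j : 'I_(size r)) : H := (w (X j))^-1%:C *: Phi (delta w (X j)) xi.
have wV i : `|(w (X i))^-1| = (w (X i))^-1.
  by rewrite ger0_norm// invr_ge0 weight_ge0.
have Pd i h : (w (X i))^-1 * rnorm (Phi (delta w (X i)) h) <= d * rnorm h.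
  rewrite ler_pdivrMl ?weight_gt0// (le_trans (op_norm_ub _ _))// mulrA.
  rewrite ler_wpM2r ?rnorm_ge0// -[op_norm _]/(rnorm (Phi (delta w (X i)))) (le_trans (upPhi _))//.
  by rewrite rnorm_delta mulrC.
have teta : dot eta eta = \sum_i \sum_j t i j * u i (v j).
  rewrite {1}/eta /T linear_sum op_sum (dot_suml dot) .
  under [RHS]eq_bigr => i _ do under eq_bigr => j _ do rewrite mulr_suml.
  under [RHS]eq_bigr => i _ do rewrite exchange_big.
  rewrite [RHS]exchange_big; apply: eq_bigr => p _.
  rewrite PhiM comp_opE restrict_op dot_suml (big_nth 1%g) big_mkord; apply: eq_bigr => i _.
  rewrite restrict_op op_comb dotZl dot_suml mulr_sumr (big_nth 1%g) big_mkord.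
  apply: eq_bigr => j _; rewrite -/(X i) -/(X j) dotZl /u /v.
  rewrite -[(w (X j))^-1%:C *: _]addr0 op_linearP dotDl dotZl.
  rewrite op0 dot0l addr0 !fmorphV.
  set D := dot _ _; set p1 := p.1 _; set p2 := p.2 _.
  have hi : (w (X i))%:C != 0 :> R[i].
    by rewrite -[0]/(0%:C) (inj_eq (@complexI R)).
  have hj : (w (X j))%:C != 0 :> R[i].
    by rewrite -[0]/(0%:C) (inj_eq (@complexI R)).
  by field; rewrite hi hj.
have tle (x y : 'I_(size r) -> R[i]) : (forall i, normc (x i) <= 1) ->
    (forall j, normc (y j) <= 1) -> normc (\sum_i \sum_j t i j * (x i * y j)) <= e.
  move=> x1 y1.
  have fx := mem_set (finite_form_dual_ball w ur x1).
  have fy := mem_set (finite_form_dual_ball w ur y1).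
  have := se (SigSub fx, SigSub fy); rewrite tensor_formE /=.
  rewrite (_ : \sum_(p <- s) _ = \sum_i \sum_j t i j * (x i * y j))//.
  under [RHS]eq_bigr => i _ do under eq_bigr => j _ do rewrite mulr_suml.
  under [RHS]eq_bigr => i _ do rewrite exchange_big.
  rewrite [RHS]exchange_big; apply: eq_bigr => p _.
  rewrite /finite_form mulr_suml; apply: eq_bigr => i _.
  rewrite mulr_sumr; apply: eq_bigr => j _; rewrite -/(X i) -/(X j); ring.
have := @grothendieck_hilbert R H dot dot_norm _ _ t e tle u v (d * rnorm xi)
  (d * rnorm eta).
rewrite -teta (dotxx dot_norm) normc_real ger0_norm ?sqr_ge0// => gh.
rewrite -(ler_pM2l ne) -expr2 (le_trans (gh _ _ _ _ _)) ?mulr_gt0//.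
- move=> i a x y; rewrite /u op_linearP dotDl dotZl; ring.
- move=> i x; rewrite /u normcM normc_real wV.
  rewrite (le_trans (ler_wpM2l _ (dot_cauchy_schwarz _ _))) ?invr_ge0 ?weight_ge0//.
  by rewrite mulrA [leRHS]mulrAC ler_wpM2r ?rnorm_ge0.
- by move=> j; rewrite /v rnormZ normc_real wV.
- by rewrite le_eqVlt; apply/orP; left; apply/eqP; ring.
Qed.

Lemma operator_algebra_bounded : injectively_bounded A (c * (98 * (d * d))).
Proof.
move=> s e se; apply/ler_addgt0Pr => k k0.
pose M : R := \sum_(t <- s) (rnorm t.1 + rnorm t.2 + 1).
have M0 : 0 <= M by apply: sumr_ge0 => t _; rewrite !addr_ge0 ?rnorm_ge0.
have M1 : 0 < M + 1 by rewrite ltr_wpDl.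
pose b := Num.min 1 (k / (M + 1)).
have b0 : 0 < b by rewrite lt_min ltr01 divr_gt0.
have b1 : b <= 1 by rewrite ge_min lexx.
have bk : b <= k / (M + 1) by rewrite ge_min lexx orbT.
have [r ur hr] := restrict_approx_seq ([seq t.1 | t <- s] ++ [seq t.2 | t <- s]) b0.
rewrite -(subrK (\sum_(t <- s) amul (restrict r t.1) (restrict r t.2)) (\sum_(t <- s) _)).
rewrite (le_trans (rnormD _ _))// addrC lerD//.
  by rewrite (le_trans (restrict_bound ur se))// le_eqVlt; apply/orP; left; apply/eqP; ring.
rewrite -sumrB.
have amulB (f f' g g' : A) : rnorm (amul f g - amul f' g') <=
    rnorm f * rnorm (g - g') + rnorm (f - f') * rnorm g'.
  have nM (x y : A) : rnorm (amul x y) <= rnorm x * rnorm y.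
    by rewrite -lecR rmorphM/= -!normE amul_norm.
  have -> : amul f g - amul f' g' = amul f (g - g') + amul (f - f') g'.
    rewrite -(scaleN1r g') -(scaleN1r f') amulDr amulDl amulZr amulZl !scaleN1r.
    by rewrite subrKA.
  by rewrite (le_trans (rnormD _ _))// lerD.
apply: (@le_trans _ _ (\sum_(t <- s) (rnorm t.1 + rnorm t.2 + 1) * b)).
  have : forall t, t \in s -> rnorm (t.1 - restrict r t.1) <= b /\
      rnorm (t.2 - restrict r t.2) <= b.
    by move=> t ts; split; apply: hr; rewrite mem_cat; apply/orP; [left|right];
      apply: map_f.
  elim: (s) => [_|t s' IH hs]; first by rewrite !big_nil rnorm0.
  rewrite !big_cons (le_trans (rnormD _ _))// lerD//; last first.
    by apply: IH => t' t's; apply: hs; rewrite inE t's orbT.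
  have [h1 h2] := hs t (mem_head _ _).
  have h3 : rnorm (restrict r t.2) <= rnorm t.2 + 1.
    rewrite -[restrict r t.2](subKr t.2) (le_trans (rnormD _ _))// rnormN.
    by rewrite lerD// (le_trans h2).
  rewrite (le_trans (amulB _ _ _ _))//.
  rewrite (le_trans (lerD (ler_wpM2l (rnorm_ge0 _) h2) (ler_pM _ _ h1 h3))) ?rnorm_ge0//.
  by rewrite le_eqVlt; apply/orP; left; apply/eqP; ring.
rewrite -mulr_suml -/M (le_trans (ler_wpM2l M0 bk))// mulrCA ler_piMr ?ltW//.
by rewrite ltr_pdivrMr// mul1r ltrDl.
Qed.

End OperatorAlgebraBound.

Theorem theorem2p8 (R : realType) (G : groupType) (w : weight R G) :
  injective_algebra (ell1 w) <-> isomorphic_to_operator_algebra (ell1 w).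
Proof.
split=> [/injective_algebra_bounded[C C0 AC]|].
  have [K [q [K0 qP]]] := injectively_bounded_qform C0 AC.
  apply: (@qform_isomorphic R (ell1 w) K q K0 _ _ _ (delta w 1%g)).
  - by move=> phi a b; have [] := qP phi a b.
  - by move=> phi a; have [] := qP phi a a.
  - by move=> phi a; have [] := qP phi a a.
  - exact: amul_delta1.
  - exact: ell1_norming.
move=> [H [B [Phi [Psi [[[dot dotN] _] PhiM [rPhi PhiK] bPhi [c Psic]]]]]].
have [d d0 upPhi] := bounded_mapP bPhi.
have c0 : 0 < normc c + 1 by rewrite ltr_wpDl// normc_ge0.
have low a : rnorm a <= (normc c + 1) * rnorm (Phi a).
  have /Psic : B (Phi a) by rewrite -rPhi; exists a.
  rewrite PhiK => h; have y0 := le_trans (normr_ge0 a) h.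
  rewrite (@le_trans _ _ (normc c * rnorm (Phi a)))//.
    rewrite -lecR rmorphM/= -!normE -[X in _ <= X * _]/(`|c|).
    by rewrite (le_trans h)// -[leLHS](ger0_norm y0) normrM normr_id.
  by rewrite mulrDl mul1r lerDl rnorm_ge0.
apply: (injectively_bounded_injective _ (operator_algebra_bounded dotN c0 d0 PhiM low upPhi)).
by rewrite !mulr_gt0.
Qed.
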